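(* Let $N\ge2$ and $A\in M_N(\{0,1\})$. If $K\in\{1,\ldots,N\}^\infty_A$ is eventually periodic, then there uniquely exists $J\in[1,\ldots,N]^*_A$ such that $$P(K)\sim\int^{\oplus}_{U(1)}P(J;c)\,d\eta(c),$$ where $\eta$ is the Haar measure of $U(1)$.
   Context: ${\bf N}=\{1,2,\ldots\}$, $U(1)=\{z\in{\bf C}:|z|=1\}$. $M_N(\{0,1\})$ is the set of $N\times N$ matrices with entries in $\{0,1\}$ having no row or column identically equal to zero. For $A=(a_{ij})\in M_N(\{0,1\})$, the Cuntz-Krieger algebra ${\cal O}_A$ is the $C^*$-algebra universally generated by partial isometries $s_1,\ldots,s_N$ satisfying $s_i^*s_i=\sum_{j=1}^N a_{ij}s_js_j^*$ for $i=1,\ldots,N$ and $\sum_{i=1}^N s_is_i^*=I$. A representation is a unital $*$-representation on a complex Hilbert space; $\sim$ between representations denotes unitary equivalence. $\{1,\ldots,N\}^\infty_A$ is the set of sequences $(j_n)_{n\in{\bf N}}$ in $\{1,\ldots,N\}$ with $a_{j_{n-1}j_n}=1$ for $n\ge2$. An infinite word is eventually periodic if it equals $J_0\cup J_1\cup J_1\cup J_1\cup\cdots$ (concatenation) for some nonempty finite words $J_0,J_1$. $\{1,\ldots,N\}^*_{A,c}$ is the set of finite words $(j_1,\ldots,j_k)$, $k\ge1$, with $a_{j_{i-1}j_i}=1$ for $i=2,\ldots,k$ and $a_{j_kj_1}=1$. A nonempty finite word is periodic if it is an $m$-fold concatenation $J_0^m$ of a nonempty finite word with $m\ge2$. A finite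 word $J=(j_1,\ldots,j_k)$ is minimal if $\sum_{l=1}^k(j'_l-j_l)N^{k-l}\ge0$ for every cyclic rotation $(j'_1,\ldots,j'_k)$ of $J$. $[1,\ldots,N]^*_A$ is the set of minimal, non periodic elements of $\{1,\ldots,N\}^*_{A,c}$. For $J=(j_l)_{l=1}^p$ finite and $z\in U(1)$, a representation $({\cal H},\pi)$ of ${\cal O}_A$ is $P(J;z)$ if there is a cyclic unit vector $\Omega$ with $\pi(s_{j_1}\cdots s_{j_p})\Omega=z\Omega$ and $\{\pi(s_{j_l}\cdots s_{j_p})\Omega\}_{l=1}^p$ orthonormal. For $K=(k_n)_{n\in{\bf N}}$ infinite, $({\cal H},\pi)$ is $P(K)$ if there is a cyclic unit vector $\Omega$ with $\{\pi(s_{k_n}^*\cdots s_{k_1}^* )\Omega\}_{n\in{\bf N}}$ orthonormal. For the words considered here such representations exist and are unique up to unitary equivalence, and the symbols also denote the equivalence classes. *)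

(* Defs.v *)
From HB Require Import structures.
From mathcomp Require Import all_boot all_order all_algebra.
From mathcomp Require Import all_classical all_reals all_analysis.
From mathcomp Require Import complex.

Set Implicit Arguments.
Unset Strict Implicit.
Unset Printing Implicit Defensive.

Import Order.TTheory GRing.Theory Num.Theory.
Import numFieldNormedType.Exports.
Local Open Scope classical_set_scope.
Local Open Scope complex_scope.
Local Open Scope ring_scope.

(* The alphabet {1, ..., N} is 'I_N = {0, ..., N-1}; an infinite word
    (k_n), n >= 1, is K : nat -> 'I_N with K n = k_(n+1). *)

Definition nonzero_lines (N : nat) (A : 'M[bool]_N) : Prop :=
  (forall i, exists j, A i j) /\ (forall j, exists i, A i j).

Definition admissible_word (N : nat) (A : 'M[bool]_N) (K : nat -> 'I_N) : Prop :=
  forall n, A (K n) (K n.+1).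

Definition word_power (T : Type) (J : seq T) (m : nat) : seq T :=
  flatten (nseq m J).

(* Every finite prefix of suitable length is J0 J1 J1 ... J1. *)
Definition eventually_periodic (T : Type) (K : nat -> T) : Prop :=
  exists J0 J1 : seq T, [/\ J0 <> [::], J1 <> [::] &
    forall m : nat, mkseq K (size J0 + m * size J1) = J0 ++ word_power J1 m].

(* path.cycle e [:: j_1; ...; j_k] says e j_(i-1) j_i for 2 <= i <= k
   and e j_k j_1. *)
Definition cyclic_word (N : nat) (A : 'M[bool]_N) (J : seq 'I_N) : Prop :=
  J <> [::] /\ cycle (fun i j => A i j) J.

Definition periodic_word (T : Type) (J : seq T) : Prop :=
  exists J0 m, [/\ J0 <> [::], (2 <= m)%N & J = word_power J0 m].

(* Only differences of letters occur, so starting the alphabet at 0 is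
   harmless. *)
Definition minimal_word (N : nat) (J : seq 'I_N) : Prop :=
  forall r : nat,
    0 <= \sum_(0 <= l < size J)
           ((nth 0%N (map val (rot r J)) l)%:Z - (nth 0%N (map val J) l)%:Z)
           * (N%:Z) ^+ (size J - l.+1) :> int.

Definition canonical_word (N : nat) (A : 'M[bool]_N) (J : seq 'I_N) : Prop :=
  [/\ cyclic_word A J, minimal_word J & ~ periodic_word J].

(* The inner product is linear on the left. *)

HB.mixin Record CompleteNormedModule_isHilbert (R : realType) H
    of CompleteNormedModule R[i] H := {
  hdot : H -> H -> R[i] ;
  hdotDl : forall x y z, hdot (x + y) z = hdot x z + hdot y z ;
  hdotZl : forall (a : R[i]) x y, hdot (a *: x) y = a * hdot x y ;
  hdotC : forall x y, hdot y x = Num.conj (hdot x y) ;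
  hdot_norm : forall x, hdot x x = `|x| ^+ 2
}.

#[short(type="hilbertType")]
HB.structure Definition Hilbert (R : realType) :=
  {H of CompleteNormedModule R[i] H & CompleteNormedModule_isHilbert R H}.

(* Norms take values in the nonnegative reals of R[i]. *)
Definition rnorm (R : realType) (H : hilbertType R) (x : H) : R :=
  complex.Re `|x|.

Definition orthonormal_family (R : realType) (H : hilbertType R) (I : eqType)
    (v : I -> H) : Prop :=
  forall i j, hdot (v i) (v j) = (i == j)%:R.

(* algType excludes the zero algebra, which changes nothing in the
   universal property below: every map into the zero algebra is the same. The
   norm is part of the mixin because the hierarchy has no common descendant of
   completeNormedModType and algType. *)
HB.mixin Record Algebra_isCStarAlg (R : realType) B
    of GRing.Algebra R[i] B := {
  star : B -> B ;
  starD : forall a b, star (a + b) = star a + star b ;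
  starZ : forall (z : R[i]) a, star (z *: a) = Num.conj z *: star a ;
  starM : forall a b, star (a * b) = star b * star a ;
  starK : forall a, star (star a) = a ;
  cnorm : B -> R ;
  cnorm0_eq0 : forall a, cnorm a = 0 -> a = 0 ;
  cnormD : forall a b, cnorm (a + b) <= cnorm a + cnorm b ;
  cnormZ : forall (z : R[i]) a, cnorm (z *: a) = complex.Re `|z| * cnorm a ;
  cnormM : forall a b, cnorm (a * b) <= cnorm a * cnorm b ;
  cnorm_star : forall a, cnorm (star a * a) = cnorm a ^+ 2 ;
  cnorm_complete : forall u : nat -> B,
    (forall e : R, 0 < e -> exists n0 : nat, forall m n : nat,
       (n0 <= m)%N -> (n0 <= n)%N -> cnorm (u m - u n) < e) ->
    exists l : B, forall e : R, 0 < e -> exists n0 : nat, forall n : nat,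
      (n0 <= n)%N -> cnorm (u n - l) < e
}.

#[short(type="cstarAlgType")]
HB.structure Definition CStarAlg (R : realType) :=
  {B of GRing.Algebra R[i] B & Algebra_isCStarAlg R B}.

Definition star_morphism (R : realType) (B C : cstarAlgType R) (f : B -> C) :
    Prop :=
  [/\ linear f, f 1 = 1, (forall a b, f (a * b) = f a * f b)
    & forall a, f (star a) = star (f a)].

Definition partial_isometry (R : realType) (B : cstarAlgType R) (t : B) : Prop :=
  t * star t * t = t.

Definition ck_relations (R : realType) (N : nat) (A : 'M[bool]_N)
    (B : cstarAlgType R) (t : 'I_N -> B) : Prop :=
  [/\ forall i, partial_isometry (t i),
      forall i, star (t i) * t i = \sum_(j < N) (A i j)%:R *: (t j * star (t j))
    & \sum_(i < N) t i * star (t i) = 1].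

(* (O, s) is O_A with its canonical generators. *)
Definition is_cuntz_krieger (R : realType) (N : nat) (A : 'M[bool]_N)
    (O : cstarAlgType R) (s : 'I_N -> O) : Prop :=
  ck_relations A s /\
  forall (B : cstarAlgType R) (t : 'I_N -> B), ck_relations A t ->
    exists! f : O -> B, star_morphism f /\ forall i, f (s i) = t i.

Definition bounded_operator (R : realType) (H : hilbertType R) (T : H -> H) :
    Prop :=
  linear T /\ exists M : R[i], forall x, `|T x| <= M * `|x|.

(* A unital *-morphism from O to the bounded operators on H. *)
Record is_representation (R : realType) (O : cstarAlgType R)
    (H : hilbertType R) (pi : O -> H -> H) : Prop := IsRepresentation {
  rep_bounded : forall a, bounded_operator (pi a) ;
  rep_linear : forall x, linear (fun a => pi a x) ;
  rep1 : forall x, pi 1 x = x ;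
  repM : forall a b x, pi (a * b) x = pi a (pi b x) ;
  rep_star : forall a x y, hdot (pi a x) y = hdot x (pi (star a) y)
}.

Definition unitarily_equivalent (R : realType) (O : cstarAlgType R)
    (H H' : hilbertType R) (pi : O -> H -> H) (pi' : O -> H' -> H') : Prop :=
  exists U : H -> H',
    [/\ linear U, (forall y, exists x, U x = y),
        (forall x y, hdot (U x) (U y) = hdot x y)
      & forall a x, U (pi a x) = pi' a (U x)].

Definition cyclic_vector (R : realType) (O : cstarAlgType R)
    (H : hilbertType R) (pi : O -> H -> H) (Omega : H) : Prop :=
  closure (range (fun a => pi a Omega)) = setT.

(* (H, pi) is P(J; z); drop l J is the word (j_(l+1), ..., j_p), 0 <= l < p. *)
Definition is_P_cycle (R : realType) (N : nat) (O : cstarAlgType R)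
    (s : 'I_N -> O) (J : seq 'I_N) (z : R[i])
    (H : hilbertType R) (pi : O -> H -> H) : Prop :=
  is_representation pi /\
  exists Omega : H,
    [/\ cyclic_vector pi Omega, `|Omega| = 1,
        pi (\prod_(j <- J) s j) Omega = z *: Omega
      & orthonormal_family
          (fun l : 'I_(size J) => pi (\prod_(j <- drop l J) s j) Omega)].

(* (H, pi) is P(K); the n-th product is s_(k_(n+1))^* ... s_(k_1)^*, n >= 0. *)
Definition is_P_chain (R : realType) (N : nat) (O : cstarAlgType R)
    (s : 'I_N -> O) (K : nat -> 'I_N)
    (H : hilbertType R) (pi : O -> H -> H) : Prop :=
  is_representation pi /\
  exists Omega : H,
    [/\ cyclic_vector pi Omega, `|Omega| = 1
      & orthonormal_family
          (fun n : nat => pi (\prod_(k <- rev (mkseq K n.+1)) star (s k)) Omega)].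

Definition circle_type (R : realType) : Type := {z : R[i] | `|z| == 1}.

HB.instance Definition _ (R : realType) := Choice.on (circle_type R).

Lemma circle_one_subproof (R : realType) : `|1 : R[i]| == 1.
Proof. by rewrite normr1. Qed.

Definition circle_one (R : realType) : circle_type R :=
  exist _ 1 (circle_one_subproof R).

HB.instance Definition _ (R : realType) :=
  isPointed.Build (circle_type R) (circle_one R).

Lemma circle_mul_subproof (R : realType) (c d : circle_type R) :
  `|val c * val d| == 1.
Proof. by rewrite normrM (eqP (valP c)) (eqP (valP d)) mulr1. Qed.

Definition circle_mul (R : realType) (c d : circle_type R) : circle_type R :=
  exist _ (val c * val d) (circle_mul_subproof c d).

Definition circle_open (R : realType) : set (set (circle_type R)) :=
  [set V | exists2 W : set (R[i])^o, open W & V = [set c | W (val c)]].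

(* U(1) with its Borel sigma-algebra. *)
Definition circle (R : realType) := g_sigma_algebraType (@circle_open R).

HB.instance Definition _ (R : realType) := Measurable.on (circle R).

(* eta is the rotation-invariant Borel probability measure. *)
Definition is_haar (R : realType) (eta : probability (circle R) R) : Prop :=
  forall (c : circle R) (E : set (circle R)), measurable E ->
    eta [set d | E (circle_mul c d)] = eta E.

(* Borel measurability of a complex function. *)
Definition cmeasurable (R : realType) (d : measure_display)
    (X : measurableType d) (f : X -> R[i]) : Prop :=
  measurable_fun setT (fun x => complex.Re (f x)) /\
  measurable_fun setT (fun x => complex.Im (f x)).

Definition lin_span (R : realType) (H : hilbertType R) (v : nat -> H) : set H :=
  [set h | exists m (a : nat -> R[i]), h = \sum_(0 <= i < m) a i *: v i].

(* Dixmier's measurable fields of Hilbert spaces: the fibers together with the space of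
   measurable vector fields. *)
Record hilbert_field (R : realType) (d : measure_display)
    (X : measurableType d) : Type := HilbertField {
  fiber :> X -> hilbertType R ;
  msection : set (forall x, fiber x) ;
  msection0 : msection (fun x => 0) ;
  msection_lin : forall (a : R[i]) u v, msection u -> msection v ->
    msection (fun x => a *: u x + v x) ;
  msection_norm : forall u, msection u ->
    measurable_fun setT (fun x => rnorm (u x)) ;
  msection_max : forall v : (forall x, fiber x),
    (forall u, msection u -> cmeasurable (fun x => hdot (u x) (v x))) ->
    msection v ;
  msection_total : exists e : nat -> forall x, fiber x,
    (forall n, msection (e n)) /\
    (forall x, closure (lin_span (fun n => e n x)) = setT)
}.

Definition is_representation_field (R : realType) (d : measure_display)
    (X : measurableType d) (O : cstarAlgType R) (F : hilbert_field R X)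
    (pi : forall x, O -> F x -> F x) : Prop :=
  (forall x, is_representation (pi x)) /\
  (forall a u, msection u -> msection (fun x => pi x a (u x))).

Definition L2_section (R : realType) (d : measure_display)
    (X : measurableType d) (mu : {measure set X -> \bar R})
    (F : hilbert_field R X) (u : forall x, F x) : Prop :=
  msection u /\ (\int[mu]_x (rnorm (u x) ^+ 2)%:E < +oo)%E.

(* (L, rho) is the direct integral of the field (F, pi): L is, through cls, the
   space of square-integrable measurable vector fields with the L2 norm, modulo
   equality almost everywhere (cls u = cls v iff the norm of u - v is 0), and
   rho acts fiberwise. The inner product of L is the integral of the fiberwise
   inner products by polarization. *)
Definition is_direct_integral (R : realType) (d : measure_display)
    (X : measurableType d) (mu : {measure set X -> \bar R})
    (O : cstarAlgType R) (F : hilbert_field R X)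
    (pi : forall x, O -> F x -> F x)
    (L : hilbertType R) (rho : O -> L -> L) : Prop :=
  is_representation rho /\
  exists cls : (forall x, F x) -> L,
    [/\ forall (a : R[i]) u v, L2_section mu u -> L2_section mu v ->
          cls (fun x => a *: u x + v x) = a *: cls u + cls v,
        forall h, exists2 u, L2_section mu u & cls u = h,
        forall u, L2_section mu u ->
          ((rnorm (cls u) ^+ 2)%:E = \int[mu]_x (rnorm (u x) ^+ 2)%:E)%E
      & forall a u, L2_section mu u ->
          rho a (cls u) = cls (fun x => pi x a (u x))].

(* Main.v *)
Require Import Defs.
From HB Require Import structures.
From mathcomp Require Import all_boot all_order all_algebra.
From mathcomp Require Import all_classical all_reals all_analysis.
From mathcomp Require Import complex measurable_realfun.
From mathcomp Require Import finmap zify ring lra.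

Set Implicit Arguments.
Unset Strict Implicit.
Unset Printing Implicit Defensive.

Import Order.TTheory GRing.Theory Num.Theory.
Import numFieldNormedType.Exports.
Local Open Scope classical_set_scope.
Local Open Scope complex_scope.
Local Open Scope ring_scope.

(** Let K end with the infinite repetition w of a word of least period p. Among
    the p rotations of a period exactly one has the least value in base N; this
    is J, and w = J J J ... after a rotation of the starting point.

    Existence. Let X be the set of admissible infinite words sharing a tail with
    w, and let a P(K) representation on H be given, with cyclic vector W.
    Stripping b letters of K from W by the adjoints of the generators, then
    prepending l letters of a word x in X whose continuation agrees with that of
    K, gives a unit vector which depends on x and on the difference l - b only.
    For a given x the admissible differences form a class modulo p, so these
    vectors are labelled e(x, m) by a word x and an integer m, and they form an
    orthonormal basis of H ([chain_vec_orth], [chain_vec_dense]). The generator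
    s_i maps e(x, m) to e(ix, m), or to e(ix, m+1) when ix is the base word w, if
    ix is admissible. Sending e(x, m) to the section c |-> c^m e_x over U(1)
    identifies H with the square-integrable sections of the constant field with
    fiber l2(X), and replaces s_i by the operator that prepends the letter i with
    a factor c when the result is w. This fiber operator is the model of P(J; c)
    ([cycle_model]), since going once around J meets w once.

    This argument treats the generators; the passage to all of O_A uses the
    universal property only. Consider the Hilbert spaces l2(X), one above each c,
    together with H above one extra point. The bounded families of operators on
    them which, along with their adjoints, preserve the measurable sections and
    preserve the correspondence between sections and vectors of H form a
    C*-algebra ([op_family]). It contains the families made of the images of the
    generators, so the universal property provides a morphism from O_A to it
    ([ck_rep_family]). Preservation of measurable sections makes the fiber
    representations a measurable field, and preservation of the correspondence
    makes it intertwine P(K) with the direct integral.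

    The correspondence is the closure of the isometry between trigonometric
    sections and combinations of the e(x, m). It is defined on all
    square-integrable sections because trigonometric sections are dense: the
    functions obtained from the characters of U(1) by iterated bounded pointwise
    limits contain the indicator of every Borel set ([baire_measurable]), and
    bounded limits are limits in L2. It reaches all of H by completeness of the
    space of sections ([riesz_fischer]).

    Uniqueness. Suppose P(K) is a direct integral of the P(J'; c). If K had no
    tail in common with J' J' ..., the operators that strip successive letters of
    K would tend strongly to 0 in every fiber ([cycle_vanishes]), hence on the
    direct integral by dominated convergence; but they map the cyclic vector of
    P(K) to unit vectors. So the powers of J and J' share a tail, and two minimal
    nonperiodic words with this property coincide ([canonical_unique]). This
    applies because a P(K) representation exists, on l2 of the words of X with a
    winding number ([chain_model]). *)

(** * Moduli, norms and inner products *)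

Section hilbert_basics.
Variables (R : realType).
Implicit Types (z : R[i]).

(** The norm of R[i] takes values in R[i]; estimates are made in R. *)
Definition cabs (z : R[i]) : R := complex.Re `|z|.

Lemma cabsE z : `|z| = (cabs z)%:C.
Proof. by rewrite /cabs normc_def. Qed.

Lemma cabs_ge0 z : 0 <= cabs z.
Proof. by rewrite -ler0c -cabsE normr_ge0. Qed.

Lemma cabsM z t : cabs (z * t) = cabs z * cabs t.
Proof. by apply: complexI; rewrite -cabsE normrM !cabsE rmorphM. Qed.

Lemma cabsD z t : cabs (z + t) <= cabs z + cabs t.
Proof. by rewrite -lecR -cabsE rmorphD /= -!cabsE ler_normD. Qed.

Lemma cabsN z : cabs (- z) = cabs z.
Proof. by rewrite /cabs normrN. Qed.

Lemma cabs_real (r : R) : cabs r%:C = `|r|.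
Proof. by rewrite /cabs normc_def /= expr0n addr0 sqrtr_sqr. Qed.

Lemma cabs0 : cabs 0 = 0.
Proof. by rewrite /cabs normr0. Qed.

Lemma cabs1 : cabs 1 = 1.
Proof. by rewrite /cabs normr1. Qed.

Lemma cabs_eq0 z : (cabs z == 0) = (z == 0).
Proof. by rewrite -(inj_eq (@complexI R)) -cabsE normr_eq0. Qed.

Lemma cabs_conj z : cabs (Num.conj z) = cabs z.
Proof. by rewrite /cabs norm_conjC. Qed.

Lemma cabs_sq z : cabs z ^+ 2 = complex.Re z ^+ 2 + complex.Im z ^+ 2.
Proof.
by rewrite /cabs normc_def /= sqr_sqrtr // addr_ge0 // sqr_ge0.
Qed.

Lemma Re_le_cabs z : `|complex.Re z| <= cabs z.
Proof.
rewrite -(@ler_pXn2r _ 2) // ?nnegrE ?cabs_ge0 ?normr_ge0 //.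
by rewrite cabs_sq real_normK ?num_real // lerDl sqr_ge0.
Qed.

Lemma Im_le_cabs z : `|complex.Im z| <= cabs z.
Proof.
rewrite -(@ler_pXn2r _ 2) // ?nnegrE ?cabs_ge0 ?normr_ge0 //.
by rewrite cabs_sq real_normK ?num_real // lerDr sqr_ge0.
Qed.

Lemma conjE z : Num.conj z = (complex.Re z -i* complex.Im z).
Proof. by case: z. Qed.

Lemma complex_ext z t : complex.Re z = complex.Re t ->
  complex.Im z = complex.Im t -> z = t.
Proof. by case: z => a b; case: t => c d /= -> ->. Qed.

Lemma conj_realC (r : R) : Num.conj r%:C = r%:C.
Proof. by apply: complex_ext; rewrite conjE /= ?oppr0. Qed.

Lemma mul_conj z : z * Num.conj z = (cabs z ^+ 2)%:C.
Proof. by rewrite -normCK cabsE rmorphXn. Qed.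

Lemma cRe_real (r : R) z : complex.Re (r%:C * z) = r * complex.Re z.
Proof. by case: z => a b /=; rewrite mul0r subr0. Qed.

Lemma cReD z t : complex.Re (z + t) = complex.Re z + complex.Re t.
Proof. by case: z; case: t. Qed.

Lemma cRe_sum (I : Type) (r : seq I) (G : I -> R[i]) :
  complex.Re (\sum_(i <- r) G i) = \sum_(i <- r) complex.Re (G i).
Proof. by elim/big_rec2: _ => // i a b _; rewrite cReD => ->. Qed.

Lemma cImD z t : complex.Im (z + t) = complex.Im z + complex.Im t.
Proof. by case: z; case: t. Qed.

Lemma cReN z : complex.Re (- z) = - complex.Re z.
Proof. by case: z. Qed.

Lemma cImN z : complex.Im (- z) = - complex.Im z.
Proof. by case: z. Qed.

Lemma cReM z t : complex.Re (z * t) =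
  complex.Re z * complex.Re t - complex.Im z * complex.Im t.
Proof. by case: z; case: t. Qed.

Lemma cImM z t : complex.Im (z * t) =
  complex.Re z * complex.Im t + complex.Im z * complex.Re t.
Proof. by case: z => a b; case: t. Qed.

Lemma cRe_conj z : complex.Re (Num.conj z) = complex.Re z.
Proof. by rewrite conjE. Qed.

Lemma cIm_conj z : complex.Im (Num.conj z) = - complex.Im z.
Proof. by rewrite conjE. Qed.

Lemma pos_real z : 0 < z -> z = (complex.Re z)%:C /\ 0 < complex.Re z.
Proof. by case: z => a b; rewrite ltcE /= => /andP[/eqP -> ->]. Qed.

Variable H : hilbertType R.
Implicit Types (x y : H).

Lemma rnormE x : `|x| = (rnorm x)%:C.
Proof.
have : 0 <= `|x| by [].
by rewrite lecE /= /rnorm; case: `|x| => a b /= /andP[/eqP -> _].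
Qed.

Lemma rnorm_ge0 x : 0 <= rnorm x.
Proof. by rewrite -ler0c -rnormE. Qed.

Lemma rnormD x y : rnorm (x + y) <= rnorm x + rnorm y.
Proof. by rewrite -lecR -rnormE rmorphD /= -!rnormE ler_normD. Qed.

Lemma rnormN x : rnorm (- x) = rnorm x.
Proof. by rewrite /rnorm normrN. Qed.

Lemma rnormB x y : rnorm (x - y) = rnorm (y - x).
Proof. by rewrite -rnormN opprB. Qed.

Lemma rnormZ a x : rnorm (a *: x) = cabs a * rnorm x.
Proof. by apply: complexI; rewrite -rnormE normrZ cabsE rnormE rmorphM. Qed.

Lemma rnorm0 : rnorm (0 : H) = 0.
Proof. by rewrite /rnorm normr0. Qed.

Lemma rnorm_eq0 x : (rnorm x == 0) = (x == 0).
Proof. by rewrite -(inj_eq (@complexI R)) -rnormE normr_eq0. Qed.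

Lemma rnorm0_eq0 x : rnorm x = 0 -> x = 0.
Proof. by move=> /eqP; rewrite rnorm_eq0 => /eqP. Qed.

Lemma hdotxx x : hdot x x = (rnorm x ^+ 2)%:C.
Proof. by rewrite hdot_norm rnormE rmorphXn. Qed.

Lemma hdot0l y : hdot 0 y = 0.
Proof. by rewrite -(scale0r (0 : H)) hdotZl mul0r. Qed.

Lemma hdotNl x y : hdot (- x) y = - hdot x y.
Proof. by rewrite -scaleN1r hdotZl mulN1r. Qed.

Lemma hdotBl x y w : hdot (x - y) w = hdot x w - hdot y w.
Proof. by rewrite hdotDl hdotNl. Qed.

Lemma hdotDr x y w : hdot x (y + w) = hdot x y + hdot x w.
Proof. by rewrite hdotC hdotDl rmorphD /= -!hdotC. Qed.

Lemma hdotZr a x y : hdot x (a *: y) = Num.conj a * hdot x y.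
Proof. by rewrite hdotC hdotZl rmorphM /= -hdotC. Qed.

Lemma hdot0r x : hdot x 0 = 0.
Proof. by rewrite hdotC hdot0l rmorph0. Qed.

Lemma hdotNr x y : hdot x (- y) = - hdot x y.
Proof. by rewrite hdotC hdotNl rmorphN /= -hdotC. Qed.

Lemma hdotBr x y w : hdot x (y - w) = hdot x y - hdot x w.
Proof. by rewrite hdotDr hdotNr. Qed.

Lemma hdot_suml (I : Type) (r : seq I) (P : pred I) (F : I -> H) y :
  hdot (\sum_(i <- r | P i) F i) y = \sum_(i <- r | P i) hdot (F i) y.
Proof.
elim/big_rec2: _ => [|i u v _ IH]; first by rewrite hdot0l.
by rewrite hdotDl IH.
Qed.

Lemma hdot_sumr (I : Type) (r : seq I) (P : pred I) (F : I -> H) y :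
  hdot y (\sum_(i <- r | P i) F i) = \sum_(i <- r | P i) hdot y (F i).
Proof.
elim/big_rec2: _ => [|i u v _ IH]; first by rewrite hdot0r.
by rewrite hdotDr IH.
Qed.

Lemma rnorm_sq x : rnorm x ^+ 2 = complex.Re (hdot x x).
Proof. by rewrite hdotxx. Qed.

Lemma rnorm_sqD x y :
  rnorm (x + y) ^+ 2 = rnorm x ^+ 2 + rnorm y ^+ 2 + 2 * complex.Re (hdot x y).
Proof.
rewrite !rnorm_sq hdotDl !hdotDr !cReD (hdotC x y) cRe_conj; ring.
Qed.

(** The triangle inequality for x + a y, with a the inner product itself, contains
    the claim after cancellation of the squares. *)
Lemma cauchy_schwarz x y : cabs (hdot x y) <= rnorm x * rnorm y.
Proof.
set a := hdot x y.
have [->|a0] := eqVneq a 0; first by rewrite cabs0 mulr_ge0 ?rnorm_ge0.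
have [y0|y0] := eqVneq y 0.
  by move: a0; rewrite /a y0 hdot0r eqxx.
have ny : 0 < rnorm y by rewrite lt_neqAle rnorm_ge0 eq_sym rnorm_eq0 y0.
have na : 0 < cabs a by rewrite lt_neqAle cabs_ge0 eq_sym cabs_eq0 a0.
have h : rnorm (x + a *: y) ^+ 2 <= (rnorm x + cabs a * rnorm y) ^+ 2.
  rewrite ler_pXn2r ?nnegrE ?addr_ge0 ?mulr_ge0 ?rnorm_ge0 ?cabs_ge0 //.
  by rewrite -rnormZ rnormD.
rewrite rnorm_sqD rnormZ hdotZr -/a [Num.conj a * a]mulrC mul_conj /= in h.
have {}h : cabs a * cabs a <= cabs a * (rnorm x * rnorm y) by nra.
by rewrite ler_pM2l in h.
Qed.

Lemma hdot_inj x y : (forall w, hdot x w = hdot y w) -> x = y.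
Proof.
move=> h; apply/eqP; rewrite -subr_eq0 -rnorm_eq0 -sqrf_eq0 rnorm_sq.
by rewrite hdotBl h subrr.
Qed.

Lemma hdot_injr x y : (forall w, hdot w x = hdot w y) -> x = y.
Proof. by move=> h; apply: hdot_inj => z; rewrite hdotC h -hdotC. Qed.

Lemma ball_rnorm x y (e : R) : ball x e%:C y = (rnorm (x - y) < e).
Proof. by rewrite -ball_normE /ball_ /= rnormE ltcR. Qed.

Lemma nbhs_rnormP x (A : set H) :
  nbhs x A <-> exists2 e : R, 0 < e & forall y, rnorm (x - y) < e -> A y.
Proof.
rewrite -nbhs_ballE; split.
  case=> e /= e0 h; have ee : e = (complex.Re e)%:C.
    by move: e0; case: (e) => a b; rewrite ltcE /= => /andP[/eqP -> _].
  exists (complex.Re e); first by rewrite -ltcR -ee.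
  by move=> y hy; apply: h; rewrite ee ball_rnorm.
case=> e e0 h; exists e%:C; first by rewrite /= ltcR.
by move=> y; rewrite ball_rnorm => /h.
Qed.

Lemma closure_rnormP (A : set H) x :
  closure A x <-> forall e : R, 0 < e -> exists2 y, A y & rnorm (x - y) < e.
Proof.
split.
  move=> h e e0; have /h [y [Ay hy]] : nbhs x [set y | rnorm (x - y) < e].
    by apply/nbhs_rnormP; exists e.
  by exists y.
move=> h B /nbhs_rnormP [e e0 eB]; have [y Ay hy] := h _ e0.
by exists y; split => //; apply: eB.
Qed.

Definition cauchy_seq (u : nat -> H) := forall e : R, 0 < e ->
  exists n0 : nat, forall m n : nat, (n0 <= m)%N -> (n0 <= n)%N ->
    rnorm (u m - u n) < e.

Definition lim_seq (u : nat -> H) (l : H) := forall e : R, 0 < e ->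
  exists n0 : nat, forall n : nat, (n0 <= n)%N -> rnorm (u n - l) < e.

Lemma hilbert_complete u : cauchy_seq u -> exists l, lim_seq u l.
Proof.
move=> hu; have : cauchy (u @ \oo).
  apply/cauchy_ballP => e e0.
  have ee : e = (complex.Re e)%:C.
    by move: e0; case: (e) => a b; rewrite ltcE /= => /andP[/eqP -> _].
  have er : 0 < complex.Re e by rewrite -ltcR -ee.
  have [n0 h] := hu _ er.
  exists (u @` [set n | (n0 <= n)%N], u @` [set n | (n0 <= n)%N]).
    by split; exists n0 => // n /= hn; exists n.
  move=> [_ _] /= [[m hm <-] [n hn <-]].
  by rewrite ee ball_rnorm; apply: h.
move=> /cauchy_cvg /cvg_ex [l hl]; exists l => e e0.
have /hl : nbhs l [set y | rnorm (l - y) < e] by apply/nbhs_rnormP; exists e.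
by case=> n0 _ h; exists n0 => n hn; rewrite rnormB; apply: h.
Qed.

End hilbert_basics.

(** * The C*-algebra of operator families preserving given sections *)

(** A family of Hilbert spaces, with classes of sections that operators will have
    to preserve. The limits in [bsec_lim] are relative to a section u, because if T
    is the norm limit of T_n then T u is exactly such a limit of the T_n u. The
    nonzero vector makes the algebra of operators nontrivial. *)
Record section_ctx (R : realType) := SectionCtx {
  bidx : Type ;
  bfib : bidx -> hilbertType R ;
  bsel : Type ;
  bsec : bsel -> set (forall c, bfib c) ;
  bsec_lin : forall j (a : R[i]) u v, bsec j u -> bsec j v ->
    bsec j (fun c => a *: u c + v c) ;
  bsec_lim : forall j u w, bsec j u ->
    (forall e : R, 0 < e -> exists2 v, bsec j v &
       forall c, rnorm (v c - w c) <= e * rnorm (u c)) -> bsec j w ;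
  bpt : bidx ;
  bvec : bfib bpt ;
  bvec_neq0 : bvec <> 0
}.

Arguments bfib {R} X c : rename.
Arguments bpt {R} X : rename.
Arguments bvec {R} X : rename.
Arguments bsec {R X} j : rename.

Section op_family_def.
Variables (R : realType) (X : section_ctx R).

Definition opfun := forall c, bfib X c -> bfib X c.

Definition is_adjoint (T S : opfun) := forall c x y, hdot (T c x) y = hdot x (S c y).
Definition bounded_by (T : opfun) (M : R) := forall c x, rnorm (T c x) <= M * rnorm x.
Definition preserves (T : opfun) := forall j u, bsec j u -> bsec j (fun c => T c (u c)).
(** Preservation is also asked of the adjoint, so that the algebra is closed under
    the star. *)
Definition good_family (T : opfun) := exists (S : opfun) M,
  [/\ is_adjoint T S, 0 <= M, bounded_by T M, preserves T & preserves S].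

Lemma is_adjointC (T S : opfun) : is_adjoint T S -> is_adjoint S T.
Proof. by move=> h c x y; rewrite hdotC -h -hdotC. Qed.

Lemma adjoint_unique (T S S' : opfun) : is_adjoint T S -> is_adjoint T S' -> S = S'.
Proof.
move=> h h'; apply/functional_extensionality_dep => c; apply/funext => x.
by apply: hdot_injr => y; rewrite -h h'.
Qed.

Lemma adjoint_linear (T S : opfun) c : is_adjoint T S -> linear (T c).
Proof.
move=> h a x y; apply: hdot_inj => z.
by rewrite h !hdotDl !hdotZl -!h.
Qed.

(** The square of the norm of S y is the inner product of T S y and y. *)
Lemma bounded_by_adjoint (T S : opfun) M : is_adjoint T S -> 0 <= M -> bounded_by T M -> bounded_by S M.
Proof.
move=> h M0 hM c y.
have [y0|y0] := eqVneq (S c y) 0.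
  by rewrite y0 rnorm0 mulr_ge0 // rnorm_ge0.
have p : 0 < rnorm (S c y) by rewrite lt_neqAle rnorm_ge0 eq_sym rnorm_eq0 y0.
have : rnorm (S c y) ^+ 2 <= rnorm (T c (S c y)) * rnorm y.
  rewrite rnorm_sq -h; apply: le_trans (cauchy_schwarz _ _).
  by apply: le_trans (Re_le_cabs _); exact: ler_norm.
have := hM c (S c y); have := rnorm_ge0 y; nra.
Qed.

Record op_family := OpFamily { op_at :> forall c, bfib X c -> bfib X c ; op_good : good_family op_at }.

Lemma op_family_ext (T S : op_family) : (forall c x, T c x = S c x) -> T = S.
Proof.
case: T => T hT; case: S => S hS /= h.
have e : T = S.
  by apply/functional_extensionality_dep => c; apply/funext => x; apply: h.
by subst S; congr OpFamily; apply: Prop_irrelevance.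
Qed.

Definition adjoint_of (T : op_family) : opfun := proj1_sig (cid (op_good T)).

Arguments adjoint_of : clear implicits.

Lemma adjoint_ofP (T : op_family) : is_adjoint T (adjoint_of T).
Proof. by rewrite /adjoint_of; case: cid => S [M []]. Qed.

Lemma op_bounded (T : op_family) : exists2 M, 0 <= M & bounded_by T M.
Proof. by have [S [M [_ M0 h _ _]]] := op_good T; exists M. Qed.

Lemma op_preserves (T : op_family) : preserves T.
Proof. by have [S [M [_ M0 _ h _]]] := op_good T. Qed.

Lemma adjoint_preserves (T : op_family) : preserves (adjoint_of T).
Proof.
have [S [M [h M0 _ _ h']]] := op_good T.
by rewrite (adjoint_unique (@adjoint_ofP T) h).
Qed.

Lemma op_linear (T : op_family) c : linear (T c).
Proof. exact: adjoint_linear (adjoint_ofP T). Qed.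

Lemma op_atD (T : op_family) c x y : T c (x + y) = T c x + T c y.
Proof. by have := @op_linear T c 1 x y; rewrite !scale1r. Qed.

Lemma op_at0 (T : op_family) c : T c 0 = 0.
Proof. by apply: (addrI (T c 0)); rewrite -op_atD !addr0. Qed.

Lemma op_atZ (T : op_family) c a x : T c (a *: x) = a *: T c x.
Proof. by have := @op_linear T c a x 0; rewrite op_at0 !addr0. Qed.

Lemma bsec0 j u : bsec j u -> @bsec R X j (fun c => 0).
Proof.
move=> hu; have := bsec_lin (-1) hu hu.
by congr bsec; apply/functional_extensionality_dep => c; rewrite scaleN1r addNr.
Qed.

Lemma bsecD j u v : bsec j u -> bsec j v -> @bsec R X j (fun c => u c + v c).
Proof.
move=> hu hv; have := bsec_lin 1 hu hv.
by congr bsec; apply/functional_extensionality_dep => c; rewrite scale1r.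
Qed.

Lemma bsecZ j a u : bsec j u -> @bsec R X j (fun c => a *: u c).
Proof.
move=> hu; have := bsec_lin a hu (bsec0 hu).
by congr bsec; apply/functional_extensionality_dep => c; rewrite addr0.
Qed.

Lemma good0 : good_family (fun c x => 0).
Proof.
exists (fun c x => 0), 0; split => //.
- by move=> c x y; rewrite hdot0l hdot0r.
- by move=> c x; rewrite rnorm0 mul0r.
- by move=> j u /bsec0.
- by move=> j u /bsec0.
Qed.

Lemma good1 : good_family (fun c x => x).
Proof. by exists (fun c x => x), 1; split => // c x; rewrite mul1r. Qed.

Lemma goodD (T S : op_family) : good_family (fun c x => T c x + S c x).
Proof.
have [M M0 hM] := op_bounded T; have [M' M0' hM'] := op_bounded S.
exists (fun c x => adjoint_of T c x + adjoint_of S c x), (M + M'); split.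
- by move=> c x y; rewrite hdotDl hdotDr !adjoint_ofP.
- by rewrite addr_ge0.
- by move=> c x; rewrite mulrDl; apply: le_trans (rnormD _ _) _; apply: lerD.
- by move=> j u hu; apply: bsecD; apply: op_preserves.
- by move=> j u hu; apply: bsecD; apply: adjoint_preserves.
Qed.

Lemma goodZ a (T : op_family) : good_family (fun c x => a *: T c x).
Proof.
have [M M0 hM] := op_bounded T.
exists (fun c x => Num.conj a *: adjoint_of T c x), (cabs a * M); split.
- by move=> c x y; rewrite hdotZl hdotZr conjCK adjoint_ofP.
- by rewrite mulr_ge0 // cabs_ge0.
- by move=> c x; rewrite rnormZ -mulrA ler_wpM2l ?cabs_ge0.
- by move=> j u hu; apply: bsecZ; apply: op_preserves.
- by move=> j u hu; apply: bsecZ; apply: adjoint_preserves.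
Qed.

Lemma goodM (T S : op_family) : good_family (fun c x => T c (S c x)).
Proof.
have [M M0 hM] := op_bounded T; have [M' M0' hM'] := op_bounded S.
exists (fun c x => adjoint_of S c (adjoint_of T c x)), (M * M'); split.
- by move=> c x y; rewrite !adjoint_ofP.
- by rewrite mulr_ge0.
- move=> c x; apply: le_trans (hM _ _) _.
  by rewrite -mulrA ler_wpM2l.
- by move=> j u hu; apply: (@op_preserves T); apply: op_preserves.
- by move=> j u hu; apply: (@adjoint_preserves S); apply: adjoint_preserves.
Qed.

Lemma good_star (T : op_family) : good_family (adjoint_of T).
Proof.
have [M M0 hM] := op_bounded T.
exists T, M; split => //.
- exact/is_adjointC/adjoint_ofP.
- exact: bounded_by_adjoint (adjoint_ofP T) M0 hM.
- exact: adjoint_preserves.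
- exact: op_preserves.
Qed.

Definition bzero := OpFamily good0.
Definition bone := OpFamily good1.
Definition badd (T S : op_family) := OpFamily (goodD T S).
Definition bscale a (T : op_family) := OpFamily (goodZ a T).
Definition bopp (T : op_family) := bscale (-1) T.
Definition bmul (T S : op_family) := OpFamily (goodM T S).
Definition bstar (T : op_family) := OpFamily (good_star T).

HB.instance Definition _ := gen_eqMixin op_family.
HB.instance Definition _ := gen_choiceMixin op_family.

Fact baddA : associative badd.
Proof. by move=> a b c; apply: op_family_ext => i x /=; rewrite addrA. Qed.
Fact baddC : commutative badd.
Proof. by move=> a b; apply: op_family_ext => i x /=; rewrite addrC. Qed.
Fact badd0 : left_id bzero badd.
Proof. by move=> a; apply: op_family_ext => i x /=; rewrite add0r. Qed.
Fact baddN : left_inverse bzero bopp badd.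
Proof. by move=> a; apply: op_family_ext => i x /=; rewrite scaleN1r addNr. Qed.

HB.instance Definition _ := GRing.isZmodule.Build op_family baddA baddC badd0 baddN.

Fact bmulA : associative bmul.
Proof. by move=> a b c; apply: op_family_ext. Qed.
Fact bmul1 : left_id bone bmul.
Proof. by move=> a; apply: op_family_ext. Qed.
Fact bmulr1 : right_id bone bmul.
Proof. by move=> a; apply: op_family_ext. Qed.
Fact bmulDl : left_distributive bmul badd.
Proof. by move=> a b c; apply: op_family_ext. Qed.
Fact bmulDr : right_distributive bmul badd.
Proof. by move=> a b c; apply: op_family_ext => i x /=; rewrite op_atD. Qed.
Fact bone_neq0 : bone != bzero.
Proof.
apply/eqP => h; apply: (@bvec_neq0 R X).
by have := f_equal (fun T : op_family => T _ (bvec X)) h.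
Qed.

HB.instance Definition _ := GRing.Zmodule_isNzRing.Build op_family
  bmulA bmul1 bmulr1 bmulDl bmulDr bone_neq0.

Fact bscaleA a b (T : op_family) : bscale a (bscale b T) = bscale (a * b) T.
Proof. by apply: op_family_ext => i x /=; rewrite scalerA. Qed.
Fact bscale1 : left_id 1 bscale.
Proof. by move=> T; apply: op_family_ext => i x /=; rewrite scale1r. Qed.
Fact bscaleDr : right_distributive bscale +%R.
Proof. by move=> a T S; apply: op_family_ext => i x /=; rewrite scalerDr. Qed.
Fact bscaleDl (T : op_family) : {morph bscale^~ T : a b / a + b}.
Proof. by move=> a b; apply: op_family_ext => i x /=; rewrite scalerDl. Qed.

HB.instance Definition _ := GRing.Zmodule_isLmodule.Build R[i] op_family
  bscaleA bscale1 bscaleDr bscaleDl.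

Fact bscaleAl (a : R[i]) (T S : op_family) : a *: (T * S) = a *: T * S.
Proof. by apply: op_family_ext. Qed.
HB.instance Definition _ := GRing.Lmodule_isLalgebra.Build R[i] op_family bscaleAl.
Fact bscaleAr (a : R[i]) (T S : op_family) : a *: (T * S) = T * (a *: S).
Proof. by apply: op_family_ext => i x /=; rewrite op_atZ. Qed.
HB.instance Definition _ := GRing.Lalgebra_isAlgebra.Build R[i] op_family bscaleAr.

Lemma bstarE (T : op_family) (S : opfun) : is_adjoint T S -> forall c x, bstar T c x = S c x.
Proof. by move=> h c x /=; rewrite (adjoint_unique (adjoint_ofP T) h). Qed.

Fact bstarD (a b : op_family) : bstar (a + b) = bstar a + bstar b.
Proof.
apply: op_family_ext; apply: bstarE => c x y /=.
by rewrite hdotDl hdotDr !adjoint_ofP.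
Qed.
Fact bstarZ (z : R[i]) (a : op_family) : bstar (z *: a) = Num.conj z *: bstar a.
Proof.
apply: op_family_ext; apply: bstarE => c x y /=.
by rewrite hdotZl hdotZr conjCK !adjoint_ofP.
Qed.
Fact bstarM (a b : op_family) : bstar (a * b) = bstar b * bstar a.
Proof. by apply: op_family_ext; apply: bstarE => c x y /=; rewrite !adjoint_ofP. Qed.
Fact bstarK (a : op_family) : bstar (bstar a) = a.
Proof. by apply: op_family_ext; apply: bstarE; exact/is_adjointC/adjoint_ofP. Qed.

Definition bnorms (T : op_family) : set R := [set r | exists c x, 
  rnorm x <= 1 /\ r = rnorm (T c x)].
Definition bnorm (T : op_family) : R := sup (bnorms T).

Lemma bnorms_sup (T : op_family) : has_sup (bnorms T).
Proof.
split; first by exists 0, (bpt X), 0; rewrite rnorm0 op_at0 rnorm0; split.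
have [M M0 hM] := op_bounded T; exists M => _ [c [x [x1 ->]]].
by apply: le_trans (hM _ _) _; rewrite -[leRHS]mulr1 ler_wpM2l.
Qed.

Lemma bnorm_ge0 (T : op_family) : 0 <= bnorm T.
Proof.
apply: ub_le_sup; first by case: (bnorms_sup T).
by exists (bpt X), 0; rewrite rnorm0 op_at0 rnorm0; split.
Qed.

Lemma bnormP (T : op_family) : bounded_by T (bnorm T).
Proof.
move=> c x; have [->|x0] := eqVneq x 0; first by rewrite op_at0 rnorm0 mulr0.
have p : 0 < rnorm x by rewrite lt_neqAle rnorm_ge0 eq_sym rnorm_eq0 x0.
have : rnorm (T c ((rnorm x)^-1%:C *: x)) <= bnorm T.
  apply: ub_le_sup; first by case: (bnorms_sup T).
  exists c, ((rnorm x)^-1%:C *: x); rewrite rnormZ cabs_real.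
  by rewrite ger0_norm ?invr_ge0 ?rnorm_ge0 // mulVf // gt_eqF.
rewrite op_atZ !rnormZ cabs_real ger0_norm ?invr_ge0 ?rnorm_ge0 //.
by rewrite mulrC ler_pdivrMr.
Qed.

Lemma bnorm_le (T : op_family) M : 0 <= M -> bounded_by T M -> bnorm T <= M.
Proof.
move=> M0 h; apply: ge_sup; first by case: (bnorms_sup T).
move=> _ [c [x [x1 ->]]].
by apply: le_trans (h _ _) _; rewrite -[leRHS]mulr1 ler_wpM2l.
Qed.

Fact bnorm0_eq0 (T : op_family) : bnorm T = 0 -> T = 0.
Proof.
move=> h; apply: op_family_ext => c x /=; apply: rnorm0_eq0.
by apply/eqP; rewrite eq_le rnorm_ge0 andbT -(mul0r (rnorm x)) -h bnormP.
Qed.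

Fact bnormD (T S : op_family) : bnorm (T + S) <= bnorm T + bnorm S.
Proof.
apply: bnorm_le; first by rewrite addr_ge0 ?bnorm_ge0.
move=> c x; rewrite mulrDl /=; apply: le_trans (rnormD _ _) _.
by apply: lerD; apply: bnormP.
Qed.

Lemma bnormZ_le (z : R[i]) (T : op_family) : bnorm (z *: T) <= cabs z * bnorm T.
Proof.
apply: bnorm_le; first by rewrite mulr_ge0 ?cabs_ge0 ?bnorm_ge0.
by move=> c x /=; rewrite rnormZ -mulrA ler_wpM2l ?cabs_ge0 // bnormP.
Qed.

Fact bnormZ (z : R[i]) (T : op_family) : bnorm (z *: T) = complex.Re `|z| * bnorm T.
Proof.
rewrite -[complex.Re _]/(cabs z).
apply/eqP; rewrite eq_le bnormZ_le /=.
have [->|z0] := eqVneq z 0; first by rewrite cabs0 mul0r bnorm_ge0.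
have p : 0 < cabs z by rewrite lt_neqAle cabs_ge0 eq_sym cabs_eq0 z0.
have := bnormZ_le z^-1 (z *: T); rewrite scalerA mulVf // scale1r.
have : cabs z * cabs z^-1 = 1 by rewrite -cabsM divff // cabs1.
move=> h1 h2; have := ler_wpM2l (cabs_ge0 z) h2.
by rewrite mulrA h1 mul1r.
Qed.

Fact bnormM (T S : op_family) : bnorm (T * S) <= bnorm T * bnorm S.
Proof.
apply: bnorm_le; first by rewrite mulr_ge0 ?bnorm_ge0.
move=> c x /=; apply: le_trans (@bnormP T c _) _.
by rewrite -mulrA ler_wpM2l ?bnorm_ge0 // bnormP.
Qed.

Lemma bnorm_star_le (T : op_family) : bnorm (bstar T) <= bnorm T.
Proof.
apply: bnorm_le; first exact: bnorm_ge0.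
by apply: bounded_by_adjoint (adjoint_ofP T) (bnorm_ge0 _) (@bnormP _).
Qed.

(** The square of the norm of T x is the inner product of T* T x and x; the other
    inequality is submultiplicativity. *)
Fact bnorm_cstar (T : op_family) : bnorm (bstar T * T) = bnorm T ^+ 2.
Proof.
apply/eqP; rewrite eq_le; apply/andP; split.
  apply: le_trans (bnormM _ _) _; rewrite expr2 ler_wpM2r ?bnorm_ge0 //.
  exact: bnorm_star_le.
set s := bnorm (bstar T * T).
have s0 : 0 <= s by exact: bnorm_ge0.
rewrite -(sqr_sqrtr s0) ler_pXn2r ?nnegrE ?bnorm_ge0 ?sqrtr_ge0 //.
apply: bnorm_le; first exact: sqrtr_ge0.
move=> c x; rewrite -(@ler_pXn2r _ 2) ?nnegrE ?mulr_ge0 ?sqrtr_ge0 ?rnorm_ge0 //.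
rewrite exprMn sqr_sqrtr // rnorm_sq adjoint_ofP.
apply: le_trans (ler_norm _) _; apply: le_trans (Re_le_cabs _) _.
apply: le_trans (cauchy_schwarz _ _) _.
have := @bnormP (bstar T * T) c x; rewrite -/s /= => h.
by have := rnorm_ge0 x; nra.
Qed.

(** The limit is fiberwise. The adjoints form a Cauchy sequence too, since the star
    does not increase the norm, and relative limits keep the sections preserved. *)
Fact bnorm_complete (u : nat -> op_family) :
  (forall e : R, 0 < e -> exists n0 : nat, forall m n : nat,
     (n0 <= m)%N -> (n0 <= n)%N -> bnorm (u m - u n) < e) ->
  exists l : op_family, forall e : R, 0 < e -> exists n0 : nat, forall n : nat,
    (n0 <= n)%N -> bnorm (u n - l) < e.
Proof.
move=> hu.
have subE (S T : op_family) c x : (S - T) c x = S c x - T c x.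
  by rewrite /= scaleN1r.
(* used for u and for the sequence of adjoints *)
have pw (v : nat -> op_family) :
  (forall e : R, 0 < e -> exists n0 : nat, forall m n : nat,
     (n0 <= m)%N -> (n0 <= n)%N -> bnorm (v m - v n) < e) ->
  exists T : opfun, forall e : R, 0 < e -> exists n0 : nat, forall n : nat,
    (n0 <= n)%N -> forall c x, rnorm (v n c x - T c x) <= e * rnorm x.
  move=> hv.
  have cs c x : cauchy_seq (fun n => v n c x).
    move=> e e0; have d0 : 0 < e / (rnorm x + 1).
      by rewrite divr_gt0 // ltr_wpDl ?rnorm_ge0.
    have [n0 h] := hv _ d0; exists n0 => m n hm hn.
    have := h _ _ hm hn => {}h; rewrite -subE.
    apply: le_lt_trans (@bnormP _ c _) _.
    have x0 := rnorm_ge0 x; have x1 : 0 < rnorm x + 1 by lra.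
    apply: le_lt_trans (_ : _ <= bnorm (v m - v n) * (rnorm x + 1)) _.
      by rewrite ler_wpM2l ?bnorm_ge0 // lerDl.
    by rewrite -ltr_pdivlMr.
  pose T : opfun := fun c x => proj1_sig (cid (hilbert_complete (cs c x))).
  exists T => e e0; have [n0 h] := hv _ e0; exists n0 => n hn c x.
  rewrite /T; case: cid => l /= hl.
  apply/ler_addgt0Pr => d d0; have [n1 h1] := hl _ d0.
  set k := maxn n0 n1.
  have -> : v n c x - l = (v n - v k) c x + (v k c x - l).
    by rewrite subE addrA subrK.
  apply: le_trans (rnormD _ _) _; apply: lerD.
    apply: le_trans (@bnormP _ c _) _; rewrite ler_wpM2r ?rnorm_ge0 //.
    by apply/ltW/h => //; rewrite leq_maxl.
  by apply/ltW/h1; rewrite leq_maxr.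
have [T hT] := pw _ hu.
have [S hS] : exists S : opfun, forall e : R, 0 < e -> exists n0 : nat,
    forall n : nat, (n0 <= n)%N ->
    forall c x, rnorm (bstar (u n) c x - S c x) <= e * rnorm x.
  apply: (pw (bstar \o u)) => e e0; have [n0 h] := hu _ e0; exists n0 => m n hm hn /=.
  apply: le_lt_trans (h _ _ hm hn).
  have -> : bstar (u m) - bstar (u n) = bstar (u m - u n).
    by rewrite bstarD -[- u n]scaleN1r bstarZ rmorphN1 scaleN1r.
  exact: bnorm_star_le.
have adj : is_adjoint T S.
  move=> c x y; apply/eqP; rewrite -subr_eq0 -cabs_eq0 eq_le cabs_ge0 andbT.
  apply/ler_addgt0Pr => e e0; rewrite add0r.
  set q := 2 * (rnorm x * rnorm y) + 1.
  have q0 : 0 < q by rewrite ltr_wpDl // !mulr_ge0 ?rnorm_ge0.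
  have [n0 h0] := hT _ (divr_gt0 e0 q0); have [n1 h1] := hS _ (divr_gt0 e0 q0).
  set k := maxn n0 n1.
  have {}h0 := h0 k (leq_maxl _ _) c x; have {}h1 := h1 k (leq_maxr _ _) c y.
  have -> : hdot (T c x) y - hdot x (S c y) =
     - hdot (u k c x - T c x) y + hdot x (bstar (u k) c y - S c y).
    by rewrite hdotBl hdotBr -(adjoint_ofP (u k)); ring.
  apply: le_trans (cabsD _ _) _; rewrite cabsN.
  apply: le_trans (lerD (cauchy_schwarz _ _) (cauchy_schwarz _ _)) _.
  apply: le_trans (_ : _ <= e / q * rnorm x * rnorm y + rnorm x * (e / q * rnorm y)) _.
    by apply: lerD; [rewrite ler_wpM2r ?rnorm_ge0|rewrite ler_wpM2l ?rnorm_ge0].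
  have -> : e / q * rnorm x * rnorm y + rnorm x * (e / q * rnorm y) =
    e / q * (2 * (rnorm x * rnorm y)) by ring.
  apply: le_trans (_ : _ <= e / q * q) _.
    apply: ler_wpM2l; first by rewrite divr_ge0 // ltW.
    by rewrite /q lerDl.
  by rewrite mulfVK // gt_eqF.
have pres (v : nat -> op_family) (V : opfun) : (forall e : R, 0 < e -> exists n0 : nat, 
    forall n : nat, (n0 <= n)%N -> 
    forall c x, rnorm (v n c x - V c x) <= e * rnorm x) -> preserves V.
  move=> hv j w hw; apply: (bsec_lim hw) => e e0.
  have [n0 h] := hv _ e0; exists (fun c => v n0 c (w c)).
    exact: op_preserves.
  by move=> c; apply: h.
have gT : good_family T.
  have [n0 h] := hT _ ltr01.
  exists S, (bnorm (u n0) + 1); split => //.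
  - by rewrite addr_ge0 ?bnorm_ge0.
  - move=> c x; have -> : T c x = u n0 c x - (u n0 c x - T c x).
      by rewrite opprB addrC subrK.
    apply: le_trans (rnormD _ _) _; rewrite rnormN mulrDl.
    by apply: lerD; [apply: bnormP|apply: h].
  - exact: pres hT.
  - exact: pres hS.
exists (OpFamily gT) => e e0.
have e2 : 0 < e / 2 by rewrite divr_gt0.
have [n0 h] := hT _ e2; exists n0 => n hn.
apply: le_lt_trans (_ : _ <= e / 2) _; last by lra.
by apply: bnorm_le; [exact: ltW|move=> c x; rewrite subE; apply: h].
Qed.

HB.instance Definition _ := Algebra_isCStarAlg.Build R op_family
  bstarD bstarZ bstarM bstarK bnorm0_eq0 bnormD bnormZ bnormM bnorm_cstar
  bnorm_complete.

End op_family_def.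

(** * Representations obtained from the universal property *)

Section reps.
Variables (R : realType) (O : cstarAlgType R).

Lemma rep_star_left (H : hilbertType R) (pi : O -> H -> H) a x y :
  is_representation pi -> hdot (pi (star a) x) y = hdot x (pi a y).
Proof. by move=> h; rewrite (rep_star h) starK. Qed.

Lemma rep_lin (H : hilbertType R) (pi : O -> H -> H) a :
  is_representation pi -> linear (pi a).
Proof. by move=> h; case: (rep_bounded h a). Qed.

Lemma rep_scale (H : hilbertType R) (pi : O -> H -> H) a z x :
  is_representation pi -> pi a (z *: x) = z *: pi a x.
Proof.
move=> h; have h0 : pi a 0 = 0.
  by have := rep_lin a h (-1) 0 0; rewrite !scaleN1r !addNr.
by have := rep_lin a h z x 0; rewrite !addr0 h0 addr0.
Qed.

Lemma rep_0 (H : hilbertType R) (pi : O -> H -> H) a :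
  is_representation pi -> pi a 0 = 0.
Proof. by move=> h; rewrite -(scale0r (0 : H)) (rep_scale _ _ _ h) !scale0r. Qed.

Lemma rep_D (H : hilbertType R) (pi : O -> H -> H) a x y :
  is_representation pi -> pi a (x + y) = pi a x + pi a y.
Proof. by move=> h; have := rep_lin a h 1 x y; rewrite !scale1r. Qed.

Lemma rep_add (H : hilbertType R) (pi : O -> H -> H) a b x :
  is_representation pi -> pi (a + b) x = pi a x + pi b x.
Proof. by move=> h; have := rep_linear h x 1 a b; rewrite !scale1r. Qed.

Lemma rep_zero (H : hilbertType R) (pi : O -> H -> H) x :
  is_representation pi -> pi 0 x = 0.
Proof.
by move=> h; apply: (addrI (pi 0 x)); rewrite -(rep_add _ _ _ h) !addr0.
Qed.

Lemma rep_scalel (H : hilbertType R) (pi : O -> H -> H) z a x :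
  is_representation pi -> pi (z *: a) x = z *: pi a x.
Proof.
by move=> h; have := rep_linear h x z a 0; rewrite !addr0 (rep_zero _ h) addr0.
Qed.

Lemma rep_sum (H : hilbertType R) (pi : O -> H -> H) (I : Type) (r : seq I)
    (P : pred I) (F : I -> O) x :
  is_representation pi ->
  pi (\sum_(i <- r | P i) F i) x = \sum_(i <- r | P i) pi (F i) x.
Proof.
move=> h; elim/big_rec2: _ => [|i u v _ IH]; first by rewrite (rep_zero _ h).
by rewrite (rep_add _ _ _ h) IH.
Qed.

Lemma rep_bound (H : hilbertType R) (pi : O -> H -> H) a :
  is_representation pi -> exists2 M : R, 0 <= M & forall x,
    rnorm (pi a x) <= M * rnorm x.
Proof.
move=> h; have [_ [M hM]] := rep_bounded h a.
exists (cabs M); first exact: cabs_ge0.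
move=> x; have := hM x => hx.
have : `|pi a x| <= `| M * `|x| |.
  by rewrite ger0_norm // (le_trans _ hx).
by rewrite normrM normr_id !rnormE cabsE -rmorphM /= lecR.
Qed.

Section subspace_ctx.
Variables (H : hilbertType R) (M : set H) (v0 : H).
Hypothesis v0N : v0 <> 0.
Hypothesis Mlin : forall (a : R[i]) x y, M x -> M y -> M (a *: x + y).
Hypothesis Mcl : forall x, (forall e : R, 0 < e -> exists2 y, M y & rnorm (y - x) < e) ->
  M x.

Lemma subspace_ctx_lim (j : unit) (u w : unit -> H) : M (u tt) ->
    (forall e : R, 0 < e -> exists2 v : unit -> H, M (v tt) &
       forall c, rnorm (v c - w c) <= e * rnorm (u c)) -> M (w tt).
Proof.
move=> hu h; apply: Mcl => e e0.
have d0 : 0 < e / (rnorm (u tt) + 1).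
  by rewrite divr_gt0 // ltr_wpDl ?rnorm_ge0.
have [v Mv hv] := h _ d0; exists (v tt) => //.
apply: le_lt_trans (hv tt) _.
have x0 := rnorm_ge0 (u tt); have x1 : 0 < rnorm (u tt) + 1 by lra.
by rewrite mulrAC ltr_pdivrMr // ltr_pM2l // ltrDl.
Qed.

(** One Hilbert space and one closed subspace: preserving the sections means leaving
    the subspace invariant. *)
Definition subspace_ctx : section_ctx R := @SectionCtx R unit (fun=> H) unit (fun _ u => M (u tt))
  (fun _ a u v => @Mlin a (u tt) (v tt)) subspace_ctx_lim tt v0 v0N.
End subspace_ctx.

Section universal.
Variables (N : nat) (A : 'M[bool]_N) (s : 'I_N -> O).
Hypothesis hO : is_cuntz_krieger A s.

Lemma op_family_sumE (X : section_ctx R) (I : Type) (r : seq I) (P : pred I) (F : I -> op_family X) c x :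
  (\sum_(i <- r | P i) F i : op_family X) c x = \sum_(i <- r | P i) F i c x.
Proof. by elim/big_rec2: _ => [|i u v _ <-]. Qed.

(** The families t i lie in the C*-algebra of families preserving the sections and
    satisfy the Cuntz-Krieger relations there, so the universal property maps O into
    this algebra. Preservation thus holds for all elements of O at once, although
    the polynomials in the generators are not known to be dense. *)
Lemma ck_rep_family (X : section_ctx R) (t t' : 'I_N -> forall c, bfib X c -> bfib X c) :
  (forall i, is_adjoint (t i) (t' i)) ->
  (forall i, preserves (t i)) -> (forall i, preserves (t' i)) ->
  (forall i c x, t i c (t' i c (t i c x)) = t i c x) ->
  (forall i c x, t' i c (t i c x) = \sum_(j < N) (A i j)%:R *: t j c (t' j c x)) ->
  (forall c x, \sum_(i < N) t i c (t' i c x) = x) ->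
  exists pi : forall c, O -> bfib X c -> bfib X c,
    [/\ forall c, is_representation (pi c),
        forall i c x, pi c (s i) x = t i c x,
        forall a, preserves (fun c => pi c a)
      & forall a, exists2 M, 0 <= M & bounded_by (fun c => pi c a) M].
Proof.
move=> hadj hp hp' hpi hrel hsum.
(* t i and t' i are contractions, by the partial isometry relation *)
have bt i : bounded_by (t i) 1.
  move=> c x; rewrite mul1r.
  have n1 : rnorm (t' i c (t i c x)) <= rnorm x.
    set y := t' i c (t i c x).
    have [y0|y0] := eqVneq y 0; first by rewrite y0 rnorm0 rnorm_ge0.
    have p : 0 < rnorm y by rewrite lt_neqAle rnorm_ge0 eq_sym rnorm_eq0 y0.
    have : rnorm y ^+ 2 <= rnorm x * rnorm y.
      rewrite rnorm_sq {1}/y (is_adjointC (hadj i)) /y hpi hadj.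
      apply: le_trans (ler_norm _) _.
      by apply: le_trans (Re_le_cabs _) _; exact: cauchy_schwarz.
    by rewrite expr2 ler_pM2r.
  rewrite -(@ler_pXn2r _ 2) ?nnegrE ?rnorm_ge0 // rnorm_sq hadj.
  apply: le_trans (ler_norm _) _; apply: le_trans (Re_le_cabs _) _.
  apply: le_trans (cauchy_schwarz _ _) _.
  by rewrite expr2 ler_wpM2l ?rnorm_ge0.
have gt i : good_family (t i) by exists (t' i), 1; split.
pose T i : op_family X := OpFamily (gt i).
have sT i c x : star (T i) c x = t' i c x.
  by apply: (bstarE (T := T i)) => //; apply: hadj.
have ckT : ck_relations A T.
  split.
  - move=> i; apply: op_family_ext => c x.
    by rewrite -[LHS]/(t i c (star (T i) c (t i c x))) sT hpi.
  - move=> i; apply: op_family_ext => c x.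
    rewrite -[LHS]/(star (T i) c (T i c x)) sT /= hrel op_family_sumE.
    apply: eq_bigr => j _.
    by rewrite -[RHS]/((A i j)%:R *: (T j c (star (T j) c x))) sT.
  - apply: op_family_ext => c x; rewrite op_family_sumE -[RHS]/x -[RHS]hsum.
    by apply: eq_bigr => j _; rewrite -[LHS]/(T j c (star (T j) c x)) sT.
have [f [[[flin f1 fM fst] fs] _]] := hO.2 _ T ckT.
exists (fun c a x => f a c x); split.
- move=> c; split.
  + move=> a; split; first exact: op_linear.
    have [M M0 hM] := op_bounded (f a); exists M%:C => x.
    by rewrite !rnormE -rmorphM /= lecR.
  + by move=> x z a b; rewrite flin.
  + by move=> x; rewrite f1.
  + by move=> a b x; rewrite fM.
  + by move=> a x y; rewrite fst; apply: adjoint_ofP.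
- by move=> i c x; rewrite fs.
- by move=> a; apply: op_preserves.
- by move=> a; apply: op_bounded.
Qed.

Lemma rep_ck (H : hilbertType R) (pi : O -> H -> H) : is_representation pi ->
  [/\ forall i x, pi (s i) (pi (star (s i)) (pi (s i) x)) = pi (s i) x,
      forall i x, pi (star (s i)) (pi (s i) x) =
        \sum_(j < N) (A i j)%:R *: pi (s j) (pi (star (s j)) x)
    & forall x, \sum_(i < N) pi (s i) (pi (star (s i)) x) = x].
Proof.
move=> h; have [[h1 h2 h3] _] := hO; split.
- by move=> i x; rewrite -!(repM h) h1.
- move=> i x; rewrite -(repM h) h2 (rep_sum _ _ _ _ h).
  by apply: eq_bigr => j _; rewrite (rep_scalel _ _ _ h) (repM h).
- move=> x; rewrite -[RHS](rep1 h) -h3 (rep_sum _ _ _ _ h).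
  by apply: eq_bigr => j _; rewrite (repM h).
Qed.

(** A representation is a morphism to the algebra of bounded operators, and the
    universal property includes uniqueness. *)
Lemma rep_unique (H : hilbertType R) (pi pi' : O -> H -> H) :
  is_representation pi -> is_representation pi' ->
  (forall i x, pi (s i) x = pi' (s i) x) -> forall a x, pi a x = pi' a x.
Proof.
move=> h h' e a x.
have [->|/eqP x0] := eqVneq x 0; first by rewrite (rep_0 _ h) (rep_0 _ h').
pose X := @subspace_ctx H setT x x0 (fun _ _ _ _ _ => I) (fun _ _ => I).
have good (p : O -> H -> H) (hp : is_representation p) b :
    good_family (X := X) (fun _ => p b).
  have [M M0 hM] := rep_bound b hp.
  exists (fun _ => p (star b)), M; split => //.
  by move=> c y z; rewrite (rep_star hp).
pose F p hp b : op_family X := OpFamily (good p hp b).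
have sm p hp : star_morphism (F p hp).
  split.
  - move=> z b c; apply: op_family_ext => i y /=.
    by rewrite (rep_add _ _ _ hp) (rep_scalel _ _ _ hp).
  - by apply: op_family_ext => i y /=; rewrite (rep1 hp).
  - by move=> b c; apply: op_family_ext => i y /=; rewrite (repM hp).
  - move=> b; apply: op_family_ext => i y; apply/esym.
    apply: (bstarE (T := F p hp b)) => c z w /=.
    by rewrite (rep_star hp).
have ck : ck_relations A (fun i => F pi h (s i)).
  have [[h1 h2 h3] _] := hO; have [flin f1 fM fst] := sm pi h.
  have f0 : F pi h 0 = 0 by apply: op_family_ext => i y /=; rewrite (rep_zero _ h).
  have fsum (G : 'I_N -> O) : F pi h (\sum_(i < N) G i) = \sum_(i < N) F pi h (G i).
    apply: big_morph => // b c.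
    by have := flin 1 b c; rewrite !scale1r.
  have fZ z b : F pi h (z *: b) = z *: F pi h b.
    by have := flin z b 0; rewrite !addr0 f0 addr0.
  split.
  - by move=> i; rewrite /partial_isometry -fst -!fM h1.
  - move=> i; rewrite -fst -fM h2 fsum; apply: eq_bigr => j _.
    by rewrite fZ fM fst.
  - by rewrite -f1 -h3 fsum; apply: eq_bigr => j _; rewrite fM fst.
have [f [_ fu]] := hO.2 _ _ ck.
have e1 := fu (F pi h) (conj (sm pi h) (fun=> erefl)).
have e2 := fu (F pi' h').
have {}e2 : f = F pi' h'.
  apply: e2; split => // i; apply: op_family_ext => c y /=; exact/esym/e.
exact: (f_equal (fun g : O -> op_family X => @op_at R X (g a) tt x) (etrans (esym e1) e2)).
Qed.

(** The generators act in the algebra of operators leaving M invariant; the morphism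
    from O to that algebra is pi by uniqueness. *)
Lemma rep_invariant (H : hilbertType R) (pi : O -> H -> H) (M : set H) :
  is_representation pi ->
  (forall (a : R[i]) x y, M x -> M y -> M (a *: x + y)) ->
  (forall x, (forall e : R, 0 < e -> exists2 y, M y & rnorm (y - x) < e) -> M x) ->
  (forall i x, M x -> M (pi (s i) x)) ->
  (forall i x, M x -> M (pi (star (s i)) x)) ->
  forall a x, M x -> M (pi a x).
Proof.
move=> h Mlin Mcl Ms Ms' a x Mx.
have [x0|/eqP x0] := eqVneq x 0; first by rewrite x0 (rep_0 _ h) -x0.
pose X := subspace_ctx x0 Mlin Mcl.
have [h1 h2 h3] := rep_ck h.
have [rho [hr hs hp _]] := @ck_rep_family X (fun i _ => pi (s i))
  (fun i _ => pi (star (s i))) (fun i _ x y => rep_star h (s i) x y)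
  (fun i _ u => @Ms i (u tt)) (fun i _ u => @Ms' i (u tt))
  (fun i _ => h1 i) (fun i _ => h2 i) (fun _ => h3).
have -> : pi a x = rho tt a x.
  by apply: (rep_unique h (hr tt)) => i y; rewrite hs.
by apply: (hp a tt (fun=> x)).
Qed.

End universal.
End reps.

(** * The Hilbert space of square-summable functions *)

Section l2_def.
Variables (R : realType) (T : choiceType).
Implicit Types (u v w : T -> R[i]) (B : {fset T}).

Definition sqsum u B : R := \sum_(t <- B) cabs (u t) ^+ 2.

Lemma sqsum_ge0 u B : 0 <= sqsum u B.
Proof. by apply: sumr_ge0 => t _; rewrite sqr_ge0. Qed.

Lemma sqsum_mono u B B' : (B `<=` B')%fset -> sqsum u B <= sqsum u B'.
Proof.
move=> sB; rewrite /sqsum [leRHS](big_fsetID _ (mem B)) /=.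
have -> : [fset x in B' | x \in B]%fset = B.
  apply/fsetP => x; rewrite !inE /=.
  by apply/andP/idP => [[]//|xB]; split => //; apply: (fsubsetP sB).
by rewrite lerDl sumr_ge0 // => t _; rewrite sqr_ge0.
Qed.

Definition square_summable u := exists M, forall B, sqsum u B <= M.
Definition sqsum_sup u : R := sup (range (sqsum u)).

Lemma sqsum_has_sup u : square_summable u -> has_sup (range (sqsum u)).
Proof.
move=> [M h]; split; first by exists (sqsum u fset0), fset0.
by exists M => _ [B _ <-].
Qed.

Lemma sqsum_le u B : square_summable u -> sqsum u B <= sqsum_sup u.
Proof. by move=> h; apply: ub_le_sup; [case: (sqsum_has_sup h)|exists B]. Qed.

Lemma sqsum_sup_le u M : (forall B, sqsum u B <= M) -> sqsum_sup u <= M.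
Proof.
move=> h; apply: ge_sup; last by move=> _ [B _ <-].
by exists (sqsum u fset0), fset0.
Qed.

Lemma sqsum_sup_ge0 u : square_summable u -> 0 <= sqsum_sup u.
Proof. by move=> h; apply: le_trans (sqsum_le fset0 h); apply: sqsum_ge0. Qed.

Lemma sqsum1 u t : sqsum u [fset t]%fset = cabs (u t) ^+ 2.
Proof. by rewrite /sqsum big_seq_fset1. Qed.

(** Unordered summation along the finite subsets. *)
Definition has_sum w z := forall e : R, 0 < e -> exists B, forall B',
  (B `<=` B')%fset -> cabs (\sum_(t <- B') w t - z) < e.

Lemma has_sum_unique w z z' : has_sum w z -> has_sum w z' -> z = z'.
Proof.
move=> h h'; apply/eqP; rewrite -subr_eq0 -cabs_eq0 eq_le cabs_ge0 andbT.
apply/ler_addgt0Pr => e e0; rewrite add0r.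
have e2 : 0 < e / 2 by rewrite divr_gt0.
have [B hB] := h _ e2; have [B' hB'] := h' _ e2.
have := hB (B `|` B')%fset (fsubsetUl _ _).
have := hB' (B `|` B')%fset (fsubsetUr _ _).
set S := \sum_(t <- _) _ => h1 h2.
have -> : z - z' = - (S - z) + (S - z') by ring.
by have := cabsD (- (S - z)) (S - z'); rewrite cabsN; lra.
Qed.

Lemma has_sumD w w' z z' : has_sum w z -> has_sum w' z' ->
  has_sum (fun t => w t + w' t) (z + z').
Proof.
move=> h h' e e0; have e2 : 0 < e / 2 by rewrite divr_gt0.
have [B hB] := h _ e2; have [B' hB'] := h' _ e2.
exists (B `|` B')%fset => B'' sB; rewrite big_split /=.
have := hB B'' (fsubset_trans (fsubsetUl _ _) sB).
have := hB' B'' (fsubset_trans (fsubsetUr _ _) sB).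
set S := \sum_(t <- _) _; set S' := \sum_(t <- _) _ => h1 h2.
have -> : S' + S - (z + z') = (S' - z) + (S - z') by ring.
by have := cabsD (S' - z) (S - z'); lra.
Qed.

Lemma has_sumZ a w z : has_sum w z -> has_sum (fun t => a * w t) (a * z).
Proof.
move=> h e e0; have p : 0 < cabs a + 1 by rewrite ltr_wpDl ?cabs_ge0.
have [B hB] := h _ (divr_gt0 e0 p); exists B => B' sB.
rewrite -mulr_sumr -mulrBr cabsM.
have := hB B' sB; rewrite ltr_pdivlMr // => hh.
apply: le_lt_trans hh; rewrite mulrC ler_wpM2l ?cabs_ge0 //.
by rewrite lerDl.
Qed.

Lemma has_sum_conj w z : has_sum w z ->
  has_sum (fun t => Num.conj (w t)) (Num.conj z).
Proof.
move=> h e e0; have [B hB] := h _ e0; exists B => B' sB.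
by rewrite -rmorph_sum -rmorphB cabs_conj; apply: hB.
Qed.

Lemma has_sum_sq u : square_summable u ->
  has_sum (fun t => (cabs (u t) ^+ 2)%:C) (sqsum_sup u)%:C.
Proof.
move=> hu e e0; have [_ [B _ <-] hB] := sup_adherent e0 (sqsum_has_sup hu).
exists B => B' sB; rewrite -rmorph_sum -rmorphB /= cabs_real.
have h1 := sqsum_mono u sB; have h2 := sqsum_le B' hu.
move: hB h1 h2; rewrite -/(sqsum_sup u) /sqsum => hB h1 h2.
rewrite ltr_norml; lra.
Qed.

Lemma square_summableD u v : square_summable u -> square_summable v -> square_summable (fun t => u t + v t).
Proof.
move=> [M hM] [M' hM']; exists (2 * M + 2 * M') => B.
apply: le_trans (_ : _ <= 2 * sqsum u B + 2 * sqsum v B) _; last first.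
  by have := hM B; have := hM' B; lra.
rewrite /sqsum !mulr_sumr -big_split /=; apply: ler_sum => t _.
apply: le_trans (_ : _ <= (cabs (u t) + cabs (v t)) ^+ 2) _.
  by rewrite ler_pXn2r ?nnegrE ?addr_ge0 ?cabs_ge0 // cabsD.
by have := sqr_ge0 (cabs (u t) - cabs (v t)); nra.
Qed.

Lemma square_summableZ a u : square_summable u -> square_summable (fun t => a * u t).
Proof.
move=> [M hM]; exists (cabs a ^+ 2 * M) => B.
rewrite /sqsum; under eq_bigr do rewrite cabsM exprMn.
by rewrite -mulr_sumr ler_wpM2l ?sqr_ge0 //; apply: hM.
Qed.

Lemma square_summable0 : square_summable (fun=> 0).
Proof.
by exists 0 => B; rewrite /sqsum big1 // => t _; rewrite cabs0 expr0n.
Qed.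

(** Polarization: the terms are combinations of the squares of |u + v|, |u| and
    |v|, and sums of squares converge to their supremum. *)
Lemma re_dot_summable u v : square_summable u -> square_summable v ->
  exists z, has_sum (fun t => (complex.Re (u t * Num.conj (v t)))%:C) z.
Proof.
move=> hu hv.
exists (2^-1 * ((sqsum_sup (fun t => u t + v t))%:C + (-1) * ((sqsum_sup u)%:C + (sqsum_sup v)%:C))).
set w := (fun t => _).
have -> : w = fun t => 2^-1 * ((cabs (u t + v t) ^+ 2)%:C
   + (-1) * ((cabs (u t) ^+ 2)%:C + (cabs (v t) ^+ 2)%:C)).
  apply/funext => t; rewrite /w -!rmorphD.
  rewrite (_ : (-1 : R[i]) = (-1)%:C); last by rewrite rmorphN1.
  rewrite (_ : (2^-1 : R[i]) = (2^-1)%:C); last by rewrite fmorphV rmorph_nat.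
  rewrite -rmorphM -rmorphD -rmorphM; congr (_%:C).
  rewrite !cabs_sq cReD cImD cReM cRe_conj cIm_conj; by field.
apply: has_sumZ; apply: has_sumD; first exact: has_sum_sq (square_summableD hu hv).
by apply: has_sumZ; apply: has_sumD; apply: has_sum_sq.
Qed.

Lemma dot_summable u v : square_summable u -> square_summable v ->
  exists z, has_sum (fun t => u t * Num.conj (v t)) z.
Proof.
move=> hu hv; have [z hz] := re_dot_summable hu hv.
have [z' hz'] := re_dot_summable hu (square_summableZ 'i hv).
exists (z + 'i * z'); have := has_sumD hz (has_sumZ 'i hz').
congr has_sum; apply/funext => t; apply: complex_ext.
  by rewrite rmorphM /= conjE; case: (u t) => a b; case: (v t) => c d /=; ring.
by rewrite rmorphM /= conjE; case: (u t) => a b; case: (v t) => c d /=; ring.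
Qed.

Record l2 := MkL2 { l2f :> T -> R[i] ; l2P : square_summable l2f }.

Lemma l2_ext (f g : l2) : (forall t, f t = g t) -> f = g.
Proof.
case: f => f hf; case: g => g hg /= h.
have e : f = g by apply/funext.
by subst g; congr MkL2; apply: Prop_irrelevance.
Qed.

HB.instance Definition _ := gen_eqMixin l2.
HB.instance Definition _ := gen_choiceMixin l2.

Definition l2zero := MkL2 square_summable0.
Definition l2add (f g : l2) := MkL2 (square_summableD (l2P f) (l2P g)).
Definition l2scale a (f : l2) := MkL2 (square_summableZ a (l2P f)).
Definition l2opp f := l2scale (-1) f.

Fact l2addA : associative l2add.
Proof. by move=> a b c; apply: l2_ext => t /=; rewrite addrA. Qed.
Fact l2addC : commutative l2add.
Proof. by move=> a b; apply: l2_ext => t /=; rewrite addrC. Qed.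
Fact l2add0 : left_id l2zero l2add.
Proof. by move=> a; apply: l2_ext => t /=; rewrite add0r. Qed.
Fact l2addN : left_inverse l2zero l2opp l2add.
Proof. by move=> a; apply: l2_ext => t /=; rewrite mulN1r addNr. Qed.

HB.instance Definition _ := GRing.isZmodule.Build l2 l2addA l2addC l2add0 l2addN.

Fact l2scaleA a b f : l2scale a (l2scale b f) = l2scale (a * b) f.
Proof. by apply: l2_ext => t /=; rewrite mulrA. Qed.
Fact l2scale1 : left_id 1 l2scale.
Proof. by move=> f; apply: l2_ext => t /=; rewrite mul1r. Qed.
Fact l2scaleDr : right_distributive l2scale +%R.
Proof. by move=> a f g; apply: l2_ext => t /=; rewrite mulrDr. Qed.
Fact l2scaleDl f : {morph l2scale^~ f : a b / a + b}.
Proof. by move=> a b; apply: l2_ext => t /=; rewrite mulrDl. Qed.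

HB.instance Definition _ := GRing.Zmodule_isLmodule.Build R[i] l2
  l2scaleA l2scale1 l2scaleDr l2scaleDl.

Implicit Types (f g h : l2).

Lemma l2E0 t : (0 : l2) t = 0. Proof. by []. Qed.
Lemma l2ED f g t : (f + g) t = f t + g t. Proof. by []. Qed.
Lemma l2EN f t : (- f) t = - f t. Proof. by rewrite /= mulN1r. Qed.
Lemma l2EB f g t : (f - g) t = f t - g t. Proof. by rewrite l2ED l2EN. Qed.
Lemma l2EZ a f t : (a *: f) t = a * f t. Proof. by []. Qed.

Definition sqnorm (f : l2) : R := sqsum_sup f.

Lemma sqnorm_ge0 f : 0 <= sqnorm f.
Proof. exact: sqsum_sup_ge0 (l2P f). Qed.

Lemma sqsum_le_sqnorm B f : sqsum f B <= sqnorm f.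
Proof. exact: sqsum_le (l2P f). Qed.

Definition l2dot f g : R[i] := proj1_sig (cid (dot_summable (l2P f) (l2P g))).

Lemma l2dotP f g : has_sum (fun t => f t * Num.conj (g t)) (l2dot f g).
Proof. by rewrite /l2dot; case: cid. Qed.

Lemma l2dotE f g z : has_sum (fun t => f t * Num.conj (g t)) z -> l2dot f g = z.
Proof. exact: has_sum_unique (l2dotP f g). Qed.

Fact l2dotDl f g h : l2dot (f + g) h = l2dot f h + l2dot g h.
Proof.
apply: l2dotE; have := has_sumD (l2dotP f h) (l2dotP g h).
by congr has_sum; apply/funext => t /=; rewrite mulrDl.
Qed.

Fact l2dotZl a f g : l2dot (a *: f) g = a * l2dot f g.
Proof.
apply: l2dotE; have := has_sumZ a (l2dotP f g).
by congr has_sum; apply/funext => t /=; rewrite mulrA.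
Qed.

Fact l2dotC f g : l2dot g f = Num.conj (l2dot f g).
Proof.
apply: l2dotE; have := has_sum_conj (l2dotP f g).
by congr has_sum; apply/funext => t; rewrite rmorphM /= mulrC; congr (_ * _); exact: conjCK.
Qed.

Lemma l2dotxx f : l2dot f f = (sqnorm f)%:C.
Proof.
apply: l2dotE; have := has_sum_sq (l2P f).
by congr has_sum; apply/funext => t /=; rewrite -mul_conj.
Qed.

Lemma sqnormZ a f : sqnorm (a *: f) = cabs a ^+ 2 * sqnorm f.
Proof.
apply: complexI; rewrite -[LHS]l2dotxx l2dotZl l2dotC l2dotZl rmorphM /= -l2dotC l2dotxx.
by rewrite mulrA mul_conj -rmorphM.
Qed.

Lemma sqnormD f g : sqnorm (f + g) = sqnorm f + sqnorm g + 2 * complex.Re (l2dot f g).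
Proof.
have e (k : l2) : sqnorm k = complex.Re (l2dot k k) by rewrite l2dotxx.
rewrite (e (f + g)) l2dotDl (l2dotC (f + g)) (l2dotC (f + g) g) !l2dotDl.
rewrite !rmorphD /= -!l2dotC !cReD -!e (l2dotC f g) cRe_conj; ring.
Qed.

Lemma l2_cauchy_schwarz f g : complex.Re (l2dot f g) ^+ 2 <= sqnorm f * sqnorm g.
Proof.
set r := complex.Re _.
have h (a : R) : 0 <= sqnorm f + a ^+ 2 * sqnorm g + 2 * a * r.
  have := sqnorm_ge0 (f + (a%:C : R[i]) *: g).
  rewrite sqnormD sqnormZ cabs_real real_normK ?num_real //.
  by rewrite l2dotC l2dotZl rmorphM /= -l2dotC conj_realC cRe_real -/r mulrA.
have g0 := sqnorm_ge0 g; have f0 := sqnorm_ge0 f.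
move: h g0 f0; set p := sqnorm f; set q := sqnorm g => h g0 f0.
have [q0|q0] := eqVneq q 0.
  have [->|r0] := eqVneq r 0; first by rewrite q0 expr0n mulr0.
  have := h (- (p + 1) / r); rewrite q0.
  have -> : 2 * (- (p + 1) / r) * r = - (2 * (p + 1)) by field.
  lra.
have qp : 0 < q by rewrite lt_neqAle eq_sym q0.
have := h (- r / q).
have -> : p + (- r / q) ^+ 2 * q + 2 * (- r / q) * r = p - r ^+ 2 / q by field.
by rewrite subr_ge0 ler_pdivrMr.
Qed.

Definition l2norm f : R[i] := (Num.sqrt (sqnorm f))%:C.

Fact l2norm_triangle f g : l2norm (f + g) <= l2norm f + l2norm g.
Proof.
rewrite /l2norm -rmorphD lecR.
rewrite -(@ler_pXn2r _ 2) ?nnegrE ?addr_ge0 ?sqrtr_ge0 //.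
have := l2_cauchy_schwarz f g.
have [fp gp] := (sqnorm_ge0 f, sqnorm_ge0 g).
rewrite sqr_sqrtr ?(sqnorm_ge0 (f + g)) // sqnormD sqrrD !sqr_sqrtr //.
move=> cs; suff : complex.Re (l2dot f g) <= Num.sqrt (sqnorm f) * Num.sqrt (sqnorm g).
  by rewrite mulr2n; lra.
apply: le_trans (ler_norm _) _.
rewrite -(@ler_pXn2r _ 2) ?nnegrE ?mulr_ge0 ?sqrtr_ge0 ?normr_ge0 //.
by rewrite exprMn !sqr_sqrtr // real_normK ?num_real.
Qed.

Fact l2normZ (a : R[i]) f : l2norm (a *: f) = `|a| * l2norm f.
Proof.
rewrite /l2norm sqnormZ cabsE -rmorphM sqrtrM ?sqr_ge0 // sqrtr_sqr.
by rewrite ger0_norm ?cabs_ge0.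
Qed.

Lemma coord_le_sq f t : cabs (f t) ^+ 2 <= sqnorm f.
Proof. by rewrite -sqsum1; exact: (sqsum_le_sqnorm _ f). Qed.

Fact l2norm0_eq0 f : l2norm f = 0 -> f = 0.
Proof.
move=> [h]; apply: l2_ext => t; rewrite l2E0; apply/eqP; rewrite -cabs_eq0.
have f0 : sqnorm f = 0.
  by rewrite -(sqr_sqrtr (sqnorm_ge0 f)) h expr0n.
rewrite -sqrf_eq0 eq_le sqr_ge0 andbT -f0; exact: coord_le_sq.
Qed.

HB.instance Definition _ := Lmodule_isNormed.Build R[i] l2
  l2norm_triangle l2normZ l2norm0_eq0.

Lemma l2normE f : `|f| = (Num.sqrt (sqnorm f))%:C.
Proof. by []. Qed.

Lemma sqnormN f : sqnorm (- f) = sqnorm f.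
Proof. by rewrite -scaleN1r sqnormZ cabsN cabs1 expr1n mul1r. Qed.

Lemma sqnormB f g : sqnorm (f - g) = sqnorm (g - f).
Proof. by rewrite -sqnormN opprB. Qed.

(** Coordinates converge by completeness of the reals. A bound on the finite partial
    sums of squares survives in the limit, and gives both square summability of the
    limit and convergence in norm. *)
Lemma l2_cauchy_cvg (F : set_system l2) : ProperFilter F -> cauchy F -> cvg F.
Proof.
move=> FF /cauchyP Fc.
have {}Fc (e : R) : 0 < e -> exists x, F [set f | sqnorm (x - f) < e].
  move=> e0; have s0 : 0 < (Num.sqrt e)%:C by rewrite ltcR sqrtr_gt0.
  have [x hx] := Fc _ s0; exists x; move: hx; apply: filterS => f.
  by rewrite -ball_normE /ball_ /= l2normE ltcR ltr_sqrt.
have cc (c : l2 -> R) : (forall f g, `|c f - c g| ^+ 2 <= sqnorm (f - g)) ->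
    cvg (c @ F).
  move=> hc; apply: cauchy_cvg; apply: cauchy_exP => e e0.
  have [x hx] := Fc (e ^+ 2) (exprn_gt0 2 e0); exists (c x).
  change (F [set f | ball (c x) e (c f)]).
  move: hx; apply: filterS => f /= hf; rewrite /ball /= -(@ltr_pXn2r _ 2) ?nnegrE ?normr_ge0 ?ltW //.
  exact: le_lt_trans hf.
have cR t : cvg ((fun f : l2 => complex.Re (f t)) @ F).
  apply: cc => f g; apply: le_trans (coord_le_sq _ t).
  rewrite l2EB ler_pXn2r ?nnegrE ?normr_ge0 ?cabs_ge0 //.
  by rewrite -cReN -cReD Re_le_cabs.
have cI t : cvg ((fun f : l2 => complex.Im (f t)) @ F).
  apply: cc => f g; apply: le_trans (coord_le_sq _ t).
  rewrite l2EB ler_pXn2r ?nnegrE ?normr_ge0 ?cabs_ge0 //.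
  by rewrite -cImN -cImD Im_le_cabs.
pose g t : R[i] := lim ((fun f : l2 => complex.Re (f t)) @ F) +i*
                   lim ((fun f : l2 => complex.Im (f t)) @ F).
(* bounds on finite partial sums are closed conditions on coordinates *)
have key (e : R) x : F [set f | sqnorm (x - f) < e] ->
    forall B, sqsum (fun t => g t - x t) B <= e.
  move=> hx B.
  have cv : (fun f : l2 => sqsum (f - x : l2) B) @ F --> sqsum (fun t => g t - x t) B.
    rewrite /sqsum; elim: (enum_fset B) => [|t r IH].
      rewrite big_nil; under eq_fun do rewrite big_nil; exact: cvg_cst.
    rewrite big_cons; under eq_fun do rewrite big_cons.
    apply: cvgD => //; rewrite cabs_sq.
    under eq_fun do rewrite cabs_sq l2EB cReD cImD cReN cImN.
    rewrite cReD cImD cReN cImN.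
    have h1 : (fun f : l2 => complex.Re (f t) - complex.Re (x t)) @ F -->
        complex.Re (g t) - complex.Re (x t).
      by apply: cvgB; [exact: cR|exact: cvg_cst].
    have h2 : (fun f : l2 => complex.Im (f t) - complex.Im (x t)) @ F -->
        complex.Im (g t) - complex.Im (x t).
      by apply: cvgB; [exact: cI|exact: cvg_cst].
    by apply: cvgD; apply: cvgM.
  apply: (cvgr_to_le cv); move: hx; apply: filterS => f /= /ltW hf.
  by apply: le_trans (sqsum_le_sqnorm B (f - x)) _; rewrite sqnormB.
have [x1 hx1] := Fc 1 ltr01.
have gP : square_summable g.
  have : square_summable (fun t => g t - x1 t) by exists 1; exact: key hx1.
  move=> hp; have := square_summableD hp (l2P x1); congr square_summable; apply/funext => t.
  by rewrite subrK.
apply/cvg_ex; exists (MkL2 gP : l2); apply/fcvg_ballP => e /pos_real[-> e0].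
have d0 : 0 < complex.Re e / 2 by rewrite divr_gt0.
have [x hx] := Fc _ (exprn_gt0 2 d0).
apply: filterS (hx) => f /= hf.
rewrite -ball_normE /ball_ /= l2normE ltcR.
set E : l2 := MkL2 gP.
have n1 : Num.sqrt (sqnorm (E - x)) <= complex.Re e / 2.
  rewrite -(ger0_norm (ltW d0)) -sqrtr_sqr ler_wsqrtr //.
  apply: sqsum_sup_le => B; apply: le_trans (key _ _ hx B).
  by apply: ler_sum => t _; rewrite l2EB.
have n2 : Num.sqrt (sqnorm (x - f)) < complex.Re e / 2.
  by rewrite -(ger0_norm (ltW d0)) -sqrtr_sqr ltr_sqrt // exprn_gt0.
have := l2norm_triangle (E - x) (x - f).
rewrite addrA subrK /l2norm -rmorphD lecR; lra.
Qed.

HB.instance Definition _ := Uniform_isComplete.Build l2 l2_cauchy_cvg.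

Fact l2dot_norm f : l2dot f f = `|f| ^+ 2.
Proof. by rewrite l2dotxx l2normE -rmorphXn /= sqr_sqrtr // sqnorm_ge0. Qed.

HB.instance Definition _ := CompleteNormedModule_isHilbert.Build R l2
  l2dotDl l2dotZl l2dotC l2dot_norm.

Lemma l2_rnorm f : rnorm f ^+ 2 = sqnorm f.
Proof. by rewrite rnorm_sq [hdot _ _]l2dotxx. Qed.

Lemma l2_coord_le f t : cabs (f t) <= rnorm f.
Proof.
rewrite -(@ler_pXn2r _ 2) ?nnegrE ?rnorm_ge0 ?cabs_ge0 // l2_rnorm.
exact: coord_le_sq.
Qed.

Lemma l2_sum_eval (I : Type) (r : seq I) (P : pred I) (F : I -> l2) t :
  (\sum_(i <- r | P i) F i : l2) t = \sum_(i <- r | P i) F i t.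
Proof. by elim/big_rec2: _ => [|i u v _ <-]. Qed.

Lemma l2e_subproof t : square_summable (fun t' => (t' == t)%:R).
Proof.
exists 1 => B; have [tB|tB] := boolP (t \in B).
  rewrite /sqsum (big_fsetD1 t) //= eqxx cabs1 expr1n big1_fset ?addr0 //.
  by move=> t'; rewrite !inE => /andP[/negPf -> _] _; rewrite cabs0 expr0n.
rewrite /sqsum big1_fset // => t' t'B _; case: eqP => [e|_].
  by move: tB; rewrite -e t'B.
by rewrite cabs0 expr0n.
Qed.

Definition l2e t : l2 := MkL2 (l2e_subproof t).

Lemma l2eE t t' : l2e t t' = (t' == t)%:R. Proof. by []. Qed.

Lemma l2_dot_e f t : hdot f (l2e t) = f t.
Proof.
apply: l2dotE => e e0; exists [fset t]%fset => B; rewrite fsub1set => tB.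
rewrite (big_fsetD1 t) //= eqxx conjC1 mulr1 big1_fset ?addr0 ?subrr ?cabs0 //.
by move=> t'; rewrite !inE => /andP[/negPf -> _] _; rewrite conjC0 mulr0.
Qed.

Lemma l2e_orthonormal : orthonormal_family l2e.
Proof. by move=> t t'; rewrite l2_dot_e l2eE eq_sym. Qed.

Definition l2trunc f B : l2 := \sum_(t <- B) f t *: l2e t.

Lemma l2truncE f B t : l2trunc f B t = if t \in B then f t else 0.
Proof.
rewrite /l2trunc l2_sum_eval; case: ifPn => tB.
  rewrite (big_fsetD1 t) //= eqxx mulr1 big1_fset ?addr0 //.
  by move=> t'; rewrite !inE eq_sym => /andP[/negPf -> _] _; rewrite mulr0.
rewrite big1_fset // => t' t'B _; rewrite l2EZ l2eE.
by case: eqP => [e|_]; [rewrite e t'B in tB|rewrite mulr0].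
Qed.

Lemma l2_dist_trunc f B : sqnorm (f - l2trunc f B) <= sqnorm f - sqsum f B.
Proof.
apply: sqsum_sup_le => B'.
set D := [fset x in B' | x \notin B]%fset.
have -> : sqsum (f - l2trunc f B : l2) B' = sqsum f D.
  rewrite /sqsum (big_fsetID _ (mem B)) /= big1_fset ?add0r.
    apply: eq_big_seq => t; rewrite !inE /= => /andP[_ /negPf tB].
    rewrite -[X in cabs X]/((f - l2trunc f B : l2) t).
    by rewrite l2EB l2truncE tB subr0.
  move=> t; rewrite !inE /= => /andP[_ tB] _.
  rewrite -[X in cabs X]/((f - l2trunc f B : l2) t).
  by rewrite l2EB l2truncE tB subrr cabs0 expr0n.
rewrite lerBrDr addrC; apply: le_trans (sqsum_le_sqnorm (B `|` B')%fset f).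
rewrite {3}/sqsum (big_fsetID _ (mem B)) /= le_eqVlt; apply/orP; left; apply/eqP.
congr (_ + _); congr (\sum_(_ <- enum_fset _) _).
  by apply/fsetP => x; rewrite !inE /=; case: (x \in B); rewrite ?andbF.
by apply/fsetP => x; rewrite !inE /=; case: (x \in B); rewrite ?andbF.
Qed.

(** The norm of the remainder is the defect of a partial sum from its supremum. *)
Lemma l2_dense f (e : R) : 0 < e ->
  exists B, forall B', (B `<=` B')%fset -> rnorm (f - l2trunc f B') < e.
Proof.
move=> e0; have [_ [B _ <-] hB] := sup_adherent (exprn_gt0 2 e0) (sqsum_has_sup (l2P f)).
exists B => B' sB.
rewrite -(@ltr_pXn2r _ 2) ?nnegrE ?rnorm_ge0 ?(ltW e0) // l2_rnorm.
apply: le_lt_trans (l2_dist_trunc f B') _.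
have := sqsum_mono f sB; move: hB; rewrite -/(sqsum_sup f) -/(sqnorm f); lra.
Qed.

End l2_def.

(** * Branching systems and their operators *)

Section wcomp_def.
Variables (R : realType) (T : choiceType).
Implicit Types (P : pred T) (h : T -> T) (w : T -> R[i]) (f g : l2 R T).

Definition wcomp_fun P h w (f : T -> R[i]) : T -> R[i] :=
  fun y => if P y then w y * f (h y) else 0.

Lemma wcomp_sqsum P h w f : {in P &, injective h} -> (forall y, cabs (w y) <= 1) ->
  forall B, sqsum (wcomp_fun P h w f) B <= sqnorm f.
Proof.
move=> hinj hw B.
apply: le_trans (sqsum_le_sqnorm [fset h y | y in [fset y in B | P y]]%fset f).
rewrite /sqsum big_imfset /=; last first.
  by move=> x y; rewrite !inE => /andP[_ Px] /andP[_ Py]; apply: hinj.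
rewrite (big_fsetID _ P) /= [X in _ + X]big1_fset ?addr0; last first.
  by move=> y; rewrite !inE => /andP[_ /negPf Py] _; rewrite /wcomp_fun Py cabs0 expr0n.
rewrite big_seq [leRHS]big_seq; apply: ler_sum => y; rewrite !inE => /andP[_ Py].
rewrite /wcomp_fun Py cabsM ler_pXn2r ?nnegrE ?mulr_ge0 ?cabs_ge0 //.
by rewrite -[leRHS]mul1r ler_wpM2r ?cabs_ge0.
Qed.

(** Data of the operator f |-> weight * (f o wmap), with value 0 off the domain.
    Injectivity and weights of modulus at most 1 make it a contraction. The
    generators and their adjoints have this form in every model below. *)
Record wcomp_data := WCompData { wdom : pred T ; wmap : T -> T ; weight : T -> R[i] ;
  wmap_inj : {in wdom &, injective wmap} ; weight_le1 : forall y, cabs (weight y) <= 1 }.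
Implicit Types (D : wcomp_data).

Lemma wcomp_square_summable D f : square_summable (wcomp_fun (wdom D) (wmap D) (weight D) f).
Proof. by exists (sqnorm f); apply: wcomp_sqsum; [exact: wmap_inj|exact: weight_le1]. Qed.

Definition wcomp D f : l2 R T := MkL2 (wcomp_square_summable D f).

Lemma wcompE D f y : wcomp D f y = if wdom D y then weight D y * f (wmap D y) else 0.
Proof. by []. Qed.

Lemma wcompD D f g : wcomp D (f + g) = wcomp D f + wcomp D g.
Proof.
apply: l2_ext => y; rewrite l2ED !wcompE; case: ifP => _; last by rewrite addr0.
by rewrite l2ED mulrDr.
Qed.

Lemma wcompZ D a f : wcomp D (a *: f) = a *: wcomp D f.
Proof.
apply: l2_ext => y; rewrite l2EZ !wcompE; case: ifP => _; last by rewrite mulr0.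
by rewrite l2EZ mulrCA.
Qed.

Lemma wcomp0 D : wcomp D 0 = 0.
Proof. by rewrite -(scale0r (0 : l2 R T)) wcompZ !scale0r. Qed.

Lemma wcomp_sum D (I : Type) (r : seq I) (F : I -> l2 R T) :
  wcomp D (\sum_(i <- r) F i) = \sum_(i <- r) wcomp D (F i).
Proof.
elim/big_rec2: _ => [|i u v _ IH]; first exact: wcomp0.
by rewrite wcompD IH.
Qed.

Lemma wcomp_norm D f : rnorm (wcomp D f) <= rnorm f.
Proof.
rewrite -(@ler_pXn2r _ 2) ?nnegrE ?rnorm_ge0 // !l2_rnorm.
by apply: sqsum_sup_le; apply: wcomp_sqsum; [exact: wmap_inj|exact: weight_le1].
Qed.

Definition mutual_adjoint D D' :=
  [/\ forall y, wdom D y -> wdom D' (wmap D y) /\ wmap D' (wmap D y) = y,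
      forall x, wdom D' x -> wdom D (wmap D' x) /\ wmap D (wmap D' x) = x
    & forall x, wdom D' x -> weight D' x = Num.conj (weight D (wmap D' x))].

Lemma wcomp_e D D' t : mutual_adjoint D D' ->
  wcomp D (l2e R t) = if wdom D' t then weight D (wmap D' t) *: l2e R (wmap D' t) else 0.
Proof.
move=> [h1 h2 h3]; apply: l2_ext => y; rewrite wcompE l2eE.
have [Py|Py] := boolP (wdom D y).
  have [Py' e] := h1 _ Py; have [et|et] := eqVneq (wmap D y) t.
    by rewrite -et Py' l2EZ e l2eE eqxx.
  rewrite mulr0; case: ifPn => [Pt|//]; rewrite l2EZ l2eE.
  case: eqP => [ey|]; last by rewrite mulr0.
  by have [_] := h2 _ Pt; rewrite -ey => /eqP; rewrite (negPf et).
case: ifPn => [Pt|//]; rewrite l2EZ l2eE.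
case: eqP => [ey|]; last by rewrite mulr0.
by have [] := h2 _ Pt; rewrite -ey (negPf Py).
Qed.

(** Both sides agree on the basis vectors, hence on the truncations, which are dense. *)
Lemma wcomp_adj D D' f g : mutual_adjoint D D' -> hdot (wcomp D f) g = hdot f (wcomp D' g).
Proof.
move=> hD; apply/eqP; rewrite -subr_eq0 -cabs_eq0 eq_le cabs_ge0 andbT.
apply/ler_addgt0Pr => e e0; rewrite add0r.
have p : 0 < rnorm g + rnorm g + 1 by rewrite ltr_wpDl ?addr_ge0 ?rnorm_ge0.
have [B hB] := l2_dense f (divr_gt0 e0 p).
have := hB B (fsubset_refl _); set k := l2trunc f B => hk.
have ek : hdot (wcomp D k) g = hdot k (wcomp D' g).
  rewrite /k /l2trunc wcomp_sum !hdot_suml; apply: eq_bigr => t _.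
  rewrite wcompZ !hdotZl (wcomp_e t hD); congr (_ * _).
  rewrite [RHS]hdotC l2_dot_e wcompE; case: ifP => Pt; last by rewrite hdot0l conjC0.
  have [_ _ h3] := hD.
  by rewrite h3 // rmorphM /= conjCK hdotZl hdotC l2_dot_e.
have -> : hdot (wcomp D f) g - hdot f (wcomp D' g) =
    hdot (wcomp D (f - k)) g - hdot (f - k) (wcomp D' g).
  have -> : f - k = f + (-1 : R[i]) *: k by rewrite scaleN1r.
  by rewrite wcompD wcompZ !hdotDl !hdotZl ek; ring.
apply: le_trans (cabsD _ _) _; rewrite cabsN.
apply: le_trans (lerD (cauchy_schwarz _ _) (cauchy_schwarz _ _)) _.
have n1 := wcomp_norm D (f - k); have n2 := wcomp_norm D' g.
apply: le_trans (_ : _ <= rnorm (f - k) * (rnorm g + rnorm g + 1)) _.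
  by have := rnorm_ge0 (f - k); have := rnorm_ge0 g; nra.
by rewrite -ler_pdivlMr // ltW.
Qed.

End wcomp_def.

(** The combinatorics of a permutative representation: [cons_of i x] is the symbol
    of the basis vector to which s_i maps the basis vector of x, up to a phase. *)
Record branching (N : nat) (A : 'M[bool]_N) := Branching {
  symbol :> choiceType ; head_of : symbol -> 'I_N ; tail_of : symbol -> symbol ; cons_of : 'I_N -> symbol -> symbol ;
  cons_ofP : forall i x, A i (head_of x) -> head_of (cons_of i x) = i /\ tail_of (cons_of i x) = x ;
  tail_ofP : forall y, A (head_of y) (head_of (tail_of y)) /\ cons_of (head_of y) (tail_of y) = y }.

Section branching_rep.
Variables (R : realType) (N : nat) (A : 'M[bool]_N) (T : branching A).
Variable (phi : T -> R[i]).
Hypothesis phi1 : forall y, cabs (phi y) = 1.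

Lemma tail_of_inj i : {in (fun y : T => head_of y == i) &, injective (@tail_of _ _ T)}.
Proof.
move=> x y /eqP hx /eqP hy e.
by rewrite -(tail_ofP x).2 -(tail_ofP y).2 hx hy e.
Qed.
Lemma phase_le1 y : cabs (phi y) <= 1. Proof. by rewrite phi1. Qed.

Lemma cons_of_inj i : {in (fun x : T => A i (head_of x)) &, injective (@cons_of _ _ T i)}.
Proof.
by move=> x y hx hy e; rewrite -(cons_ofP hx).2 -(cons_ofP hy).2 e.
Qed.
Lemma phase_adj_le1 i y : cabs (Num.conj (phi (cons_of i y))) <= 1.
Proof. by rewrite cabs_conj phi1. Qed.

Definition gen_data i := WCompData (@tail_of_inj i) phase_le1.
Definition gen_data_adj i := WCompData (@cons_of_inj i) (phase_adj_le1 i).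

Lemma gen_mutual_adjoint i : mutual_adjoint (gen_data i) (gen_data_adj i).
Proof.
split=> //=.
- by move=> y /eqP hy; rewrite -hy; have [h ->] := tail_ofP y.
- by move=> x hx; have [-> ->] := cons_ofP hx.
Qed.

Lemma phi_sq y : phi y * Num.conj (phi y) = 1.
Proof. by rewrite mul_conj phi1 expr1n. Qed.

Lemma gen_adj_gen i f x : wcomp (gen_data_adj i) (wcomp (gen_data i) f) x =
  if A i (head_of x) then f x else 0.
Proof.
rewrite !wcompE /=; case: ifP => // hx; have [-> ->] := cons_ofP hx.
by rewrite eqxx mulrA [X in X * _]mulrC phi_sq mul1r.
Qed.

Lemma gen_gen_adj i f y : wcomp (gen_data i) (wcomp (gen_data_adj i) f) y =
  if head_of y == i then f y else 0.
Proof.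
rewrite !wcompE /=; case: eqP => // <-; have [h e] := tail_ofP y.
by rewrite h e mulrA phi_sq mul1r.
Qed.

Lemma gen_partial_isometry i f : wcomp (gen_data i) (wcomp (gen_data_adj i) (wcomp (gen_data i) f)) = wcomp (gen_data i) f.
Proof.
apply: l2_ext => y; rewrite gen_gen_adj; case: ifP => // h.
by rewrite wcompE /= h.
Qed.

Lemma gen_relation i f : wcomp (gen_data_adj i) (wcomp (gen_data i) f) =
  \sum_(j < N) (A i j)%:R *: wcomp (gen_data j) (wcomp (gen_data_adj j) f).
Proof.
apply: l2_ext => y; rewrite gen_adj_gen l2_sum_eval (bigD1 (head_of y)) //=.
rewrite big1 ?addr0; last first.
  move=> j jy; rewrite -[LHS]/(_ * wcomp (gen_data j) (wcomp (gen_data_adj j) f) y) gen_gen_adj.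
  by rewrite eq_sym (negPf jy) mulr0.
rewrite -[RHS]/(_ * wcomp (gen_data (head_of y)) (wcomp (gen_data_adj (head_of y)) f) y) gen_gen_adj eqxx.
by case: (A i _); rewrite ?mul1r ?mul0r.
Qed.

Lemma gen_complete f : \sum_(i < N) wcomp (gen_data i) (wcomp (gen_data_adj i) f) = f.
Proof.
apply: l2_ext => y; rewrite l2_sum_eval (bigD1 (head_of y)) // gen_gen_adj eqxx.
rewrite big1; first exact: addr0.
by move=> j jy; rewrite gen_gen_adj eq_sym (negPf jy).
Qed.

Lemma gen_basis i x : wcomp (gen_data i) (l2e R x) =
  if A i (head_of x) then phi (cons_of i x) *: l2e R (cons_of i x) else 0.
Proof. by rewrite (wcomp_e _ (gen_mutual_adjoint i)). Qed.

End branching_rep.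

(** * Periodic sequences and canonical words *)

Section periodic_words.
Variables (N : nat).
Implicit Types (w : nat -> 'I_N) (J : seq 'I_N).

Definition period w d := forall n, w (n + d)%N = w n.
Definition minimal_period w p :=
  [/\ (0 < p)%N, period w p & forall d, (0 < d < p)%N -> ~ period w d].

Lemma period_mul w d k : period w d -> period w (k * d)%N.
Proof.
move=> h; elim: k => [|k IH] n; first by rewrite addn0.
by rewrite mulSn addnCA addnC h IH.
Qed.

Lemma period_mod w p : period w p -> forall n, w (n %% p)%N = w n.
Proof.
by move=> h n; rewrite [in RHS](divn_eq n p) addnC (period_mul _ h).
Qed.

Lemma period_dvd w p d : minimal_period w p -> period w d -> (p %| d)%N.
Proof.
move=> [p0 hp hmin] hd; rewrite /dvdn -leqn0 leqNgt; apply/negP => r0.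
apply: (hmin (d %% p)%N); first by rewrite r0 ltn_pmod.
move=> n; rewrite -[LHS](period_mul (d %/ p) hp).
by rewrite -addnA [(_ %% _ + _)%N]addnC -divn_eq hd.
Qed.

(** Every position is, modulo p, a position beyond a. *)
Lemma period_tail w p a d : (0 < p)%N -> period w p ->
  (forall n, w (a + n + d)%N = w (a + n)%N) -> period w d.
Proof.
move=> p0 hp h n; rewrite -(period_mul a hp) -[RHS](period_mul a hp).
have e : (a <= a * p)%N by rewrite leq_pmulr.
have -> : (n + d + a * p = a + (n + (a * p - a)) + d)%N by lia.
by rewrite h; congr w; lia.
Qed.

Lemma word_power_size (J : seq 'I_N) m : size (word_power J m) = (m * size J)%N.
Proof. by rewrite /word_power size_flatten /shape map_nseq sumn_nseq mulnC. Qed.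

Lemma word_power_nth d J m l : (l < m * size J)%N ->
  nth d (word_power J m) l = nth d J (l %% size J)%N.
Proof.
elim: m l => [//|m IH] l; rewrite mulSn => hl.
rewrite /word_power /= nth_cat; case: ltnP => hJ; first by rewrite modn_small.
rewrite -/(word_power J m) IH; last by lia.
by rewrite -[in RHS](subnK hJ) modnDr.
Qed.

(** The repetition J J J ...; d is a default letter for empty J. *)
Definition repeat_word (d : 'I_N) J n := nth d J (n %% size J)%N.

Lemma repeat_word_period d J : period (repeat_word d J) (size J).
Proof. by move=> n; rewrite /repeat_word modnDr. Qed.

Lemma mkseq_repeat_word d J : mkseq (repeat_word d J) (size J) = J.
Proof.
apply: (@eq_from_nth _ d); first by rewrite size_mkseq.
by move=> i; rewrite size_mkseq => hi; rewrite nth_mkseq // /repeat_word modn_small.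
Qed.

Lemma period_word_power d J k p : size J = (k * p)%N -> (0 < p)%N ->
  period (repeat_word d J) p -> J = word_power (take p J) k.
Proof.
move=> sJ p0 hp; case: (posnP k) => [k0|k0].
  by rewrite k0 /word_power /=; apply: size0nil; rewrite sJ k0.
have st : size (take p J) = p by rewrite size_take sJ; case: ltnP => //; nia.
apply: (@eq_from_nth _ d); first by rewrite word_power_size st.
move=> i hi; rewrite word_power_nth ?st -?sJ // nth_take ?ltn_pmod //.
have e1 : nth d J i = repeat_word d J i by rewrite /repeat_word modn_small.
have h2 : (i %% p < size J)%N by apply: leq_ltn_trans hi; apply: leq_mod.
have e2 : nth d J (i %% p) = repeat_word d J (i %% p)%N by rewrite /repeat_word (modn_small h2).
by rewrite e1 e2 (period_mod hp).
Qed.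

(** The least period of the repetition divides both the length of J and any other
    period, so a proper one would exhibit J as a power of a prefix. *)
Lemma nonperiodic_min d J : J <> [::] -> ~ periodic_word J ->
  minimal_period (repeat_word d J) (size J).
Proof.
move=> J0 hJ; have p0 : (0 < size J)%N by case: (J) J0.
split; [by []|exact: repeat_word_period|move=> e /andP[e0 eJ] he].
have [m [m0 hm hmin]] : exists m, minimal_period (repeat_word d J) m.
  have ex : exists m, (0 < m)%N && `[< period (repeat_word d J) m >].
    by exists e; rewrite e0; apply/asboolP.
  exists (ex_minn ex); case: ex_minnP => m /andP[m0 /asboolP hm] h; split => //.
  move=> f /andP[f0 fm] hf; have := h f; rewrite f0 /=.
  by move/asboolP: hf => -> /(_ isT); rewrite leqNgt fm.
have [/dvdnP[k sJ] /dvdnP[l el]] :=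
  (period_dvd (And3 m0 hm hmin) (repeat_word_period d J), period_dvd (And3 m0 hm hmin) he).
apply: hJ; exists (take m J), k; split; last exact: period_word_power sJ m0 hm.
  by move/(congr1 size); rewrite size_take sJ; case: ltnP => /= ; nia.
have lk : (l < k)%N by rewrite -(ltn_pmul2r m0) -el -sJ.
have l0 : (0 < l)%N by rewrite lt0n; apply/eqP => l0; rewrite el l0 in e0.
by lia.
Qed.

Lemma min_nonperiodic d J : minimal_period (repeat_word d J) (size J) -> ~ periodic_word J.
Proof.
move=> [p0 hp hmin] [J0 [m [J0n m2 eJ]]].
have s0 : (0 < size J0)%N by case: (J0) J0n.
have sJ : size J = (m * size J0)%N by rewrite eJ word_power_size.
apply: (hmin (size J0)); first by rewrite s0 sJ; nia.
have h n : repeat_word d J n = nth d J0 (n %% size J0)%N.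
  rewrite /repeat_word {1}eJ word_power_nth; last by rewrite -sJ ltn_pmod.
  by rewrite modn_dvdm // sJ dvdn_mull.
by move=> n; rewrite !h modnDr.
Qed.

(** The number written by J in base N, by which minimality compares rotations. *)
Definition word_value J : int :=
  \sum_(0 <= l < size J) (nth 0%N (map val J) l)%:Z * N%:Z ^+ (size J - l.+1).

Lemma minimal_word_value J : minimal_word J <-> forall r, word_value J <= word_value (rot r J).
Proof.
have e r : \sum_(0 <= l < size J)
   ((nth 0%N (map val (rot r J)) l)%:Z - (nth 0%N (map val J) l)%:Z)
           * (N%:Z) ^+ (size J - l.+1) = word_value (rot r J) - word_value J :> int.
  rewrite /word_value size_rot -sumrB; apply: eq_bigr => l _; by rewrite mulrBl.
by split => h r; have := h r; rewrite e subr_ge0.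
Qed.

Lemma word_value_cons x J : word_value (x :: J) = (val x)%:Z * N%:Z ^+ size J + word_value J.
Proof.
rewrite /word_value /= big_nat_recl //= subn1 /=; congr (_ + _).
Qed.

Lemma word_value_ge0 J : 0 <= word_value J.
Proof. by rewrite sumr_ge0 // => l _; rewrite mulr_ge0 // exprn_ge0. Qed.

Lemma word_value_lt J : word_value J < N%:Z ^+ size J.
Proof.
elim: J => [|x J IH]; first by rewrite /word_value big_geq.
rewrite word_value_cons /= exprS.
apply: lt_le_trans (_ : _ < (val x)%:Z * N%:Z ^+ size J + N%:Z ^+ size J) _.
  by rewrite ltrD2l.
rewrite -[X in _ + X]mul1r -mulrDl ler_wpM2r ?exprn_ge0 //.
by rewrite addrC -intS lez_nat; exact: ltn_ord.
Qed.

Lemma word_value_inj J J' : size J = size J' -> word_value J = word_value J' -> J = J'.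
Proof.
elim: J J' => [|x J IH] [|y J'] //= [sJ]; rewrite !word_value_cons sJ => e.
have h1 := word_value_ge0 J; have h2 := word_value_ge0 J'.
have h3 := word_value_lt J; have h4 := word_value_lt J'; rewrite sJ in h3.
set M := N%:Z ^+ size J' in e h3 h4.
have exy : val x = val y.
  have M0 : 0 < M by lia.
  apply/eqP; rewrite eqn_leq; apply/andP; split; rewrite leqNgt; apply/negP => hlt.
    have : ((val y)%:Z + 1) * M <= (val x)%:Z * M by rewrite ler_pM2r //; lia.
    rewrite mulrDl mul1r; lia.
  have : ((val x)%:Z + 1) * M <= (val y)%:Z * M by rewrite ler_pM2r //; lia.
  rewrite mulrDl mul1r; lia.
move: e; rewrite exy => /addrI /(IH _ sJ) ->.
by congr (_ :: _); apply: val_inj.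
Qed.

Lemma rot_repeat_word d J r : (r <= size J)%N ->
  rot r J = mkseq (fun n => repeat_word d J (n + r)) (size J).
Proof.
move=> rJ; apply: (@eq_from_nth _ d); first by rewrite size_rot size_mkseq.
move=> i; rewrite size_rot => hi; rewrite nth_mkseq // /rot nth_cat size_drop.
rewrite /repeat_word; case: ltnP => h.
  by rewrite nth_drop addnC modn_small //; lia.
rewrite nth_take; last by lia.
have -> : (i + r = (i - (size J - r)) + size J)%N by lia.
by rewrite modnDr modn_small //; lia.
Qed.

(** A common tail forces equal least periods, that is equal lengths, and each word
    is a rotation of the other. Both being minimal, their values are equal, and the
    value determines a word of given length. *)
Lemma canonical_unique (A : 'M[bool]_N) d J J' a b :
  canonical_word A J -> canonical_word A J' ->
  (forall n, repeat_word d J (a + n)%N = repeat_word d J' (b + n)%N) -> J = J'.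
Proof.
move=> [[J0 _] /minimal_word_value mJ nJ] [[J0' _] /minimal_word_value mJ' nJ'] h.
have [p0 hp hmin] := nonperiodic_min d J0 nJ.
have [p0' hp' hmin'] := nonperiodic_min d J0' nJ'.
have d1 : (size J %| size J')%N.
  apply: period_dvd (And3 p0 hp hmin) _.
  apply: (period_tail (a := a) p0 hp) => n.
  by rewrite -addnA !h addnA hp'.
have d2 : (size J' %| size J)%N.
  apply: period_dvd (And3 p0' hp' hmin') _.
  apply: (period_tail (a := b) p0' hp') => n.
  by rewrite -addnA -!h addnA hp.
have sJ : size J = size J' by apply/eqP; rewrite eqn_dvd d1 d2.
(* shift by a multiple of the length to make the two offsets comparable *)
have half (I I' : seq 'I_N) u v : (0 < size I)%N -> size I = size I' ->
    (forall n, repeat_word d I (u + n)%N = repeat_word d I' (v + n)%N) ->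
    exists r, I' = rot r I.
  move=> I0 sI hI.
  exists ((u + (size I * v - v)) %% size I)%N.
  rewrite (rot_repeat_word d); last by rewrite ltnW // ltn_pmod.
  rewrite -(mkseq_repeat_word d I') -sI; apply: eq_mkseq => n.
  rewrite -(period_mul v (repeat_word_period d I')) -sI.
  have -> : (n + v * size I = v + (n + (size I * v - v)))%N.
    have : (v <= size I * v)%N by rewrite leq_pmull.
    lia.
  by rewrite -hI /repeat_word modnDmr; congr (nth _ _ (_ %% _)%N); lia.
have [r er] := half J J' a b p0 sJ h.
have [r' er'] := half J' J b a p0' (esym sJ) (fun n => esym (h n)).
have h1 : word_value J <= word_value J' by rewrite er; apply: mJ.
have h2 : word_value J' <= word_value J by rewrite er'; apply: mJ'.
by apply: word_value_inj => //; apply/eqP; rewrite eq_le h1 h2.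
Qed.

Lemma cyclic_repeat_word (A : 'M[bool]_N) d J : J <> [::] ->
  admissible_word A (repeat_word d J) -> cyclic_word A J.
Proof.
move=> J0 hA; split => //; rewrite -(mkseq_repeat_word d J).
case: (size J) (repeat_word_period d J) (size_eq0 J) => [|p] hp s0.
  by move/esym: s0; rewrite eqxx => /eqP.
rewrite /mkseq /= -cats1.
have -> : [seq repeat_word d J i | i <- iota 1 p] ++ [:: repeat_word d J 0%N] =
   mkseq (fun n => repeat_word d J n.+1) p.+1.
  rewrite mkseqS /= cats1; congr rcons; last by rewrite -(hp 0%N).
  by rewrite -[1%N]addn0 iotaDl -map_comp /mkseq; apply: eq_map.
apply/(pathP d) => i; rewrite size_mkseq => hi.
rewrite nth_mkseq //; case: i hi => [|i] hi /=; first exact: hA.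
by rewrite nth_mkseq; [apply: hA|lia].
Qed.

(** Cut a block of K of length the least eventual period, and take the rotation of
    it with the least value. The least eventual period cannot be shortened, so this
    rotation is nonperiodic. *)
Lemma canonical_exists (A : 'M[bool]_N) (K : nat -> 'I_N) :
  admissible_word A K -> eventually_periodic K ->
  exists J a, canonical_word A J /\ forall n, K (a + n)%N = repeat_word (K 0%N) J n.
Proof.
move=> hK [J0 [J1 [J0n J1n hJ]]].
set q := size J1; set a1 := size J0; set d := K 0%N.
have q0 : (0 < q)%N by rewrite /q; case: (J1) J1n.
have Kper n : K (a1 + n)%N = nth d J1 (n %% q)%N.
  have := congr1 (fun s => nth d s (a1 + n)) (hJ n.+1).
  rewrite nth_mkseq; last by rewrite -/q -/a1 ltn_add2l; nia.
  rewrite nth_cat -/a1 ltnNge leq_addr /= addKn => ->.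
  by rewrite word_power_nth // -/q; nia.
pose P m := (0 < m)%N && `[< exists a, forall n, K (a + n + m)%N = K (a + n)%N >].
have exP : exists m, P m.
  exists q; rewrite /P q0; apply/asboolP; exists a1 => n.
  by rewrite -addnA !Kper modnDr.
case: (ex_minnP exP) => p /andP[p0 /asboolP[a ha]] hmin.
pose J2 := mkseq (fun n => K (a + n)%N) p.
have sJ2 : size J2 = p by rewrite size_mkseq.
have per2 n : K (a + n)%N = repeat_word d J2 n.
  have hp : period (fun n => K (a + n)%N) p by move=> k; rewrite addnA ha.
  by rewrite /repeat_word sJ2 nth_mkseq ?ltn_pmod // (period_mod hp).
pose r0 : 'I_p := Ordinal p0.
pose r := [arg min_(r < r0) `|word_value (rot r J2)|%N].
pose J := rot r J2.
have sJ : size J = p by rewrite size_rot.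
have perJ n : K (a + r + n)%N = repeat_word d J n.
  rewrite -addnA per2 /repeat_word sJ2 sJ /J (rot_repeat_word d); last by rewrite sJ2 ltnW.
  rewrite sJ2 nth_mkseq ?ltn_pmod // /repeat_word sJ2.
  by rewrite modnDml addnC.
have Jn : J <> [::] by move=> e; have := p0; rewrite -sJ e.
exists J, (a + r)%N; split; last exact: perJ.
split.
- apply: (cyclic_repeat_word (d := d)) => // n; rewrite -!perJ addnS; exact: hK.
- apply/minimal_word_value => t.
  have [r' er'] : exists r' : 'I_p, rot t J = rot r' J2.
    have [tp|tp] := ltnP t p; last by exists r; rewrite rot_oversize ?sJ.
    rewrite /J rot_add_mod ?sJ2 ?(ltnW tp) ?(ltnW (ltn_ord r)) //.
    case: ifP => h.
      have [e|e] := eqVneq (t + r)%N p.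
        by exists r0; rewrite e rot0 rot_oversize ?sJ2.
      have lt : (t + r < p)%N by rewrite ltn_neqAle e h.
      by exists (Ordinal lt).
    have lt : (t + r - p < p)%N by have := ltn_ord r; lia.
    by exists (Ordinal lt).
  rewrite er' /J /r; case: arg_minnP => // i _ /(_ r' isT).
  have h1 := word_value_ge0 (rot i J2); have h2 := word_value_ge0 (rot r' J2); lia.
- apply: (min_nonperiodic (d := d)); rewrite sJ; split => //.
    by rewrite -sJ; apply: repeat_word_period.
  move=> e /andP[e0 ep] he; have := hmin e; rewrite leqNgt ep /P e0 /=.
  suff -> : `[< exists a, forall n, K (a + n + e)%N = K (a + n)%N >] by move/(_ isT).
  by apply/asboolP; exists (a + r)%N => n; rewrite -addnA !perJ.
Qed.

End periodic_words.

(** * Words with a given periodic tail *)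

Section tail_words.
Variables (N : nat) (A : 'M[bool]_N) (w0 : nat -> 'I_N) (p : nat).
Hypothesis hp : minimal_period w0 p.
Hypothesis hA : admissible_word A w0.

Definition has_tail (w : nat -> 'I_N) :=
  admissible_word A w /\ exists a, forall n, w (a + n)%N = w0 n.

Definition tail_word : choiceType := {w : nat -> 'I_N | `[< has_tail w >]}.
Implicit Types (x y : tail_word).

Lemma tail_wordP x : has_tail (val x).
Proof. by apply/asboolP; exact: (valP x). Qed.

Definition mk_tail_word w (hw : has_tail w) : tail_word := exist _ w (asboolT hw).

Lemma tail_word_ext x y : (forall n, val x n = val y n) -> x = y.
Proof. by move=> h; apply: val_inj; apply/funext. Qed.

Lemma has_tail_base : has_tail w0.
Proof. by split => //; exists 0%N. Qed.

Definition base_word : tail_word := mk_tail_word has_tail_base.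

Lemma has_tail_shift x : has_tail (fun n => val x n.+1).
Proof.
have [h [a ha]] := tail_wordP x; split; first by move=> n; apply: h.
have [p0 hper _] := hp.
exists (a + p.-1)%N => n; rewrite -addSn -addnS prednK // -addnA ha addnC.
exact: hper.
Qed.

Definition word_head x : 'I_N := val x 0%N.
Definition word_tail x : tail_word := mk_tail_word (has_tail_shift x).

Definition cons_seq (i : 'I_N) (w : nat -> 'I_N) n := if n is m.+1 then w m else i.

Lemma has_tail_cons i x : A i (word_head x) -> has_tail (cons_seq i (val x)).
Proof.
move=> hi; have [h [a ha]] := tail_wordP x; split; first by case.
by exists a.+1.
Qed.

(** The junk value x covers the case of an inadmissible word ix. *)
Definition word_cons i x : tail_word :=
  if pselect (A i (word_head x)) is left h then mk_tail_word (has_tail_cons h) else x.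

Lemma word_consE i x : A i (word_head x) -> val (word_cons i x) = cons_seq i (val x).
Proof. by rewrite /word_cons; case: pselect. Qed.

Lemma word_consP i x : A i (word_head x) -> word_head (word_cons i x) = i /\ word_tail (word_cons i x) = x.
Proof.
move=> h; rewrite /word_head word_consE //; split => //.
by apply: tail_word_ext => n /=; rewrite word_consE.
Qed.

Lemma word_tailP y : A (word_head y) (word_head (word_tail y)) /\ word_cons (word_head y) (word_tail y) = y.
Proof.
have h : A (word_head y) (word_head (word_tail y)) by have [+ _] := tail_wordP y; apply.
by split => //; apply: tail_word_ext => n; rewrite word_consE //; case: n.
Qed.

(** The branching system of P(J; c). *)
Definition tail_branching : branching A := Branching word_consP word_tailP.

Lemma val_iter_tail k x n : val (iter k word_tail x) n = val x (k + n)%N.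
Proof. by elim: k n => [|k IH] n //=; rewrite IH addnS. Qed.

Lemma preperiod_ex x : exists a, `[< iter a word_tail x = base_word >].
Proof.
have [_ [a ha]] := tail_wordP x; exists a; apply/asboolP.
by apply: tail_word_ext => n; rewrite val_iter_tail ha.
Qed.

Definition preperiod x : nat := ex_minn (preperiod_ex x).

Lemma preperiodP x : iter (preperiod x) word_tail x = base_word.
Proof. by rewrite /preperiod; case: ex_minnP => m /asboolP. Qed.

Lemma preperiod_min x a : iter a word_tail x = base_word -> (preperiod x <= a)%N.
Proof. by move=> h; rewrite /preperiod; case: ex_minnP => m _; apply; apply/asboolP. Qed.

Lemma iter_tail_base_dvd a : iter a word_tail base_word = base_word -> (p %| a)%N.
Proof.
move=> h; apply: (period_dvd hp) => n; rewrite addnC.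
by rewrite -[LHS]/(val base_word (a + n)%N) -val_iter_tail h.
Qed.

Lemma iter_tail_base k : iter (k * p) word_tail base_word = base_word.
Proof.
have [_ hper _] := hp; apply: tail_word_ext => n; rewrite val_iter_tail addnC.
exact: (period_mul k hper).
Qed.

Lemma preperiod_base : preperiod base_word = 0%N.
Proof. by apply/eqP; rewrite -leqn0; apply: preperiod_min. Qed.

Lemma preperiod_tail y : y != base_word -> preperiod y = (preperiod (word_tail y)).+1.
Proof.
move=> y0; apply/eqP; rewrite eqn_leq; apply/andP; split.
  by apply: preperiod_min; rewrite iterSr preperiodP.
have := preperiodP y; case: (preperiod y) => [|h] e; first by rewrite (e : y = base_word) eqxx in y0.
by rewrite ltnS; apply: preperiod_min; rewrite -iterSr.
Qed.

Lemma preperiod_tail_base : (preperiod (word_tail base_word)).+1 = p.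
Proof.
have [p0 hper _] := hp; apply/eqP; rewrite eqn_leq; apply/andP; split.
  rewrite -ltnS ltnS -[leqRHS](prednK p0) ltnS; apply: preperiod_min.
  by rewrite -iterSr prednK // -[p]mul1n iter_tail_base.
by apply: dvdn_leq => //; apply: iter_tail_base_dvd; rewrite iterSr preperiodP.
Qed.

(** The letters before the base word determine the word. *)
Lemma tail_word_countable : exists c : tail_word -> nat, injective c.
Proof.
exists (fun x => @choice.pickle (seq 'I_N) (mkseq (val x) (preperiod x))) => x y /(pcan_inj choice.pickleK) e.
have hxy : preperiod x = preperiod y by rewrite -(size_mkseq (val x) (preperiod x)) e size_mkseq.
apply: tail_word_ext => n; have [hn|hn] := ltnP n (preperiod x).
  by rewrite -(nth_mkseq (val x 0%N) (val x) hn) e nth_mkseq // -hxy.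
have ex := congr1 (fun z : tail_word => val z (n - preperiod x)%N) (preperiodP x).
have ey := congr1 (fun z : tail_word => val z (n - preperiod y)%N) (preperiodP y).
move: ex ey; rewrite !val_iter_tail !subnKC -?hxy // => -> ->.
by rewrite hxy.
Qed.

(** The integer is a winding number: it distinguishes the visits to the base word,
    so that the tails of a word are pairwise different as winding words. *)
Definition winding_word : choiceType := (tail_word * int)%type.

Definition winding_head (y : winding_word) := word_head y.1.
Definition winding_tail (y : winding_word) : winding_word := (word_tail y.1, y.2 - (y.1 == base_word)%:Z).
Definition winding_cons i (y : winding_word) : winding_word :=
  (word_cons i y.1, y.2 + (word_cons i y.1 == base_word)%:Z).

Lemma winding_consP i (y : winding_word) : A i (winding_head y) -> winding_head (winding_cons i y) = i /\ winding_tail (winding_cons i y) = y.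
Proof.
case: y => x m h; have [e1 e2] := word_consP h.
by split => //; rewrite /winding_tail /= e2 addrK.
Qed.

Lemma winding_tailP (y : winding_word) : A (winding_head y) (winding_head (winding_tail y)) /\ winding_cons (winding_head y) (winding_tail y) = y.
Proof.
case: y => x m; have [h e] := word_tailP x.
by split => //; rewrite /winding_cons /winding_head /winding_tail /= e subrK.
Qed.

(** The branching system of P(K). *)
Definition winding_branching : branching A := Branching winding_consP winding_tailP.

(** A position along the word: each letter removed lowers it by one. *)
Definition winding_deg (y : winding_word) : int := (preperiod y.1)%:Z + p%:Z * y.2.

Lemma winding_deg_tail (y : winding_word) : winding_deg (winding_tail y) = winding_deg y - 1.
Proof.
case: y => x m; rewrite /winding_deg /=; have [->|x0] := eqVneq x base_word.
  rewrite preperiod_base -[X in _ + X%:Z * _ = _]preperiod_tail_base -[X in _ = _ + X%:Z * _ - _]preperiod_tail_base /=.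
  by rewrite intS; ring.
by rewrite (preperiod_tail x0) /= intS; ring.
Qed.

Lemma winding_deg_iter n (y : winding_word) : winding_deg (iter n winding_tail y) = winding_deg y - n%:Z.
Proof.
elim: n => [|n IH]; first by rewrite subr0.
by rewrite iterS winding_deg_tail IH intS; ring.
Qed.

Lemma winding_tail_iter n (y : winding_word) : (iter n winding_tail y).1 = iter n word_tail y.1.
Proof. by elim: n => //= n ->. Qed.

Lemma winding_word_eq (y y' : winding_word) : y.1 = y'.1 -> winding_deg y = winding_deg y' -> y = y'.
Proof.
case: y => x m; case: y' => x' m' /= <-; rewrite /winding_deg /= => /addrI e.
have [p0 _ _] := hp; congr pair; apply: (@mulfI _ p%:Z) => //.
by rewrite eqz_nat -lt0n.
Qed.

(** Remove letters until both words are the base word, removing extra periods from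
    the one with the larger winding number; equal degrees then give equal winding
    words. *)
Lemma winding_word_connect (y y' : winding_word) : exists k n, iter k winding_tail y = iter n winding_tail y'.
Proof.
have [p0 _ _] := hp.
have to0 (z : winding_word) k : (iter (k * p + preperiod z.1) winding_tail z).1 = base_word.
  by rewrite winding_tail_iter iterD preperiodP iter_tail_base.
have key (z z' : winding_word) (k k' : nat) : winding_deg z - (k * p + preperiod z.1)%N%:Z =
    winding_deg z' - (k' * p + preperiod z'.1)%N%:Z ->
    iter (k * p + preperiod z.1) winding_tail z = iter (k' * p + preperiod z'.1) winding_tail z'.
  by move=> e; apply: winding_word_eq; [rewrite !to0|rewrite !winding_deg_iter].
have [h|h] := leP y.2 y'.2.
  exists (0 * p + preperiod y.1)%N, (`|y'.2 - y.2|%N * p + preperiod y'.1)%N; apply: key.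
  rewrite /winding_deg mul0n add0n PoszD PoszM gez0_abs ?subr_ge0 //; ring.
exists (`|y.2 - y'.2|%N * p + preperiod y.1)%N, (0 * p + preperiod y'.1)%N; apply: key.
rewrite /winding_deg mul0n add0n PoszD PoszM gez0_abs ?subr_ge0 ?ltW //; ring.
Qed.

End tail_words.

Section words_in_reps.
Variables (R : realType) (O : cstarAlgType R) (N : nat) (A : 'M[bool]_N)
  (s : 'I_N -> O) (H : hilbertType R) (pi : O -> H -> H).
Hypothesis hpi : is_representation pi.

Fixpoint star_chain (K : nat -> 'I_N) (n : nat) (x : H) : H :=
  if n is m.+1 then pi (star (s (K m))) (star_chain K m x) else x.

Lemma star_chainE K n x : pi (\prod_(k <- rev (mkseq K n)) star (s k)) x = star_chain K n x.
Proof.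
elim: n => [|n IH]; first by rewrite big_nil (rep1 hpi).
by rewrite mkseqS rev_rcons big_cons (repM hpi) IH.
Qed.

End words_in_reps.

Section branching_models.
Variables (R : realType) (O : cstarAlgType R) (N : nat) (A : 'M[bool]_N)
  (s : 'I_N -> O) (T : branching A) (phi : T -> R[i]).
Hypothesis phi1 : forall y, cabs (phi y) = 1.
Variable (pi : O -> l2 R T -> l2 R T).
Hypothesis hpi : is_representation pi.
Hypothesis hs : forall i f, pi (s i) f = wcomp (gen_data phi1 i) f.
Local Notation e := (l2e R).

Lemma rep_gen_star i f : pi (star (s i)) f = wcomp (gen_data_adj phi1 i) f.
Proof.
apply: hdot_injr => g; rewrite -(rep_star hpi) hs; exact/wcomp_adj/gen_mutual_adjoint.
Qed.

Lemma rep_gen_basis (y : T) : pi (s (head_of y)) (e (tail_of y)) = phi y *: e y.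
Proof. by rewrite hs gen_basis; have [-> ->] := tail_ofP y. Qed.

Lemma rep_gen_star_basis (y : T) : pi (star (s (head_of y))) (e y) = Num.conj (phi y) *: e (tail_of y).
Proof.
have e1 : e y = Num.conj (phi y) *: pi (s (head_of y)) (e (tail_of y)).
  by rewrite rep_gen_basis scalerA mulrC (phi_sq phi1) scale1r.
rewrite {1}e1 (rep_scale _ _ _ hpi) hs rep_gen_star; congr (_ *: _).
apply: l2_ext => t; rewrite gen_adj_gen l2eE; case: ifPn => // ht.
case: eqP => // et; move: ht; rewrite et; by have [->] := tail_ofP y.
Qed.

(** A generator leads from the tail of a symbol to the symbol and its adjoint back,
    so one basis vector yields all those of the connected component. *)
Lemma branching_cyclic (y0 : T) :
  (forall y : T, exists k n, iter k (@tail_of _ _ T) y = iter n (@tail_of _ _ T) y0) ->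
  cyclic_vector pi (e y0).
Proof.
move=> hc.
have up (y : T) : (exists a, pi a (e y0) = e (tail_of y)) -> exists a, pi a (e y0) = e y.
  move=> [a ha]; exists (Num.conj (phi y) *: (s (head_of y) * a)).
  rewrite (rep_scalel _ _ _ hpi) (repM hpi) ha rep_gen_basis scalerA mulrC (phi_sq phi1).
  by rewrite scale1r.
have down (y : T) : (exists a, pi a (e y0) = e y) -> exists a, pi a (e y0) = e (tail_of y).
  move=> [a ha]; exists (phi y *: (star (s (head_of y)) * a)).
  rewrite (rep_scalel _ _ _ hpi) (repM hpi) ha rep_gen_star_basis scalerA (phi_sq phi1).
  by rewrite scale1r.
have all (y : T) : exists a, pi a (e y0) = e y.
  have [k [n hk]] := hc y.
  have hn : exists a, pi a (e y0) = e (iter n (@tail_of _ _ T) y0).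
    by elim: n {hk} => [|n IH]; [exists 1; rewrite (rep1 hpi)|apply: down].
  rewrite -hk in hn; elim: k hn {hk} => [//|k IH] hn.
  by apply/IH/up.
apply/seteqP; split => // f _; apply/closure_rnormP => d d0.
have [B hB] := l2_dense f d0; exists (l2trunc f B); last by apply: hB.
rewrite /l2trunc; elim: (enum_fset B) => [|t r [a _ ha]].
  by exists 0 => //; rewrite big_nil (rep_zero _ hpi).
have [b hb] := all t; exists (f t *: b + a) => //.
by rewrite (rep_add _ _ _ hpi) (rep_scalel _ _ _ hpi) hb /= ha big_cons.
Qed.

Lemma l2e_norm (y : T) : `|e y : l2 R T| = 1.
Proof.
rewrite rnormE; have : rnorm (e y) ^+ 2 = 1.
  by rewrite rnorm_sq l2e_orthonormal eqxx.
by move/eqP; rewrite sqrp_eq1 ?rnorm_ge0 // => /eqP ->.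
Qed.

End branching_models.

(** * Models of the two kinds of representations *)

Section models.
Variables (R : realType) (N : nat) (A : 'M[bool]_N) (O : cstarAlgType R)
  (s : 'I_N -> O).
Hypothesis hO : is_cuntz_krieger A s.
Variables (w0 : nat -> 'I_N) (p : nat).
Hypothesis hp : minimal_period w0 p.
Hypothesis hA : admissible_word A w0.

(** The model on winding words with trivial phases. Successive tails of K have
    different degrees, hence orthogonal basis vectors. *)
Lemma chain_model (K : nat -> 'I_N) a : admissible_word A K ->
  (forall n, K (a + n)%N = w0 n) ->
  exists (H : hilbertType R) (pi : O -> H -> H), is_P_chain s K pi.
Proof.
move=> hK ha; pose T := winding_branching hp hA; pose phi (y : T) : R[i] := 1.
have phi1 (y : T) : cabs (phi y) = 1 by exact: cabs1.
have tK : has_tail A w0 K by split => //; exists a.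
pose y0 : T := (mk_tail_word tK, 0 : int).
have v0 : l2e R y0 <> 0.
  move/(congr1 (@l2f R T)) => /(congr1 (fun f => f y0)) /=; rewrite eqxx => /eqP.
  by rewrite oner_eq0.
pose X := @subspace_ctx R (l2 R T) setT (l2e R y0) v0 (fun _ _ _ _ _ => I) (fun _ _ => I).
have [pi [hpi hs _ _]] := @ck_rep_family _ _ _ _ _ hO X
  (fun i _ => wcomp (gen_data phi1 i)) (fun i _ => wcomp (gen_data_adj phi1 i))
  (fun i _ f g => wcomp_adj f g (gen_mutual_adjoint phi1 i)) (fun _ _ _ _ => I) (fun _ _ _ _ => I)
  (fun i _ => gen_partial_isometry phi1 i) (fun i _ => gen_relation phi1 i) (fun _ => gen_complete phi1).
have {}hpi := hpi tt; have {}hs i f : pi tt (s i) f = wcomp (gen_data phi1 i) f := hs i tt f.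
exists (l2 R T), (pi tt); split => //; exists (l2e R y0); split.
- apply: (branching_cyclic hpi hs) => y; exact: winding_word_connect.
- exact: l2e_norm.
have word n : winding_head (iter n (@winding_tail _ _ _ _ hp hA) y0) = K n.
  by rewrite /winding_head winding_tail_iter /word_head val_iter_tail /= addn0.
have chn n : star_chain s (pi tt) K n (l2e R y0) = l2e R (iter n (@winding_tail _ _ _ _ hp hA) y0 : T).
  elim: n => [//|n IH] /=; rewrite IH -(word n) (rep_gen_star_basis hpi hs).
  by rewrite /phi conjC1 scale1r.
move=> m n; rewrite !(star_chainE s hpi) !chn l2e_orthonormal; congr (_%:R).
have [->|mn] := eqVneq m n; first by rewrite eqxx.
case: eqP => // e; have := @winding_deg_iter _ _ _ _ hp hA m.+1 y0; rewrite e winding_deg_iter => /addrI /oppr_inj [].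
by move=> nm; rewrite nm eqxx in mn.
Qed.

(** Prepending the p letters of J to the base word passes through p distinct words
    and returns to the base word, where the only nontrivial phase c is picked up. *)
Lemma cycle_model (J : seq 'I_N) (c : R[i]) (phi : tail_branching A hp -> R[i])
    (phi1 : forall y, cabs (phi y) = 1)
    (pi : O -> l2 R (tail_branching A hp) -> l2 R (tail_branching A hp)) :
  J = mkseq w0 p ->
  (forall x, phi x = if x == base_word hA then c else 1) ->
  is_representation pi -> (forall i f, pi (s i) f = wcomp (gen_data phi1 i) f) ->
  is_P_cycle s J c pi.
Proof.
move=> -> hphi hpi hs; split => //.
have [p0 hper hmin] := hp.
pose x0 : tail_branching A hp := base_word hA.
pose it l : tail_branching A hp := iter l (@word_tail _ _ _ _ hp) x0.
have itN l : (0 < l < p)%N -> it l != x0.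
  move=> /andP[l0 lp]; apply/eqP => /iter_tail_base_dvd /(dvdn_leq l0).
  by rewrite leqNgt lp.
have itp : it p = x0 by have := iter_tail_base hp hA 1; rewrite mul1n.
have c1 : cabs c = 1 by rewrite -(phi1 x0) hphi eqxx.
have drp l : (l < p)%N -> drop l (mkseq w0 p) = w0 l :: drop l.+1 (mkseq w0 p).
  by move=> lp; rewrite (drop_nth (w0 0%N)) ?size_mkseq // nth_mkseq.
have step l : pi (s (w0 l)) (l2e R (it l.+1)) = phi (it l) *: l2e R (it l).
  have := rep_gen_basis hs (it l); rewrite /head_of /tail_of /=; rewrite /word_head val_iter_tail addn0.
  by [].
have word k l : (0 < l)%N -> (l + k)%N = p ->
    pi (\prod_(j <- drop l (mkseq w0 p)) s j) (l2e R x0) = l2e R (it l).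
  elim: k l => [|k IH] l l0 lk.
    rewrite addn0 in lk; rewrite lk drop_oversize ?size_mkseq // big_nil (rep1 hpi).
    by rewrite itp.
  have lp : (l < p)%N by lia.
  rewrite (drp _ lp) big_cons (repM hpi) IH; [|by []|by lia].
  by rewrite step hphi (negPf (itN l _)) ?scale1r // l0.
pose ph l : R[i] := if l == 0%N then c else 1.
have wordl l : (l < p)%N ->
    pi (\prod_(j <- drop l (mkseq w0 p)) s j) (l2e R x0) = ph l *: l2e R (it l).
  case: l => [|l] lp; last first.
    by rewrite scale1r (word (p - l.+1)%N) //; lia.
  rewrite (drp _ lp) big_cons (repM hpi) (word p.-1) //; last by lia.
  by rewrite step hphi eqxx.
exists (l2e R x0); split.
- apply: (branching_cyclic hpi hs) => y; exists (preperiod hp hA y), 0%N; exact: preperiodP.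
- exact: l2e_norm.
- have := wordl 0%N p0; rewrite drop0 => ->; by rewrite /ph eqxx.
move=> l m; have lp : (l < p)%N by rewrite -[ltnRHS](size_mkseq w0 p) ltn_ord.
have mp : (m < p)%N by rewrite -[ltnRHS](size_mkseq w0 p) ltn_ord.
rewrite !wordl // hdotZl hdotZr l2e_orthonormal.
have ph1 k : ph k * Num.conj (ph k) = 1.
  by rewrite mul_conj /ph; case: eqP => _; rewrite ?c1 ?cabs1 expr1n.
have [->|lm] := eqVneq l m; first by rewrite eqxx mulr1 ph1.
suff /negPf -> : it l != it m by rewrite !mulr0.
have inj (u v : nat) : (u < v)%N -> (v < p)%N -> it u != it v.
  move=> uv vp; apply/eqP => e.
  have h : it ((p - v) + u)%N = x0.
    by rewrite /it iterD -/(it u) e -iterD subnK ?itp // ltnW.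
  have : (0 < (p - v) + u < p)%N by lia.
  by move=> /itN; rewrite h eqxx.
case: (ltngtP l m) => [h|h|h]; first exact: inj.
  by rewrite eq_sym; apply: inj.
by move: lm; rewrite (ord_inj h) eqxx.
Qed.

End models.

(** * Stripping the letters of a foreign word *)

Section dct.
Variables (R : realType) (d : measure_display) (X : measurableType d)
  (mu : {measure set X -> \bar R}).

Definition intR (f : X -> R) : \bar R := (\int[mu]_x (f x)%:E)%E.

Lemma intR_ge0 (f : X -> R) : (forall x, 0 <= f x) -> (0 <= intR f)%E.
Proof. by move=> h; apply: integral_ge0 => x _; rewrite lee_fin. Qed.

Lemma intR_le (f g : X -> R) : (forall x, 0 <= f x <= g x) ->
  measurable_fun setT f -> measurable_fun setT g -> (intR f <= intR g)%E.
Proof.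
move=> h mf mg; apply: ge0_le_integral => //.
- by move=> x _; rewrite lee_fin; have /andP[] := h x.
- exact/measurable_EFinP.
- exact/measurable_EFinP.
- by move=> x _; rewrite lee_fin; have /andP[] := h x.
Qed.

Lemma intRD (f g : X -> R) : (forall x, 0 <= f x) -> (forall x, 0 <= g x) ->
  measurable_fun setT f -> measurable_fun setT g ->
  (intR (fun x => f x + g x)%R = intR f + intR g)%E.
Proof.
move=> f0 g0 mf mg; rewrite /intR; under eq_integral do rewrite EFinD.
by apply: ge0_integralD => //; try exact/measurable_EFinP;
  move=> x _; rewrite lee_fin.
Qed.

Lemma intRZ (k : R) (f : X -> R) : 0 <= k -> (forall x, 0 <= f x) ->
  measurable_fun setT f -> (intR (fun x => k * f x)%R = k%:E * intR f)%E.
Proof.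
move=> k0 f0 mf; rewrite /intR; under eq_integral do rewrite EFinM.
by apply: ge0_integralZl_EFin => //; try exact/measurable_EFinP;
  move=> x _; rewrite lee_fin.
Qed.

(** Dominated convergence for real integrands tending to 0. *)
Lemma dominated_vanish (f : nat -> X -> R) (g : X -> R) :
  (forall n, measurable_fun setT (f n)) -> measurable_fun setT g ->
  (forall n x, 0 <= f n x <= g x) -> (intR g < +oo)%E ->
  (forall x (e : R), 0 < e -> exists n0, forall n, (n0 <= n)%N -> f n x <= e) ->
  forall e : R, 0 < e -> exists n0, forall n, (n0 <= n)%N -> (intR (f n) <= e%:E)%E.
Proof.
move=> mf mg hfg ig hlim e e0.
have g0 x : 0 <= g x by have /andP[h1 h2] := hfg 0%N x; apply: le_trans h2.
have gint : mu.-integrable setT (EFin \o g).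
  apply/integrableP; split; first exact/measurable_EFinP.
  apply: le_lt_trans ig; rewrite /intR le_eqVlt; apply/orP; left; apply/eqP.
  by apply: eq_integral => x _ /=; rewrite ger0_norm.
have h : (fun n => intR (f n)) @ \oo --> (\int[mu]_(x in setT) cst 0%E x)%E.
  apply: (@dominated_cvg _ X R mu setT measurableT (fun n => EFin \o f n) (cst 0%E) (EFin \o g)) => //.
  - by move=> n; apply/measurable_EFinP.
  - move=> x _ /=; apply: cvg_EFin; first by apply: nearW.
    apply/cvgrPdist_le => d0 d1; have [n0 hn] := hlim x _ d1.
    exists n0 => // n /= /hn; rewrite sub0r normrN ger0_norm //.
    by have /andP[] := hfg n x.
  - by move=> n x _ /=; have /andP[h1 h2] := hfg n x; rewrite lee_fin ger0_norm.
rewrite integral0 in h.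
have /fine_cvgP[[n0 _ h1] /cvgrPdist_le/(_ _ e0)[n1 _ h2]] := h.
exists (maxn n0 n1) => n; rewrite geq_max => /andP[n0n n1n].
have p0 : 0 <= fine (intR (f n)).
  by apply: fine_ge0; apply: intR_ge0 => x; have /andP[] := hfg n x.
by have := h2 n n1n; rewrite /= sub0r normrN ger0_norm // -(fineK (h1 n n0n)) lee_fin.
Qed.

End dct.

Section tail_vanish.
Variables (R : realType) (N : nat) (A : 'M[bool]_N) (O : cstarAlgType R)
  (s : 'I_N -> O).
Hypothesis hO : is_cuntz_krieger A s.
Variables (H : hilbertType R) (pi : O -> H -> H).
Hypothesis hpi : is_representation pi.
Local Notation S i x := (pi (s i) x).
Local Notation S' i x := (pi (star (s i)) x).

(** The ranges of the generators are orthogonal and exhaust the space. *)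
Lemma norm_star_sum x : \sum_(i < N) rnorm (S' i x) ^+ 2 = rnorm x ^+ 2.
Proof.
have [_ _ h3] := rep_ck hO hpi.
rewrite [RHS]rnorm_sq -[in RHS](h3 x) hdot_suml.
rewrite (_ : complex.Re (\sum_(i < N) hdot (S i (S' i x)) (\sum_(i < N) S i (S' i x))) =
  \sum_(i < N) complex.Re (hdot (S i (S' i x)) x)); last first.
  by rewrite h3 cRe_sum.
by apply: eq_bigr => i _; rewrite rnorm_sq [in RHS](rep_star hpi).
Qed.

Lemma norm_star_le i x : rnorm (S' i x) <= rnorm x.
Proof.
rewrite -(@ler_pXn2r _ 2) ?nnegrE ?rnorm_ge0 // -(norm_star_sum x) (bigD1 i) //=.
by rewrite lerDl sumr_ge0 // => j _; rewrite sqr_ge0.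
Qed.

(** The component of s_j x along the range of s_j already has the full norm. *)
Lemma star_s_neq i j x : i != j -> S' i (S j x) = 0.
Proof.
move=> ij; have [h1 _ _] := rep_ck hO hpi.
have := norm_star_sum (S j x); rewrite (bigD1 j) //=.
have -> : rnorm (S' j (S j x)) ^+ 2 = rnorm (S j x) ^+ 2.
  by rewrite rnorm_sq -(rep_star hpi) h1 -rnorm_sq.
rewrite -[RHS]addr0 => /addrI /eqP; rewrite psumr_eq0 => [/allP h|k _]; last exact: sqr_ge0.
have := h i; rewrite mem_index_enum ij => /(_ isT); rewrite sqrf_eq0 rnorm_eq0.
by move/eqP.
Qed.

Lemma star_s_star i x : S' i (S i (S' i x)) = S' i x.
Proof.
have [h1 _ _] := rep_ck hO hpi; apply: hdot_injr => y.
rewrite -(rep_star hpi) -(rep_star_left (s i) _ _ hpi) -(rep_star hpi) h1.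
exact: rep_star.
Qed.

Lemma star_s_s i j x : S' i (S i (S j x)) = (A i j)%:R *: S j x.
Proof.
have [h1 h2 _] := rep_ck hO hpi; rewrite h2 (bigD1 j) //= h1.
rewrite big1 ?addr0 // => k kj.
by rewrite (star_s_neq _ kj) (rep_0 _ hpi) scaler0.
Qed.

Lemma star_star_s i j x : S' j (S' i (S i x)) = (A i j)%:R *: S' j x.
Proof.
have e1 : x = \sum_(k < N) S k (S' k x) by have [_ _ ->] := rep_ck hO hpi.
have [h1 h2 _] := rep_ck hO hpi; rewrite h2 (bigD1 j) //=.
rewrite (rep_D _ _ _ hpi) (rep_scale _ _ _ hpi) star_s_star.
suff -> : pi (star (s j)) (\sum_(i0 < N | i0 != j) (A i i0)%:R *: S i0 (S' i0 x)) = 0.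
  by rewrite addr0.
elim/big_rec: _ => [|k u kj hu]; first exact: rep_0.
by rewrite (rep_D _ _ _ hpi) hu (rep_scale _ _ _ hpi) star_s_neq ?scaler0 ?addr0 // eq_sym.
Qed.

Lemma star_chain0 w n : star_chain s pi w n 0 = 0.
Proof. by elim: n => //= n ->; rewrite (rep_0 _ hpi). Qed.

Lemma star_chain_lin w n (a : R[i]) x y :
  star_chain s pi w n (a *: x + y) = a *: star_chain s pi w n x + star_chain s pi w n y.
Proof. by elim: n => //= n ->; rewrite (rep_lin _ hpi). Qed.

Lemma star_chainZ w n (a : R[i]) x : star_chain s pi w n (a *: x) = a *: star_chain s pi w n x.
Proof. by have := star_chain_lin w n a x 0; rewrite star_chain0 !addr0. Qed.

Lemma star_chain_norm w n x : rnorm (star_chain s pi w n x) <= rnorm x.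
Proof. by elim: n => //= n IH; apply: le_trans (norm_star_le _ _) _. Qed.

Lemma star_chain_norm_le w m n x : (m <= n)%N ->
  rnorm (star_chain s pi w n x) <= rnorm (star_chain s pi w m x).
Proof.
move=> /subnKC <-; elim: (n - m)%N => [|k IH]; first by rewrite addn0.
by rewrite addnS /=; apply: le_trans (norm_star_le _ _) _.
Qed.

Lemma star_chain_shift w n x :
  star_chain s pi w n.+1 x = star_chain s pi (fun k => w k.+1) n (S' (w 0%N) x).
Proof. by elim: n => [//|n IH]; rewrite /= -IH. Qed.

Fixpoint word_prod (w : nat -> 'I_N) n x :=
  if n is m.+1 then S (w 0%N) (word_prod (fun k => w k.+1) m x) else x.

Lemma word_prodZ w n (a : R[i]) x : word_prod w n (a *: x) = a *: word_prod w n x.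
Proof. by elim: n w => //= n IH w; rewrite IH (rep_scale _ _ _ hpi). Qed.

Lemma chain_word_prod_neq m w w' y : w m != w' m -> star_chain s pi w m.+1 (word_prod w' m.+1 y) = 0.
Proof.
elim: m w w' => [|m IH] w w' hm; first by rewrite /= star_s_neq.
rewrite star_chain_shift [word_prod _ _ _]/=.
have [e|e] := eqVneq (w 0%N) (w' 0%N); last by rewrite star_s_neq // star_chain0.
rewrite e star_s_s star_chainZ.
have := IH (fun k => w k.+1) (fun k => w' k.+1) hm => ->.
by rewrite scaler0.
Qed.

Definition vanishes w x := forall e : R, 0 < e -> exists n, rnorm (star_chain s pi w n x) < e.

(** The vectors killed asymptotically along all words of W form a closed subspace,
    since stripping does not increase norms. It is invariant under the generators
    and their adjoints because W is stable under removing and prepending letters. *)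
Lemma vanishes_cyclic (W : (nat -> 'I_N) -> Prop) Om :
  cyclic_vector pi Om ->
  (forall w, W w -> W (fun k => w k.+1)) ->
  (forall i w, W w -> W (fun k => if k is m.+1 then w m else i)) ->
  (forall w, W w -> vanishes w Om) ->
  forall w x, W w -> vanishes w x.
Proof.
move=> hcyc Wsh Wc h0.
pose M := [set x | forall w, W w -> vanishes w x].
have Mcl x : (forall e : R, 0 < e -> exists2 y, M y & rnorm (y - x) < e) -> M x.
  move=> hx w hw e e0; have e2 : 0 < e / 2 by rewrite divr_gt0.
  have [y My hy] := hx _ e2; have [n hn] := My w hw _ e2; exists n.
  have -> : x = (-1 : R[i]) *: (y - x) + y by rewrite scaleN1r opprB subrK.
  rewrite star_chain_lin scaleN1r; apply: le_lt_trans (rnormD _ _) _; rewrite rnormN.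
  have := star_chain_norm w n (y - x); lra.
have Mlin (a : R[i]) x y : M x -> M y -> M (a *: x + y).
  move=> hx hy w hw e e0; have p : 0 < cabs a + 1 by rewrite ltr_wpDl ?cabs_ge0.
  have e2 : 0 < e / 2 by rewrite divr_gt0.
  have [n hn] := hx w hw _ (divr_gt0 e2 p); have [m hm] := hy w hw _ e2.
  exists (maxn n m); rewrite star_chain_lin; apply: le_lt_trans (rnormD _ _) _.
  rewrite rnormZ.
  have h1 := star_chain_norm_le w x (leq_maxl n m).
  have h2 := star_chain_norm_le w y (leq_maxr n m).
  have h3 : cabs a * rnorm (star_chain s pi w (maxn n m) x) <= e / 2.
    apply: le_trans (_ : _ <= (cabs a + 1) * (e / 2 / (cabs a + 1))) _.
      apply: ler_pM; rewrite ?cabs_ge0 ?rnorm_ge0 ?lerDl //.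
      by apply: le_trans h1 (ltW hn).
    by rewrite mulrC divfK // gt_eqF.
  by move: h2 hm h3; lra.
have Ms i x : M x -> M (S i x).
  move=> hx w hw e e0.
  have [e1|e1] := eqVneq (w 0%N) i; last first.
    by exists 1%N; rewrite /= star_s_neq // rnorm0.
  have [n hn] := hx _ (Wsh _ hw) _ e0.
  exists n.+2; rewrite !star_chain_shift e1 star_star_s star_chainZ rnormZ.
  have := star_chain_norm_le (fun k => w k.+1) x (leqnSn n).
  rewrite star_chain_shift; case: (A i _); rewrite ?cabs1 ?cabs0 ?mul1r ?mul0r //.
  by move=> h; apply: le_lt_trans hn.
have Ms' i x : M x -> M (S' i x).
  move=> hx w hw e e0; have [n hn] := hx _ (Wc i _ hw) _ e0; exists n.
  apply: le_lt_trans hn.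
  by have := star_chain_norm_le (fun k => if k is m.+1 then w m else i) x (leqnSn n); rewrite star_chain_shift.
have MO : M Om by [].
move=> w x hw; suff : M x by apply.
apply: (Mcl x) => e e0.
have : closure (range (fun a => pi a Om)) x by rewrite hcyc.
move/closure_rnormP => /(_ e e0) [_ [a _ <-] ha].
exists (pi a Om); last by rewrite rnormB.
exact: (rep_invariant hO hpi Mlin Mcl Ms Ms').
Qed.

(** Up to a phase, the cyclic vector of P(J; c) is the image of a vector under any
    number of letters of J J ...; stripping a word that differs from this sequence
    at some position kills it. The condition on w is stable under changes of finitely
    many letters, so the conclusion spreads to all vectors. *)
Lemma cycle_vanishes d J c w : is_P_cycle s J c pi -> J <> [::] ->
  `|c| = 1 ->
  (forall a b, exists n, w (a + n)%N != repeat_word d J (b + n)%N) ->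
  forall x, vanishes w x.
Proof.
move=> [_ [Om [hcyc _ hJ _]]] J0 c1 hw x.
pose W (v : nat -> 'I_N) := forall a b, exists n, v (a + n)%N != repeat_word d J (b + n)%N.
have p0 : (0 < size J)%N by case: (J) J0.
have c0 : c != 0 by rewrite -normr_eq0 c1 oner_eq0.
apply: (vanishes_cyclic (W := W) hcyc) => //.
- by move=> v hv a b; have [n hn] := hv a.+1 b; exists n; rewrite -addSn.
- move=> i v hv a b; have [n hn] := hv a b.+1; exists n.+1.
  by rewrite addnS addnS -addSn.
move=> v hv e e0; have [m hm] := hv 0%N 0%N; exists m.+1.
(* at the end of J the cyclic vector is recreated with the phase inverted *)
have form n : forall l, (l < size J)%N -> exists y,
    pi (\prod_(j <- drop l J) s j) Om = word_prod (fun k => repeat_word d J (l + k)%N) n y.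
  elim: n => [|n IH] l lJ; first by exists (pi (\prod_(j <- drop l J) s j) Om).
  have e1 : (fun k => repeat_word d J (l + k.+1)%N) = (fun k => repeat_word d J (l.+1 + k)%N).
    by apply/funext => k; rewrite addnS.
  rewrite (drop_nth d) // big_cons (repM hpi) /=.
  have -> : nth d J l = repeat_word d J (l + 0)%N by rewrite addn0 /repeat_word modn_small.
  rewrite e1; have [lt|ge] := ltnP l.+1 (size J).
    by have [y ->] := IH _ lt; exists y.
  have ll : l.+1 = size J by apply/eqP; rewrite eqn_leq lJ ge.
  have [y hy] := IH _ p0; exists (c^-1 *: y).
  rewrite drop_oversize // big_nil (rep1 hpi); congr (pi _ _).
  have -> : Om = c^-1 *: pi (\prod_(j <- J) s j) Om.
    by rewrite hJ scalerA mulVf // scale1r.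
  rewrite -{1}(drop0 J) hy word_prodZ; congr (_ *: word_prod _ _ _).
  by apply/funext => k; rewrite ll add0n addnC repeat_word_period.
have [y hy] := form m.+1 0%N p0.
have -> : Om = c^-1 *: pi (\prod_(j <- drop 0 J) s j) Om.
  by rewrite drop0 hJ scalerA mulVf // scale1r.
rewrite hy star_chainZ chain_word_prod_neq ?scaler0 ?rnorm0 //.
Qed.

End tail_vanish.

(** * The tail of the word is determined by a decomposition *)

(** Otherwise the operators that strip letters of K tend to 0 strongly in each fiber,
    and on the direct integral by dominated convergence, whereas the cyclic vector of
    P(K) is mapped to unit vectors. *)
Lemma decomposition_tail (R : realType) (N : nat) (A : 'M[bool]_N)
    (O : cstarAlgType R) (s : 'I_N -> O) (hO : is_cuntz_krieger A s)
    (eta : probability (circle R) R) (K : nat -> 'I_N) (d : 'I_N) (J : seq 'I_N)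
    (H : hilbertType R) (pi : O -> H -> H)
    (F : hilbert_field R (circle R)) (pi_ : forall c : circle R, O -> F c -> F c)
    (L : hilbertType R) (rho : O -> L -> L) :
  J <> [::] -> is_P_chain s K pi -> is_representation_field pi_ ->
  (forall c : circle R, is_P_cycle s J (val c) (pi_ c)) ->
  is_direct_integral eta pi_ rho -> unitarily_equivalent pi rho ->
  exists a b, forall n, K (a + n)%N = repeat_word d J (b + n)%N.
Proof.
move=> J0 [hpi [Om [_ _ horth]]] [hrep hms] hcyc [hrho [cls [_ hsurj hnorm hint]]]
  [U [Ulin Usurj Uiso Uint]].
apply: contrapT => hno.
have hw a b : exists n, K (a + n)%N != repeat_word d J (b + n)%N.
  apply: contrapT => h; apply: hno; exists a, b => n.
  by apply/eqP; apply: contrapT => /negP hn; apply: h; exists n.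
have [u [mu uL2] hu] := hsurj (U Om).
pose aa n : O := \prod_(k <- rev (mkseq K n.+1)) star (s k).
have aE n c x : pi_ c (aa n) x = star_chain s (pi_ c) K n.+1 x by apply: star_chainE.
have mn n : msection (fun c => pi_ c (aa n) (u c)) by apply: hms.
pose f n c := rnorm (pi_ c (aa n) (u c)) ^+ 2.
pose g c := rnorm (u c) ^+ 2.
have mf n : measurable_fun setT (f n) by apply/measurable_funX/msection_norm/mn.
have mg : measurable_fun setT g by apply/measurable_funX/msection_norm/mu.
have hfg n c : 0 <= f n c <= g c.
  rewrite sqr_ge0 /= ler_pXn2r ?nnegrE ?rnorm_ge0 // aE.
  exact: (star_chain_norm hO (hrep c)).
have L2n n : L2_section eta (fun c => pi_ c (aa n) (u c)).
  split; first exact: mn.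
  apply: le_lt_trans uL2; exact: (@intR_le _ _ _ eta _ _ (hfg n) (mf n) mg).
have one n : intR eta (f n) = 1%:E.
  rewrite /intR -(hnorm _ (L2n n)) -hint; last by split.
  rewrite hu -Uint rnorm_sq Uiso; congr (_%:E).
  by rewrite /aa (horth n n) eqxx.
have hlim c (e : R) : 0 < e -> exists m, forall n, (m <= n)%N -> f n c <= e.
  move=> e0.
  have s0 : 0 < Num.sqrt e by rewrite sqrtr_gt0.
  have [m hm] := cycle_vanishes hO (hrep c) (hcyc c) J0 (eqP (valP c)) hw (u c) s0.
  exists m => n mn'; rewrite /f aE -(sqr_sqrtr (ltW e0)).
  rewrite ler_pXn2r ?nnegrE ?rnorm_ge0 ?sqrtr_ge0 //.
  apply: le_trans (ltW hm); apply: (star_chain_norm_le hO (hrep c)).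
  exact: leq_trans (leqnSn _).
have [n0 h] := @dominated_vanish _ _ _ eta f g mf mg hfg uL2 hlim _ (divr_gt0 ltr01 (ltr0n R 2)).
by have := h n0 (leqnn _); rewrite one lee_fin; lra.
Qed.

(** * Baire functions on the circle *)

Section real_bounds.
Variable R : realType.
Implicit Types (x t : R).

Lemma bernoulli_low t k : 0 <= t <= 1 -> 1 - k%:R * t <= (1 - t) ^+ k.
Proof.
move=> /andP[t0 t1]; elim: k => [|k IH]; first by rewrite mul0r subr0.
rewrite exprS -natr1; have k0 : 0 <= k%:R :> R by [].
apply: le_trans (_ : _ <= (1 - t) * (1 - k%:R * t)) _; first nra.
by rewrite ler_wpM2l // subr_ge0.
Qed.

Lemma bernoulli_up t k : 0 <= t <= 1 -> (1 - t) ^+ k * (1 + k%:R * t) <= 1.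
Proof.
move=> /andP[t0 t1]; elim: k => [|k IH]; first by rewrite mul0r addr0 mulr1.
rewrite exprS -natr1; have k0 : 0 <= k%:R :> R by [].
apply: le_trans IH; rewrite mulrAC mulrC ler_wpM2l ?exprn_ge0 ?subr_ge0 //.
by nra.
Qed.

(** With z the square root of y and t = 1 - z, the Bernoulli inequality bounds z ^ n
    by 1 / (1 + n t), and y ^ n is the square of z ^ n. *)
Lemma mul_expr_small y (e : R) : 0 <= y < 1 -> 0 < e ->
  exists n0 : nat, forall n, (n0 <= n)%N -> n%:R * y ^+ n <= e.
Proof.
move=> /andP[y0 y1] e0; set z := Num.sqrt y.
have z0 : 0 <= z by exact: sqrtr_ge0.
have zz : z ^+ 2 = y by exact: sqr_sqrtr.
have z1 : z < 1 by nra.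
set t := 1 - z; have t0 : 0 < t by rewrite subr_gt0.
have q0 : 0 <= (e * t ^+ 2)^-1 by rewrite invr_ge0 mulr_ge0 ?sqr_ge0 // ltW.
exists (Num.bound (e * t ^+ 2)^-1) => n hn.
have nq : (e * t ^+ 2)^-1 <= n%:R.
  by apply: le_trans (ltW (archi_boundP q0)) _; rewrite ler_nat.
have et : 0 < e * t ^+ 2 by rewrite mulr_gt0 // exprn_gt0.
have n1 : 1 <= n%:R * (e * t ^+ 2) by rewrite -ler_pdivrMr // mul1r.
have t1 : 0 <= t <= 1 by rewrite ltW //= /t gerBl.
have := bernoulli_up n t1; rewrite /t subKr -/t => hz.
rewrite -zz exprAC; set w := z ^+ n in hz *.
have w0 : 0 <= w by exact: exprn_ge0.
have n0 : 0 <= n%:R :> R by [].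
have h1 : w * (n%:R * t) <= 1 by nra.
have h0 : 0 <= w * (n%:R * t) by rewrite !mulr_ge0 // ltW.
have h2 : (w * (n%:R * t)) ^+ 2 <= 1 by rewrite expr_le1.
(* multiplied by n * t ^+ 2, which is at least 1 / e *)
have h3 : n%:R * w ^+ 2 * (n%:R * t ^+ 2) <= 1.
  by apply: le_trans h2; rewrite le_eqVlt; apply/orP; left; apply/eqP; ring.
have ntp : 0 < n%:R * t ^+ 2 by nra.
have h4 : n%:R * w ^+ 2 * (n%:R * t ^+ 2) <= e * (n%:R * t ^+ 2) by nra.
by rewrite ler_pM2r in h4.
Qed.

(** Polynomials tending to 1 for x < 1/2 and to 0 for x >= 1/2: the product of the
    exponent with x ^ n is n (2 x) ^ n. *)
Definition step_pow n x := (1 - x ^+ n) ^+ (n * 2 ^ n).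

Lemma step_pow01 n x : 0 <= x <= 1 -> 0 <= step_pow n x <= 1.
Proof.
move=> /andP[x0 x1]; have h : 0 <= x ^+ n <= 1 by rewrite exprn_ge0 // exprn_ile1.
have /andP[h0 h1] := h.
by rewrite exprn_ge0 ?subr_ge0 //= exprn_ile1 ?subr_ge0 // gerBl.
Qed.

Lemma step_pow_lt x (e : R) : 0 <= x -> x < 2^-1 -> 0 < e ->
  exists n0 : nat, forall n, (n0 <= n)%N -> `|step_pow n x - 1| <= e.
Proof.
move=> x0 x1 e0; have y1 : 0 <= 2 * x < 1 by lra.
have [n0 h] := mul_expr_small y1 e0; exists n0 => n hn.
have x01 : 0 <= x <= 1 by lra.
have /andP[_ s1] := step_pow01 n x01.
have /andP[h0 h1] : 0 <= x ^+ n <= 1 by rewrite exprn_ge0 // exprn_ile1 //; lra.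
rewrite distrC ger0_norm ?subr_ge0 //.
have := @bernoulli_low (x ^+ n) (n * 2 ^ n)%N; rewrite h0 h1 => /(_ isT).
rewrite -/(step_pow n x) => hb; have := h n hn.
rewrite exprMn natrM natrX in hb *; lra.
Qed.

Lemma step_pow_ge x (e : R) : 2^-1 <= x <= 1 -> 0 < e ->
  exists n0 : nat, forall n, (n0 <= n)%N -> `|step_pow n x| <= e.
Proof.
move=> /andP[x0 x1] e0; have e1 : 0 <= e^-1 by rewrite invr_ge0 ltW.
exists (Num.bound e^-1) => n hn.
have x01 : 0 <= x <= 1 by lra.
have /andP[s0 _] := step_pow01 n x01; rewrite ger0_norm //.
have /andP[h0 h1] : 0 <= x ^+ n <= 1 by rewrite exprn_ge0 // ?exprn_ile1 //; lra.
have := @bernoulli_up (x ^+ n) (n * 2 ^ n)%N; rewrite h0 h1 => /(_ isT).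
rewrite -/(step_pow n x) => hb.
have h2 : 1 <= 2 ^+ n * x ^+ n.
  by rewrite -exprMn exprn_ege1 //; lra.
have ne : e^-1 <= n%:R.
  by apply: le_trans (ltW (archi_boundP e1)) _; rewrite ler_nat.
have n0 : 0 <= n%:R :> R by [].
have h3 : n%:R <= (n * 2 ^ n)%N%:R * x ^+ n.
  by rewrite natrM natrX -mulrA ler_peMr.
have h4 : step_pow n x * e^-1 <= 1.
  apply: le_trans hb; rewrite ler_wpM2l //; lra.
by rewrite ler_pdivrMr // mul1r in h4.
Qed.

End real_bounds.

Section circle_functions.
Variable R : realType.
Local Notation C := (circle R).
Implicit Types (f g : C -> R[i]) (c : C).

Lemma circle_abs c : cabs (val c) = 1.
Proof. by rewrite /cabs (eqP (valP c)). Qed.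

Lemma circle_neq0 c : val c != 0.
Proof. by rewrite -normr_eq0 (eqP (valP c)) oner_eq0. Qed.

(** The characters of the circle. *)
Definition chi (m : int) c : R[i] := (val c) ^ m.

Lemma chi0 c : chi 0 c = 1. Proof. exact: expr0z. Qed.

Lemma chiD m m' c : chi (m + m') c = chi m c * chi m' c.
Proof. by rewrite /chi expfzDr ?circle_neq0. Qed.

Lemma chi_abs m c : cabs (chi m c) = 1.
Proof.
apply: complexI; rewrite -cabsE /chi; case: m => n.
  by rewrite -exprnP normrX (eqP (valP c)) expr1n.
by rewrite NegzE -exprnN normrV ?normrX ?(eqP (valP c)) ?expr1n ?invr1 // unitfE expf_eq0 negb_and circle_neq0 orbT.
Qed.

Lemma chi_conj m c : Num.conj (chi m c) = chi (- m) c.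
Proof.
have h : chi m c * chi (- m) c = 1 by rewrite -chiD subrr chi0.
have n0 : chi m c != 0 by rewrite -cabs_eq0 chi_abs oner_eq0.
by apply: (mulfI n0); rewrite h mul_conj chi_abs expr1n.
Qed.

(** The functions obtained from the characters by linear combinations and iterated
    uniformly bounded pointwise limits. A property stable under these operations
    needs to be checked on characters only. *)
Inductive baire : (C -> R[i]) -> Prop :=
| baire_chi m : baire (chi m)
| baire_lin (a : R[i]) f g : baire f -> baire g -> baire (fun c => a * f c + g c)
| baire_lim (f_ : nat -> C -> R[i]) f (M : R) :
    (forall n, baire (f_ n)) -> (forall n c, cabs (f_ n c) <= M) ->
    (forall c (e : R), 0 < e -> exists n0, forall n, (n0 <= n)%N ->
       cabs (f_ n c - f c) <= e) -> baire f.

Lemma lim_bound (u : nat -> R[i]) z (M : R) : (forall n, cabs (u n) <= M) ->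
  (forall e : R, 0 < e -> exists n0, forall n, (n0 <= n)%N -> cabs (u n - z) <= e) ->
  cabs z <= M.
Proof.
move=> hM hz; apply/ler_addgt0Pr => e e0; have [n h] := hz _ e0.
have -> : z = u n - (u n - z) by rewrite opprB addrC subrK.
apply: le_trans (cabsD _ _) _; rewrite cabsN.
by apply: lerD => //; apply: h.
Qed.

Lemma baire_bound f : baire f -> exists2 M, 0 <= M & forall c, cabs (f c) <= M.
Proof.
elim=> [m|a {}f g _ [M M0 hM] _ [M' M0' hM']|f_ {}f M _ _ hM hf].
- by exists 1 => // c; rewrite chi_abs.
- exists (cabs a * M + M'); first by rewrite addr_ge0 ?mulr_ge0 ?cabs_ge0.
  move=> c; apply: le_trans (cabsD _ _) _; rewrite cabsM.
  by apply: lerD => //; rewrite ler_wpM2l ?cabs_ge0.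
- exists `|M| => // c; apply: le_trans (ler_norm _); apply: lim_bound (hf c).
  by move=> n; apply: hM.
Qed.

Lemma baire_ext f g : baire f -> (forall c, f c = g c) -> baire g.
Proof. by move=> h e; have -> : g = f by apply/funext. Qed.

Lemma baireZ (a : R[i]) f : baire f -> baire (fun c => a * f c).
Proof.
move=> h; have h0 := baire_lin (-1) h h.
apply: baire_ext (baire_lin a h h0) _ => c; by rewrite mulN1r addNr addr0.
Qed.

Lemma baireD f g : baire f -> baire g -> baire (fun c => f c + g c).
Proof. by move=> h h'; apply: baire_ext (baire_lin 1 h h') _ => c; rewrite mul1r. Qed.

Lemma baire_cst (a : R[i]) : baire (fun=> a).
Proof.
by apply: baire_ext (baireZ a (baire_chi 0)) _ => c; rewrite chi0 mulr1.
Qed.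

(** By induction on both factors: characters multiply to characters, and bounded
    limits commute with multiplication by a bounded function. *)
Lemma baireM f g : baire f -> baire g -> baire (fun c => f c * g c).
Proof.
move=> hf hg.
have [N N0 hN] := baire_bound hg.
have limM (h : C -> R[i]) (u_ : nat -> C -> R[i]) u (B M : R) : 0 <= B ->
    (forall c, cabs (h c) <= B) -> (forall n c, cabs (u_ n c) <= M) ->
    (forall c (e : R), 0 < e -> exists n0, forall n, (n0 <= n)%N ->
       cabs (u_ n c - u c) <= e) -> (forall n, baire (fun c => u_ n c * h c)) ->
    baire (fun c => u c * h c).
  move=> B0 hB hM hu hb; apply: (baire_lim (M := `|M| * B) hb).
    move=> n c; rewrite cabsM ler_pM ?cabs_ge0 //.
    by apply: le_trans (ler_norm _); apply: hM.
  move=> c e e0; have p : 0 < B + 1 by rewrite ltr_wpDl.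
  have [n0 hn0] := hu c _ (divr_gt0 e0 p); exists n0 => n hn.
  rewrite -mulrBl cabsM.
  apply: le_trans (_ : _ <= e / (B + 1) * (B + 1)) _; last by rewrite divfK // gt_eqF.
  apply: ler_pM; rewrite ?cabs_ge0 //; first exact: hn0.
  by apply: le_trans (hB c) _; rewrite lerDl.
elim: hf => {f} [m|a f f' _ IH _ IH'|f_ f M hb IH hM hu].
- elim: hg {N N0 hN} => {g} [m'|a g g' _ IH _ IH'|g_ g M hb IH hM hu].
  + by apply: baire_ext (baire_chi (m + m')) _ => c; rewrite chiD.
  + apply: baire_ext (baire_lin a IH IH') _ => c; ring.
  + have := limM (chi m) g_ g 1 M ler01 _ hM hu _.
    have e1 c : cabs (chi m c) <= 1 by rewrite chi_abs.
    have e2 n : baire (fun c => g_ n c * chi m c).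
      by apply: baire_ext (IH n) _ => c; rewrite mulrC.
    by move=> /(_ e1 e2) h; apply: baire_ext h _ => c; rewrite mulrC.
- apply: baire_ext (baire_lin a IH IH') _ => c; ring.
- exact: (limM g f_ f N M).
Qed.

Lemma baireX f n : baire f -> baire (fun c => f c ^+ n).
Proof.
move=> h; elim: n => [|n IH]; first exact: baire_cst.
by apply: baire_ext (baireM h IH) _ => c; rewrite exprS.
Qed.

Lemma baire_Re : baire (fun c => (complex.Re (val c))%:C).
Proof.
have := baireZ (2^-1) (baireD (baire_chi 1) (baire_chi (-1))).
move=> h; apply: baire_ext h _ => c.
rewrite -chi_conj /chi expr1z.
have -> : val c + Num.conj (val c) = (2 * complex.Re (val c))%:C.
  by apply: complex_ext; rewrite conjE; case: (val c) => a b /=; ring.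
by rewrite rmorphM /= rmorph_nat mulrA mulVf ?mul1r // pnatr_eq0.
Qed.

Lemma baire_Im : baire (fun c => (complex.Im (val c))%:C).
Proof.
have := baireZ ((2 * 'i)^-1) (baire_lin (-1) (baire_chi (-1)) (baire_chi 1)).
move=> h; apply: baire_ext h _ => c.
rewrite -chi_conj /chi expr1z.
have -> : -1 * Num.conj (val c) + val c = (2 * 'i) * (complex.Im (val c))%:C.
  rewrite (_ : (2 : R[i]) = 2%:C); last by rewrite rmorph_nat.
  by apply: complex_ext; rewrite conjE; case: (val c) => a b /=; ring.
rewrite mulrA mulVf ?mul1r // mulf_neq0 ?pnatr_eq0 //.
by apply/eqP => -[] /eqP; rewrite oner_eq0.
Qed.

Definition baire_set (E : set C) := baire (fun c => (\1_E c : R)%:C).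

Lemma baire_setC E : baire_set E -> baire_set (~` E).
Proof.
move=> h; apply: baire_ext (baire_lin (-1) h (baire_cst 1)) _ => c.
rewrite !indicE in_setC; case: (c \in E) => /=.
  by rewrite mulr1 addNr.
by rewrite mulr0 add0r.
Qed.

Lemma baire_setI E E' : baire_set E -> baire_set E' -> baire_set (E `&` E').
Proof.
move=> h h'; apply: baire_ext (baireM h h') _ => c.
by rewrite !indicE in_setI; case: (c \in E); case: (c \in E'); rewrite ?mulr1 ?mulr0 ?mul0r.
Qed.

Lemma baire_setT : baire_set setT.
Proof. by apply: baire_ext (baire_cst 1) _ => c; rewrite indicE in_setT. Qed.

Lemma baire_set0 : baire_set set0.
Proof. by apply: baire_ext (baire_cst 0) _ => c; rewrite indicE in_set0. Qed.

(** The complements of the finite unions decrease to the complement of the union. *)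
Lemma baire_bigcup (E : nat -> set C) : (forall n, baire_set (E n)) ->
  baire_set (\bigcup_n E n).
Proof.
move=> h; rewrite -[X in baire_set X]setCK; apply: baire_setC.
pose F n := ~` \bigcup_(k in [set k | (k < n)%N]) E k.
have hF n : baire_set (F n).
  elim: n => [|n IH].
    rewrite (_ : F 0%N = setT); first exact: baire_setT.
    by apply/seteqP; split => // c _ [].
  rewrite (_ : F n.+1 = F n `&` ~` E n); first exact/baire_setI/baire_setC.
  apply/seteqP; split => c.
    move=> hc; split; last by move=> Ec; apply: hc; exists n => /=.
    by move=> [k /= kn Ek]; apply: hc; exists k => //=; apply: ltnW.
  move=> [h1 h2] [k /=]; rewrite ltnS leq_eqVlt => /orP[/eqP -> //|kn Ek].
  by apply: h1; exists k.
apply: (baire_lim (M := 1) hF).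
  by move=> n c; rewrite indicE; case: (c \in _); rewrite ?cabs0 ?cabs1.
move=> c e e0; have [hc|hc] := pselect ((\bigcup_n E n) c).
  have [k _ Ek] := hc; exists k.+1 => n hn.
  have e1 : (c \in ~` \bigcup_n E n) = false by apply: memNset => h'; exact: (h' hc).
  have e2 : (c \in F n) = false by apply: memNset => h'; apply: h'; exists k.
  by rewrite !indicE e1 e2 subrr cabs0 ltW.
have e1 : (c \in ~` \bigcup_n E n) = true by apply: mem_set.
have e2 n : (c \in F n) = true.
  by apply: mem_set => -[k _ Ek]; apply: hc; exists k.
by exists 0%N => n _; rewrite !indicE e1 e2 subrr cabs0 ltW.
Qed.

(** The indicator is the limit of the step polynomials in an affine image of r. *)
Lemma baire_lt (r : C -> R) (a : R) : baire (fun c => (r c)%:C) ->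
  (forall c, `|r c| <= 1) -> baire_set [set c | r c < a].
Proof.
move=> hr r1; have [a1|a1] := ltP 1 a.
  rewrite (_ : [set c | _] = setT); first exact: baire_setT.
  apply/seteqP; split => // c _ /=; apply: le_lt_trans a1.
  by apply: le_trans (r1 c); apply: ler_norm.
have [a2|a2] := ltP a (-1).
  rewrite (_ : [set c | _] = set0); first exact: baire_set0.
  apply/seteqP; split => // c /= hc; have := r1 c; rewrite ler_norml; lra.
(* the factor 4 keeps x in [0, 1], because r - a lies in [-2, 2] *)
pose x c := 2^-1 + 4^-1 * (r c - a).
have x01 c : 0 <= x c <= 1.
  have := r1 c; rewrite ler_norml /x; lra.
have hx : baire (fun c => (x c)%:C).
  apply: baire_ext (baire_lin (4^-1)%:C hr (baire_cst (2^-1 - 4^-1 * a)%:C)) _ => c.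
  by rewrite -rmorphM -rmorphD; congr (_%:C); rewrite /x; ring.
have hn n : baire (fun c => (step_pow n (x c))%:C).
  have h1 : baire (fun c => (1 - x c ^+ n)%:C).
    apply: baire_ext (baire_lin (-1) (baireX n hx) (baire_cst 1)) _ => c.
    by rewrite mulN1r -rmorphXn rmorphB rmorph1 addrC.
  apply: baire_ext (baireX (n * 2 ^ n) h1) _ => c.
  by rewrite -rmorphXn.
apply: (baire_lim (M := 1) hn).
  move=> n c; rewrite cabs_real.
  by have /andP[s0 s1] := step_pow01 n (x01 c); rewrite ger0_norm.
move=> c e e0; have /andP[x0 x1] := x01 c.
have [hc|hc] := ltP (r c) a.
  have xl : x c < 2^-1 by rewrite /x; lra.
  have [n0 h] := step_pow_lt x0 xl e0; exists n0 => n /h.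
  by rewrite indicE mem_set // -rmorphB cabs_real.
have xl : 2^-1 <= x c <= 1 by rewrite x1 andbT /x; lra.
have [n0 h] := step_pow_ge xl e0; exists n0 => n /h.
rewrite indicE memNset /= ?subr0 ?cabs_real //.
by move=> /= h'; have := lt_le_trans h' hc; rewrite ltxx.
Qed.

Lemma circle_Re_le c : `|complex.Re (val c)| <= 1.
Proof. by rewrite -(circle_abs c) Re_le_cabs. Qed.

Lemma circle_Im_le c : `|complex.Im (val c)| <= 1.
Proof. by rewrite -(circle_abs c) Im_le_cabs. Qed.

Lemma baire_strip (r : C -> R) (a b : R) : baire (fun c => (r c)%:C) ->
  (forall c, `|r c| <= 1) -> baire_set [set c | a < r c < b].
Proof.
move=> hr r1.
have hN : baire (fun c => (- r c)%:C).
  by apply: baire_ext (baireZ (-1) hr) _ => c; rewrite mulN1r rmorphN.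
have rN c : `|- r c| <= 1 by rewrite normrN.
have := baire_setI (baire_lt (- a) hN rN) (baire_lt b hr r1).
congr baire_set; apply/seteqP; split => c /=; rewrite ltrN2.
  by move=> [-> ->].
by move=> /andP[].
Qed.

Lemma cabs_le_sum (z : R[i]) : cabs z <= `|complex.Re z| + `|complex.Im z|.
Proof.
rewrite -(@ler_pXn2r _ 2) ?nnegrE ?addr_ge0 ?cabs_ge0 ?normr_ge0 //.
rewrite cabs_sq -(real_normK (num_real (complex.Re z))).
rewrite -(real_normK (num_real (complex.Im z))).
by have := mulr_ge0 (normr_ge0 (complex.Re z)) (normr_ge0 (complex.Im z)); nra.
Qed.

(** The open square of center q.1 and half side q.2. *)
Definition in_box (q : rat * rat * rat) (z : R[i]) : bool :=
  (ratr q.1.1 - ratr q.2 < complex.Re z < ratr q.1.1 + ratr q.2) &&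
  (ratr q.1.2 - ratr q.2 < complex.Im z < ratr q.1.2 + ratr q.2).

Lemma rat_box (z : R[i]) (d : R) : 0 < d -> exists q : rat * rat * rat,
  in_box q z /\ forall w, in_box q w -> cabs (z - w) < d.
Proof.
move=> d0; have d4 : 0 < d / 4 by rewrite divr_gt0.
have [q3] := rat_in_itvoo d4; rewrite in_itv /= => /andP[q30 q3d].
have hlt (x : R) : x - ratr q3 < x + ratr q3.
  by rewrite ltrD2l (lt_trans _ q30) // oppr_lt0.
have [q1 h1] := rat_in_itvoo (hlt (complex.Re z)).
have [q2 h2] := rat_in_itvoo (hlt (complex.Im z)).
move: h1 h2; rewrite !in_itv /= => /andP[h1 h1'] /andP[h2 h2'].
exists (q1, q2, q3); rewrite /in_box /=; split.
  by apply/andP; split; apply/andP; split; lra.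
move=> w /andP[/andP[k1 k1'] /andP[k2 k2']].
apply: le_lt_trans (cabs_le_sum _) _; rewrite cReD cImD cReN cImN.
have a1 : `|complex.Re z - complex.Re w| < d / 2 by rewrite ltr_norml; lra.
have a2 : `|complex.Im z - complex.Im w| < d / 2 by rewrite ltr_norml; lra.
lra.
Qed.

(** An open set is the union of the countably many rational squares it contains. *)
Lemma baire_open : @circle_open R `<=` baire_set.
Proof.
move=> _ [W oW ->].
pose box q : set C := [set c | in_box q (val c)].
pose V : set C := [set c | W (val c)].
pose E n : set C := if @choice.unpickle (rat * rat * rat)%type n is Some q then
  (if `[< box q `<=` V >] then box q else set0) else set0.
have hb q : baire_set (box q).
  have := baire_setI (baire_strip (ratr q.1.1 - ratr q.2) (ratr q.1.1 + ratr q.2)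
    baire_Re circle_Re_le) (baire_strip (ratr q.1.2 - ratr q.2) (ratr q.1.2 + ratr q.2)
    baire_Im circle_Im_le).
  by congr baire_set; apply/seteqP; split => c /=; rewrite /box /= /in_box => /andP.
have hE n : baire_set (E n).
  rewrite /E; case: (choice.unpickle n) => [q|]; last exact: baire_set0.
  by case: ifP => _; [exact: hb|exact: baire_set0].
have -> : [set c | W (val c)] = \bigcup_n E n.
  apply/seteqP; split => c; last first.
    move=> [n _]; rewrite /E; case: (choice.unpickle n) => [q|//].
    by case: asboolP => // h; apply: h.
  move=> /= Wc.
  have : nbhs (val c : (R[i])^o) W by apply: open_nbhs_nbhs.
  rewrite -nbhs_ballE => -[d /= /pos_real[-> d0] hd].
  have [q [hq hq']] := rat_box (val c) d0.
  have [n hn] : exists n, @choice.unpickle (rat * rat * rat)%type n = Some q.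
    by exists (choice.pickle q); rewrite choice.pickleK.
  exists n; first by []; rewrite /E hn.
  have bV : box q `<=` V.
    by move=> c' hc'; apply: hd; rewrite -ball_normE /ball_ /= cabsE ltcR; apply: hq'.
  by rewrite asboolT.
exact: baire_bigcup.
Qed.

(** The sets with a Baire indicator form a sigma-algebra containing the open sets. *)
Lemma baire_measurable (E : set C) : measurable E -> baire_set E.
Proof.
apply: smallest_sub; last exact: baire_open.
split; [exact: baire_set0| |exact: baire_bigcup].
by move=> A hA; rewrite setTD; apply: baire_setC.
Qed.

End circle_functions.

(** * Measurability and Fourier integrals on the circle *)

Section cmeas.
Variables (R : realType) (d : measure_display) (X : measurableType d).
Implicit Types (f g : X -> R[i]).

Lemma cmeas_ext f g : cmeasurable f -> (forall x, f x = g x) -> cmeasurable g.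
Proof. by move=> h e; have -> : g = f by apply/funext. Qed.

Lemma cmeas_cst (a : R[i]) : cmeasurable (fun _ : X => a).
Proof. by split; exact: measurable_cst. Qed.

Lemma cmeasD f g : cmeasurable f -> cmeasurable g -> cmeasurable (fun x => f x + g x).
Proof.
move=> [h1 h2] [h3 h4]; split.
  by under eq_fun do rewrite cReD; apply: measurable_funD.
by under eq_fun do rewrite cImD; apply: measurable_funD.
Qed.

Lemma cmeasM f g : cmeasurable f -> cmeasurable g -> cmeasurable (fun x => f x * g x).
Proof.
move=> [h1 h2] [h3 h4]; split.
  by under eq_fun do rewrite cReM; apply: measurable_funB; apply: measurable_funM.
by under eq_fun do rewrite cImM; apply: measurable_funD; apply: measurable_funM.
Qed.

Lemma cmeas_conj f : cmeasurable f -> cmeasurable (fun x => Num.conj (f x)).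
Proof.
move=> [h1 h2]; split; first by under eq_fun do rewrite cRe_conj.
under eq_fun do rewrite cIm_conj; exact: measurable_funN.
Qed.

Lemma cmeas_real (r : X -> R) : measurable_fun setT r -> cmeasurable (fun x => (r x)%:C).
Proof. by move=> h; split => //=; exact: measurable_cst. Qed.

Lemma cmeas_sum (I : Type) (r : seq I) (F : I -> X -> R[i]) :
  (forall i, cmeasurable (F i)) -> cmeasurable (fun x => \sum_(i <- r) F i x).
Proof.
move=> h; elim: r => [|i r IH].
  by apply: cmeas_ext (cmeas_cst 0) _ => x; rewrite big_nil.
by apply: cmeas_ext (cmeasD (h i) IH) _ => x; rewrite big_cons.
Qed.

Lemma cmeas_lim (f_ : nat -> X -> R[i]) f : (forall n, cmeasurable (f_ n)) ->
  (forall x (e : R), 0 < e -> exists n0, forall n, (n0 <= n)%N ->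
       cabs (f_ n x - f x) <= e) -> cmeasurable f.
Proof.
move=> hm hl; split.
  apply: (@measurable_fun_cvg _ _ _ _ (fun n x => complex.Re (f_ n x))) => [n|x _].
    by case: (hm n).
  apply/cvgrPdist_le => e e0; have [n0 h] := hl x e e0; exists n0 => // n /= /h.
  by apply: le_trans; rewrite distrC -cReN -cReD Re_le_cabs.
apply: (@measurable_fun_cvg _ _ _ _ (fun n x => complex.Im (f_ n x))) => [n|x _].
  by case: (hm n).
apply/cvgrPdist_le => e e0; have [n0 h] := hl x e e0; exists n0 => // n /= /h.
by apply: le_trans; rewrite distrC -cImN -cImD Im_le_cabs.
Qed.

Lemma cmeas_abs2 f : cmeasurable f -> measurable_fun setT (fun x => cabs (f x) ^+ 2).
Proof.
move=> [h1 h2]; under eq_fun do rewrite cabs_sq.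
by apply: measurable_funD; apply: measurable_funX.
Qed.

End cmeas.

Section circle_measure.
Variable R : realType.
Local Notation C := (circle R).

Lemma circle_open_measurable (W : set (R[i])^o) : open W ->
  measurable ([set c | W (val c)] : set C).
Proof. by move=> oW; apply: sub_sigma_algebra; exists W. Qed.

(** Applied to the real and the imaginary part, which are 1-Lipschitz. *)
Lemma half_plane_open (r : R[i] -> R) (x : R) :
  (forall z w, `|r z - r w| <= cabs (z - w)) ->
  open ([set z | x < r z] : set (R[i])^o).
Proof.
move=> hr; rewrite openE => z /= hz; rewrite /interior -nbhs_ballE.
exists (r z - x)%:C; first by rewrite /= ltcR subr_gt0.
move=> w; rewrite -ball_normE /ball_ /= cabsE ltcR => hw.
have := le_lt_trans (hr z w) hw; rewrite ltr_norml; lra.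
Qed.

Lemma circle_Re_measurable : measurable_fun setT (fun c : C => complex.Re (val c)).
Proof.
apply: (measurability _ (RGenOInfty.measurableE R)) => _ [_ [x ->] <-].
rewrite setTI; have -> : (fun c : C => complex.Re (val c)) @^-1` `]x, +oo[ =
    [set c | x < complex.Re (val c)].
  by apply/seteqP; split => c /=; rewrite in_itv /= andbT.
apply: (@circle_open_measurable [set z | x < complex.Re z]).
by apply: half_plane_open => z w; rewrite -cReN -cReD Re_le_cabs.
Qed.

Lemma circle_Im_measurable : measurable_fun setT (fun c : C => complex.Im (val c)).
Proof.
apply: (measurability _ (RGenOInfty.measurableE R)) => _ [_ [x ->] <-].
rewrite setTI; have -> : (fun c : C => complex.Im (val c)) @^-1` `]x, +oo[ =
    [set c | x < complex.Im (val c)].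
  by apply/seteqP; split => c /=; rewrite in_itv /= andbT.
apply: (@circle_open_measurable [set z | x < complex.Im z]).
by apply: half_plane_open => z w; rewrite -cImN -cImD Im_le_cabs.
Qed.

Lemma cmeas_val : cmeasurable (fun c : C => val c).
Proof. by split; [exact: circle_Re_measurable|exact: circle_Im_measurable]. Qed.

Lemma cmeas_chi m : cmeasurable (@chi R m).
Proof.
have pos n : cmeasurable (fun c : C => chi (Posz n) c).
  elim: n => [|n IH]; first by apply: cmeas_ext (cmeas_cst C 1) _ => c; rewrite chi0.
  apply: cmeas_ext (cmeasM cmeas_val IH) _ => c.
  by rewrite intS chiD /chi expr1z.
case: m => n; first exact: pos.
by apply: cmeas_ext (cmeas_conj (pos n.+1)) _ => c; rewrite chi_conj NegzE.
Qed.

Lemma cmeas_baire (f : C -> R[i]) : baire f -> cmeasurable f.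
Proof.
elim=> [m|a {}f g _ h _ h'|f_ {}f M _ h _ hl]; first exact: cmeas_chi.
- by apply: cmeasD => //; apply: cmeasM => //; exact: cmeas_cst.
- exact: cmeas_lim h hl.
Qed.

Lemma rotation_measurable (d : C) : measurable_fun setT (circle_mul d : C -> C).
Proof.
apply: (@measurability _ _ C C setT (circle_mul d) (@circle_open R) erefl).
move=> _ [_ [W oW ->] <-]; rewrite setTI.
apply: (@circle_open_measurable [set z | W (val d * z)]).
rewrite openE => z /= hz; rewrite /interior -nbhs_ballE.
have : nbhs ((val d * z) : (R[i])^o) W by apply: open_nbhs_nbhs.
rewrite -nbhs_ballE => -[e /= e0 he]; exists e => // w hw; apply: he.
move: hw; rewrite -!ball_normE /ball_ /= -mulrBr normrM (eqP (valP d)) mul1r.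
by [].
Qed.

Variable eta : probability C R.
Hypothesis heta : is_haar eta.

Lemma haar_invariant (d : C) (f : C -> R) :
  measurable_fun setT f -> eta.-integrable setT (EFin \o (f \o circle_mul d)) ->
  (\int[eta]_c (f c)%:E = \int[eta]_c (f (circle_mul d c))%:E)%E.
Proof.
move=> mf fint.
pose rt : C -> C := circle_mul d.
have e1 := @integral_pushforward _ _ C C R rt (rotation_measurable d) eta
  setT (EFin \o f) (iffRL (measurable_EFinP _ _) mf) fint measurableT.
have e2 : (\int[pushforward eta rt]_c (f c)%:E = \int[eta]_c (f c)%:E)%E.
  apply: eq_measure_integral; first exact: (rotation_measurable d).
  by move=> mT E mE _; rewrite -[RHS](heta d mE).
by rewrite -e2 e1.
Qed.

Lemma bounded_int (f : C -> R) (M : R) : measurable_fun setT f ->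
  (forall c, `|f c| <= M) -> eta.-integrable setT (EFin \o f).
Proof.
move=> mf hM; have fin : (eta setT < +oo)%E by rewrite probability_setT ltry.
apply: (measurable_bounded_integrable measurableT fin mf).
exists M; split; first exact: num_real.
by move=> x Mx c _ /=; apply: le_trans (hM c) (ltW Mx).
Qed.

Lemma chi_eqN1 (m : int) : m != 0 -> exists d : C, chi m d = -1.
Proof.
have pos n : (0 < n)%N -> exists d : C, chi n%:Z d = -1.
  move=> n0; have hr : (n.-root (-1) : R[i]) ^+ n = -1 by exact: rootCK.
  have h1 : `|n.-root (-1) : R[i]| == 1.
    by rewrite -(@pexpr_eq1 _ _ n) // -normrX hr normrN1.
  by exists (exist (fun z : R[i] => `|z| == 1) (n.-root (-1)) h1 : C).
case: m => n m0; first by apply: pos; rewrite lt0n.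
have [d hd] := pos n.+1 isT; exists d.
by rewrite NegzE -chi_conj hd rmorphN1.
Qed.

Lemma chi_mul m (c d : C) : chi m (circle_mul c d) = chi m c * chi m d.
Proof. by rewrite /chi /= exprzMl // unitfE circle_neq0. Qed.

(** Real parts suffice, because norms are only ever integrals of real functions. *)
Definition re_chi (b : R[i]) m (c : C) : R := complex.Re (b * chi m c).

Lemma re_chi_measurable b m : measurable_fun setT (re_chi b m).
Proof. by have [] := cmeasM (cmeas_cst C b) (cmeas_chi m). Qed.

Lemma re_chi_bound b m c : `|re_chi b m c| <= cabs b.
Proof. by rewrite (le_trans (Re_le_cabs _)) // cabsM chi_abs mulr1. Qed.

(** A rotation by d with d ^ m = -1 preserves the integral and changes its sign. *)
Lemma re_chi_integral b m : (\int[eta]_c (re_chi b m c)%:E =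
  (complex.Re (b * (m == 0)%:R))%:E)%E.
Proof.
have [->|m0] := eqVneq m 0.
  rewrite mulr1 (eq_integral (cst (complex.Re b)%:E)); last first.
    by move=> c _; rewrite /re_chi chi0 mulr1.
  transitivity ((complex.Re b)%:E * eta setT)%E; first exact: integral_cst.
  by rewrite probability_setT mule1.
rewrite mulr0 /=; have [d hd] := chi_eqN1 m0.
have int1 b' := bounded_int (re_chi_measurable b' m) (re_chi_bound b' m).
have e1 : (fun c => re_chi b m (circle_mul d c)) = re_chi (- b) m.
  by apply/funext => c; rewrite /re_chi chi_mul hd mulN1r mulrN mulNr.
have := @haar_invariant d (re_chi b m) (re_chi_measurable b m).
rewrite -[_ \o circle_mul d]/(fun c => re_chi b m (circle_mul d c)) e1.
move=> /(_ (int1 _)).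
under [in RHS]eq_integral do rewrite -[re_chi b m (circle_mul d _)]/((fun c => re_chi b m (circle_mul d c)) _) e1.
have -> : (\int[eta]_x (re_chi (- b) m x)%:E = - \int[eta]_x (re_chi b m x)%:E)%E.
  rewrite -integralN; last by apply: (integrable_add_def _ (int1 b)).
  by apply: eq_integral => c _; rewrite /re_chi mulNr cReN EFinN.
have fin := integrable_fin_num measurableT (int1 b).
rewrite -(fineK fin) -EFinN => -[h]; congr (_%:E); move: h; lra.
Qed.

Lemma trig_integral (r : seq (R[i] * int)) :
  (\int[eta]_c (\sum_(k <- r) re_chi k.1 k.2 c)%:E =
   (\sum_(k <- r) complex.Re (k.1 * (k.2 == 0)%:R))%:E)%E.
Proof.
have int1 b' m := bounded_int (re_chi_measurable b' m) (re_chi_bound b' m).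
have [M hM] : exists M : R, forall c, `|\sum_(k <- r) re_chi k.1 k.2 c| <= M.
  exists (\sum_(k <- r) cabs k.1) => c; apply: le_trans (ler_norm_sum _ _ _) _.
  by apply: ler_sum => k _; exact: re_chi_bound.
elim: r {M hM} => [|k r IH].
  by rewrite big_nil; under eq_integral do rewrite big_nil; rewrite integral0.
rewrite big_cons; under eq_integral do rewrite big_cons EFinD.
have mr : measurable_fun setT (fun c => \sum_(k <- r) re_chi k.1 k.2 c).
  elim: (r) => [|k' r' IH'].
    by under eq_fun do rewrite big_nil; exact: measurable_cst.
  under eq_fun do rewrite big_cons; apply: measurable_funD => //.
  exact: re_chi_measurable.
have int2 : eta.-integrable setT (EFin \o (fun c => \sum_(k <- r) re_chi k.1 k.2 c)).
  apply: (bounded_int (M := \sum_(k <- r) cabs k.1) mr) => c.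
  apply: le_trans (ler_norm_sum _ _ _) _.
  by apply: ler_sum => k' _; exact: re_chi_bound.
have := @integralD _ _ _ eta setT measurableT _ _ (int1 k.1 k.2) int2.
by rewrite /= => ->; rewrite re_chi_integral IH EFinD.
Qed.

End circle_measure.

(** * The orthonormal basis of a chain representation *)

Section chain_basis.
Variables (R : realType) (N : nat) (A : 'M[bool]_N) (O : cstarAlgType R)
  (s : 'I_N -> O).
Hypothesis hO : is_cuntz_krieger A s.
Variables (w0 : nat -> 'I_N) (p : nat).
Hypothesis hp : minimal_period w0 p.
Hypothesis hA : admissible_word A w0.
Variables (H : hilbertType R) (pi : O -> H -> H).
Hypothesis hpi : is_representation pi.
Local Notation S i x := (pi (s i) x).
Local Notation S' i x := (pi (star (s i)) x).
Local Notation word_prod := (word_prod s pi).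
Local Notation star_chain := (star_chain s pi).

Lemma star_chainD (K : nat -> 'I_N) m n x :
  star_chain K (m + n) x = star_chain (fun k => K (m + k)%N) n (star_chain K m x).
Proof. by elim: n => [|n IH]; rewrite ?addn0 // addnS /= IH. Qed.

Lemma word_prodS w n x : word_prod w n.+1 x = word_prod w n (S (w n) x).
Proof. by elim: n w => [//|n IH] w; exact: (congr1 (pi (s (w 0%N))) (IH _)). Qed.

Lemma word_prodD w m n x : word_prod w (m + n) x =
  word_prod w m (word_prod (fun k => w (m + k)%N) n x).
Proof. by elim: m w => [//|m IH] w; exact: (congr1 (pi (s (w 0%N))) (IH _)). Qed.

Lemma word_prod_adj w n x y : hdot (word_prod w n x) y = hdot x (star_chain w n y).
Proof.
elim: n w y => [//|n IH] w y; rewrite star_chain_shift /= -IH.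
exact: rep_star.
Qed.

Lemma word_prod_eq w w' n x : (forall i, (i < n)%N -> w i = w' i) -> word_prod w n x = word_prod w' n x.
Proof.
elim: n w w' => [//|n IH] w w' h /=; rewrite h //; congr (pi _ _).
by apply: IH => i hi; apply: h.
Qed.

Lemma chain_word_prod w n z : admissible_word A w ->
  star_chain w n (word_prod w n (S (w n) z)) = S (w n) z.
Proof.
elim: n w => [//|n IH] w hw; rewrite star_chain_shift [word_prod _ n.+1 _]/=.
have -> : S' (w 0%N) (S (w 0%N) (word_prod (fun k => w k.+1) n (S (w n.+1) z))) =
    word_prod (fun k => w k.+1) n (S (w n.+1) z).
  by case: n {IH} => [|n] /=; rewrite (star_s_s hO hpi) hw scale1r.
by apply: (IH (fun k => w k.+1)) => k; apply: hw.
Qed.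

(** By the sum formula for the norms, the other components of x vanish. *)
Lemma star_full i x : rnorm (S' i x) = rnorm x -> S i (S' i x) = x.
Proof.
move=> h; have h1 := norm_star_sum hO hpi x; rewrite (bigD1 i) //= h in h1.
move: h1; rewrite -[RHS]addr0 => /addrI /eqP.
rewrite psumr_eq0 => [/allP h1|k _]; last exact: sqr_ge0.
have [_ _ h3] := rep_ck hO hpi; rewrite -[RHS]h3 (bigD1 i) //= big1 ?addr0 // => j ji.
have := h1 j; rewrite mem_index_enum ji => /(_ isT); rewrite sqrf_eq0 rnorm_eq0.
by move=> /eqP ->; rewrite (rep_0 _ hpi).
Qed.

Variables (Om : H) (xK : tail_word A w0).
Local Notation K := (val xK).
Hypothesis hcyc : cyclic_vector pi Om.
Hypothesis Om1 : `|Om| = 1.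
Hypothesis horth : orthonormal_family
  (fun n : nat => pi (\prod_(k <- rev (mkseq K n.+1)) star (s k)) Om).

Definition stripped b := star_chain K b Om.

Lemma stripped_orth b b' : (0 < b)%N -> (0 < b')%N -> hdot (stripped b) (stripped b') = (b == b')%:R.
Proof.
case: b => // b _; case: b' => // b' _.
by have := horth b b'; rewrite !(star_chainE s hpi).
Qed.

Lemma stripped_norm b : rnorm (stripped b) = 1.
Proof.
case: b => [|b]; first by apply: complexI; rewrite -rnormE.
have := stripped_orth (b := b.+1) (b' := b.+1) isT isT.
rewrite hdotxx eqxx => -[] /eqP; by rewrite sqrp_eq1 ?rnorm_ge0 // => /eqP.
Qed.

(** Stripping a letter of K preserves the norm, so the letter can be restored. *)
Lemma stripped_step b : S (K b) (stripped b.+1) = stripped b.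
Proof.
have h : rnorm (S' (K b) (stripped b)) = rnorm (stripped b).
  by rewrite -[S' _ _]/(stripped b.+1) !stripped_norm.
exact: star_full h.
Qed.

Definition grafted x l b := word_prod x l (stripped b).
(** The extra period ensures that at least one letter of K is stripped: orthogonality
    is assumed from there on. *)
Definition start := (preperiod hp hA xK + p)%N.

Lemma preperiodE (x : tail_word A w0) k : val x (preperiod hp hA x + k)%N = w0 k.
Proof.
by have := congr1 (fun z : tail_word A w0 => val z k) (preperiodP hp hA x); rewrite val_iter_tail.
Qed.

Lemma startE k : K (start + k)%N = w0 k.
Proof. by rewrite /start -addnA preperiodE addnC; have [_ hper _] := hp; apply: hper. Qed.

Definition agree (x : nat -> 'I_N) l b := forall i, x (l + i)%N = K (b + i)%N.

Lemma agree_add x l b j : agree x l b -> agree x (l + j) (b + j).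
Proof. by move=> h i; rewrite -!addnA h. Qed.

Lemma grafted_add x l b j : agree x l b -> grafted x (l + j) (b + j) = grafted x l b.
Proof.
elim: j => [|j IH] h; first by rewrite !addn0.
rewrite !addnS -(IH h) /grafted word_prodS; congr word_prod.
have := agree_add j h 0%N; rewrite !addn0 => ->; exact: stripped_step.
Qed.

(** A nonnegative winding number is realized by prepending more periods of x, a
    negative one by stripping more periods of K; the degree of y is then the length
    minus the number of stripped letters, up to a constant. *)
Definition graft_len (y : winding_word A w0) := (preperiod hp hA y.1 + (if y.2 is Posz n then n else 0) * p)%N.
Definition strip_len (y : winding_word A w0) := (start + (if y.2 is Negz n then n.+1 else 0) * p)%N.
Definition chain_vec (y : winding_word A w0) : H := grafted (val y.1) (graft_len y) (strip_len y).

Lemma graft_agree y : agree (val y.1) (graft_len y) (strip_len y).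
Proof.
have [_ hper _] := hp.
by move=> i; rewrite /graft_len /strip_len -addnA (preperiodE y.1) -addnA startE !(addnC (_ * _)%N) !(period_mul _ hper).
Qed.

Lemma graft_deg y : (graft_len y)%:Z - (strip_len y)%:Z = winding_deg hp hA y - start%:Z.
Proof.
case: y => x [n|n]; rewrite /graft_len /strip_len /winding_deg /= ?mul0n ?addn0 !PoszD !PoszM; first ring.
by rewrite NegzE; ring.
Qed.

(** The positions l and b matter through their difference only, because advancing
    both strips one more letter and prepends the same letter again. *)
Lemma chain_vecE y l b : agree (val y.1) l b -> l%:Z - b%:Z = winding_deg hp hA y - start%:Z ->
  chain_vec y = grafted (val y.1) l b.
Proof.
move=> h; rewrite -graft_deg => e; rewrite /chain_vec.
have [hl|hl] := leqP (graft_len y) l.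
  have [el eb] : l = (graft_len y + (l - graft_len y))%N /\ b = (strip_len y + (l - graft_len y))%N by lia.
  by rewrite el eb grafted_add //; apply: graft_agree.
have [el eb] : graft_len y = (l + (graft_len y - l))%N /\ strip_len y = (b + (graft_len y - l))%N by lia.
by rewrite el eb grafted_add.
Qed.

Lemma chain_vec_step y : S (winding_head y) (chain_vec (winding_tail hp hA y)) = chain_vec y.
Proof.
set z := winding_tail hp hA y.
rewrite (@chain_vecE y (graft_len z).+1 (strip_len z)) //; first by move=> i; rewrite addSn; apply: (graft_agree z).
by have := graft_deg z; rewrite winding_deg_tail; lia.
Qed.

Lemma chain_vec_range y : exists z, chain_vec y = S (winding_head y) z.
Proof. by exists (chain_vec (winding_tail hp hA y)); rewrite chain_vec_step. Qed.

Lemma chain_vec_s i x : S i (chain_vec x) =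
  if A i (winding_head x) then chain_vec (winding_cons hA i x) else 0.
Proof.
case: ifPn => h.
  have [e1 e2] := @winding_consP _ _ _ _ hp hA i x h.
  by rewrite -{1}e2 -{1}e1 chain_vec_step.
have [z hz] := chain_vec_range x.
apply: rnorm0_eq0; apply/eqP; rewrite -sqrf_eq0 rnorm_sq (rep_star hpi) hz.
by rewrite (star_s_s hO hpi) (negPf h) scale0r hdot0r.
Qed.

Lemma chain_vec_star i y : S' i (chain_vec y) = if winding_head y == i then chain_vec (winding_tail hp hA y) else 0.
Proof.
rewrite -{1}chain_vec_step; case: eqP => [<-|/eqP h]; last by rewrite (star_s_neq hO hpi) // eq_sym.
have [z ->] := chain_vec_range (winding_tail hp hA y).
by rewrite (star_s_s hO hpi) (winding_tailP hp hA y).1 scale1r.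
Qed.

(** If the prefixes of length l differ, the ranges of two generators are orthogonal.
    If they agree they cancel, and the stripped vectors of K remain. *)
Lemma grafted_orth (x x' : tail_word A w0) l b b' : (0 < b)%N -> (0 < b')%N ->
  agree (val x) l b -> agree (val x') l b' ->
  hdot (grafted (val x) l b) (grafted (val x') l b') = ((x == x') && (b == b'))%:R.
Proof.
move=> b0 b0' h h'.
have [e|ne] := pselect (forall i, (i < l)%N -> val x i = val x' i); last first.
  have [m [ml hm]] : exists m, (m < l)%N /\ val x m != val x' m.
    apply: contrapT => no; apply: ne => i il; apply/eqP; apply: contrapT => /negP hi.
    by apply: no; exists i.
  have -> : (x == x') = false by apply/eqP => e; rewrite e eqxx in hm.
  rewrite /grafted word_prod_adj -(subnKC ml) word_prodD star_chainD.
  by rewrite (chain_word_prod_neq hO hpi) // star_chain0 // hdot0r.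
rewrite /grafted -(word_prod_eq _ e) hdotC word_prod_adj.
rewrite -(stripped_step b); have := h 0%N; rewrite !addn0 => <-.
rewrite chain_word_prod; last by have [] := tail_wordP x.
have -> : val x l = K b by have := h 0%N; rewrite !addn0.
rewrite stripped_step stripped_orth // eq_sym conjC_nat; have [bb|bb] := eqVneq b b'; last by rewrite andbF.
rewrite andbT; suff -> : x = x' by rewrite eqxx.
apply: tail_word_ext => n; have [nl|nl] := ltnP n l; first exact: e.
by rewrite -(subnKC nl) h h' bb.
Qed.

Lemma strip_len_gt0 y : (0 < strip_len y)%N.
Proof. by have [p0 _ _] := hp; rewrite /strip_len /start; lia. Qed.

(** Prolong one of the two words so that both prefixes have the same length. *)
Lemma chain_vec_orth : orthonormal_family chain_vec.
Proof.
move=> y y'.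
have key l b b' : (0 < b)%N -> (0 < b')%N -> agree (val y.1) l b ->
    agree (val y'.1) l b' ->
    l%:Z - b%:Z = winding_deg hp hA y - start%:Z -> l%:Z - b'%:Z = winding_deg hp hA y' - start%:Z ->
    hdot (chain_vec y) (chain_vec y') = (y == y')%:R.
  move=> b0 b0' h h' d d'; rewrite (chain_vecE h d) (chain_vecE h' d') grafted_orth //; congr (_%:R).
  congr nat_of_bool; apply/andP/eqP => [[/eqP exy /eqP bb]|e].
    by apply: (@winding_word_eq _ _ _ _ hp hA) => //; lia.
  by rewrite -e in d' *; split => //; apply/eqP; move: d d'; lia.
have [hl|hl] := leqP (graft_len y) (graft_len y').
  apply: (key (graft_len y') (strip_len y + (graft_len y' - graft_len y))%N (strip_len y')).
  - by rewrite ltn_addr // strip_len_gt0.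
  - exact: strip_len_gt0.
  - by rewrite -{1}(subnKC hl); apply: agree_add; apply: graft_agree.
  - exact: graft_agree.
  - by have := graft_deg y; lia.
  - exact: graft_deg.
apply: (key (graft_len y) (strip_len y) (strip_len y' + (graft_len y - graft_len y'))%N).
- exact: strip_len_gt0.
- by rewrite ltn_addr // strip_len_gt0.
- exact: graft_agree.
- by rewrite -{1}(subnKC (ltnW hl)); apply: agree_add; apply: graft_agree.
- exact: graft_deg.
- by have := graft_deg y'; lia.
Qed.

Lemma chain_vec_Om : chain_vec (xK, 1 : int) = Om.
Proof.
rewrite (@chain_vecE _ start start) //; last by rewrite /winding_deg /start /=; lia.
(* the winding number 1 compensates the extra period in start *)
suff h n : word_prod K n (stripped n) = Om by exact: h.
elim: n => [//|n IH]; by rewrite word_prodS stripped_step.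
Qed.

Definition chain_comb (r : seq (R[i] * winding_word A w0)) : H := \sum_(k <- r) k.1 *: chain_vec k.2.

Lemma chain_comb_cat r r' : chain_comb (r ++ r') = chain_comb r + chain_comb r'.
Proof. exact: big_cat. Qed.

Lemma chain_comb_scale (a : R[i]) r : chain_comb [seq (a * k.1, k.2) | k <- r] = a *: chain_comb r.
Proof.
by rewrite /chain_comb big_map scaler_sumr; apply: eq_bigr => k _; rewrite scalerA.
Qed.

(** The closed span of the vectors contains the cyclic vector and is invariant under
    the generators and their adjoints, hence under O. *)
Lemma chain_vec_dense (h : H) (e : R) : 0 < e -> exists r, rnorm (h - chain_comb r) < e.
Proof.
pose M := [set h | forall e : R, 0 < e -> exists r, rnorm (h - chain_comb r) < e].
suff : M h by apply.
have Mlin (a : R[i]) x y : M x -> M y -> M (a *: x + y).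
  move=> hx hy d d0; have q : 0 < cabs a + 1 by rewrite ltr_wpDl ?cabs_ge0.
  have d2 : 0 < d / 2 by rewrite divr_gt0.
  have [r hr] := hx _ (divr_gt0 d2 q); have [r' hr'] := hy _ d2.
  exists ([seq (a * k.1, k.2) | k <- r] ++ r').
  rewrite chain_comb_cat chain_comb_scale.
  have -> : a *: x + y - (a *: chain_comb r + chain_comb r') =
    a *: (x - chain_comb r) + (y - chain_comb r') by rewrite scalerBr opprD addrACA.
  apply: le_lt_trans (rnormD _ _) _; rewrite rnormZ.
  have h3 : cabs a * rnorm (x - chain_comb r) <= d / 2.
    apply: le_trans (_ : _ <= (cabs a + 1) * (d / 2 / (cabs a + 1))) _.
      by apply: ler_pM; rewrite ?cabs_ge0 ?rnorm_ge0 ?lerDl // ltW.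
    by rewrite mulrC divfK // gt_eqF.
  by move: h3 hr'; lra.
have Mcl x : (forall e : R, 0 < e -> exists2 y, M y & rnorm (y - x) < e) -> M x.
  move=> hx d d0; have d2 : 0 < d / 2 by rewrite divr_gt0.
  have [y My hy] := hx _ d2; have [r hr] := My _ d2; exists r.
  have -> : x - chain_comb r = (y - chain_comb r) - (y - x) by rewrite opprB [RHS]addrC addrA subrK.
  by apply: le_lt_trans (rnormD _ _) _; rewrite rnormN; lra.
have Me y : M (chain_vec y).
  move=> d d0; exists [:: (1, y)]; rewrite /chain_comb big_seq1 scale1r subrr rnorm0.
  by [].
have M0 : M 0 by move=> d d0; exists [::]; rewrite /chain_comb big_nil subrr rnorm0.
have Minv (T : H -> H) (q : R) : (forall (a : R[i]) x y, T (a *: x + y) = a *: T x + T y) ->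
    0 <= q -> (forall x, rnorm (T x) <= q * rnorm x) -> (forall y, M (T (chain_vec y))) ->
    forall x, M x -> M (T x).
  move=> Tlin q0 hq hT x hx; apply: Mcl => d d0.
  have q1 : 0 < q + 1 by rewrite ltr_wpDl.
  have [r hr] := hx _ (divr_gt0 d0 q1); exists (T (chain_comb r)).
    have T0 : T 0 = 0 by have := Tlin (-1) 0 0; rewrite !scaleN1r !addNr.
    elim: r {hr} => [|k r IH]; first by rewrite /chain_comb big_nil T0.
    by rewrite /chain_comb big_cons Tlin; apply: Mlin.
  have -> : T (chain_comb r) - T x = T (chain_comb r - x).
    by have := Tlin (-1) x (chain_comb r); rewrite !scaleN1r ![- _ + _]addrC => ->.
  apply: le_lt_trans (hq _) _; rewrite rnormB; move: hr; rewrite ltr_pdivlMr // => hr.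
  by apply: le_lt_trans hr; rewrite mulrC ler_wpM2l ?rnorm_ge0 // lerDl.
have lin a : forall (z : R[i]) x y, pi a (z *: x + y) = z *: pi a x + pi a y.
  exact: rep_lin.
have Mpi a : (forall y, M (pi a (chain_vec y))) -> forall x, M x -> M (pi a x).
  by have [q q0 hq] := rep_bound a hpi; apply: Minv q0 hq => //; apply: lin.
have MS i x : M x -> M (S i x).
  by apply: Mpi => y; rewrite chain_vec_s; case: ifP.
have MS' i x : M x -> M (S' i x).
  by apply: Mpi => y; rewrite chain_vec_star; case: ifP.
have MO : M Om by rewrite -chain_vec_Om.
apply: (Mcl h) => d d0.
have : closure (range (fun a => pi a Om)) h by rewrite hcyc.
move/closure_rnormP => /(_ d d0) [_ [a _ <-] ha].
exists (pi a Om); last by rewrite rnormB.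
exact: (rep_invariant hO hpi Mlin Mcl MS MS').
Qed.

End chain_basis.

(** * Constant fields of Hilbert spaces *)

Section const_field.
Variables (R : realType) (T : choiceType) (cx : T -> nat).
Hypothesis cinj : injective cx.

Definition enum_of n : option T :=
  if pselect (exists x, cx x = n) is left h then Some (proj1_sig (cid h)) else None.

Lemma enum_ofK x : enum_of (cx x) = Some x.
Proof.
rewrite /enum_of; case: pselect => [h|[]]; last by exists x.
by case: cid => y /= /cinj ->.
Qed.

Lemma enum_ofP n x : enum_of n = Some x -> cx x = n.
Proof. by rewrite /enum_of; case: pselect => // h [<-]; case: cid. Qed.

Definition enum_trunc (f : l2 R T) m : l2 R T :=
  \sum_(0 <= i < m) (if enum_of i is Some x then f x *: l2e R x else 0).

Lemma enum_truncS f m : enum_trunc f m.+1 = enum_trunc f m + (if enum_of m is Some x then f x *: l2e R x else 0).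
Proof. by rewrite /enum_trunc big_nat_recr. Qed.

Lemma enum_truncE f m t : enum_trunc f m t = if (cx t < m)%N then f t else 0.
Proof.
elim: m => [|m IH]; first by rewrite /enum_trunc big_geq.
rewrite enum_truncS l2ED IH [in RHS]ltnS [in RHS]leq_eqVlt; case e : (enum_of m) => [x|].
  have cm := enum_ofP e; rewrite l2EZ l2eE.
  have [->|tx] := eqVneq t x; first by rewrite cm eqxx ltnn /= add0r mulr1.
  rewrite mulr0 addr0; suff /negPf -> : cx t != m by [].
  by rewrite -cm (inj_eq cinj).
rewrite l2E0 addr0; case: eqP => [cm|//].
by move: e; rewrite -cm enum_ofK.
Qed.

Lemma enum_trunc_fset f m : exists B : {fset T}, enum_trunc f m = l2trunc f B /\
  forall t, (t \in B) = (cx t < m)%N.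
Proof.
have [B hB] : exists B : {fset T}, forall t, (t \in B) = (cx t < m)%N.
  exists [fset x in pmap enum_of (iota 0 m)]%fset => t; rewrite !inE /= mem_pmap.
  apply/mapP/idP => [[k]|h].
    by rewrite mem_iota add0n => /andP[_ km] /esym /enum_ofP ->.
  by exists (cx t); rewrite ?enum_ofK // mem_iota.
by exists B; split => //; apply: l2_ext => t; rewrite enum_truncE l2truncE hB.
Qed.

Lemma enum_trunc_dense f (e : R) : 0 < e ->
  exists m0, forall m, (m0 <= m)%N -> rnorm (f - enum_trunc f m) < e.
Proof.
move=> e0; have [B hB] := l2_dense f e0.
exists (\max_(t <- B) (cx t).+1)%N => m hm.
have [B' [-> hB']] := enum_trunc_fset f m; apply: hB; apply/fsubsetP => t tB.
rewrite hB'; apply: leq_trans hm.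
by rewrite (big_fsetD1 t) //= leq_maxl.
Qed.

Lemma enum_trunc_le f m : rnorm (f - enum_trunc f m) <= rnorm f.
Proof.
have [B [-> _]] := enum_trunc_fset f m.
rewrite -(@ler_pXn2r _ 2) ?nnegrE ?rnorm_ge0 // !l2_rnorm.
by apply: le_trans (l2_dist_trunc _ _) _; rewrite gerBl sqsum_ge0.
Qed.

Lemma enum_trunc_norm f m : rnorm (enum_trunc f m) ^+ 2 =
  \sum_(0 <= i < m) (if enum_of i is Some x then cabs (f x) ^+ 2 else 0).
Proof.
elim: m => [|m IH]; first by rewrite /enum_trunc !big_geq // rnorm0 expr0n.
rewrite enum_truncS big_nat_recr //= -IH rnorm_sqD.
case e : (enum_of m) => [x|]; last by rewrite rnorm0 hdot0r expr0n /= mulr0 !addr0.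
rewrite hdotZr l2_dot_e enum_truncE (enum_ofP e) ltnn mulr0 /= mulr0 addr0 rnormZ exprMn.
by rewrite (_ : rnorm (l2e R x) ^+ 2 = 1) ?mulr1 // rnorm_sq l2e_orthonormal eqxx.
Qed.

Variables (d : measure_display) (X : measurableType d).

Definition coord_measurable (u : X -> l2 R T) : Prop := forall t, cmeasurable (fun x => u x t).

Lemma coord_measurable0 : coord_measurable (fun=> 0).
Proof. by move=> t; exact: cmeas_cst. Qed.

Lemma coord_measurable_lin (a : R[i]) u v : coord_measurable u -> coord_measurable v -> coord_measurable (fun x => a *: u x + v x).
Proof.
by move=> hu hv t; apply: cmeasD => //; apply: cmeasM => //; exact: cmeas_cst.
Qed.

(** The norm is the limit of the norms of the truncations. *)
Lemma coord_measurable_norm u : coord_measurable u -> measurable_fun setT (fun x => rnorm (u x)).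
Proof.
move=> hu.
apply: (@measurable_fun_cvg _ _ _ _ (fun m x => rnorm (enum_trunc (u x) m))) => [m|x _].
  have -> : (fun x => rnorm (enum_trunc (u x) m)) = Num.sqrt \o (fun x => rnorm (enum_trunc (u x) m) ^+ 2).
    by apply/funext => x /=; rewrite sqrtr_sqr ger0_norm ?rnorm_ge0.
  apply: measurableT_comp.
    by apply: continuous_measurable_fun; exact: sqrt_continuous.
  under eq_fun do rewrite enum_trunc_norm.
  elim: m => [|m IH]; first by under eq_fun do rewrite big_geq //; exact: measurable_cst.
  under eq_fun do rewrite big_nat_recr //=; apply: measurable_funD => //.
  by case: (enum_of m) => [t|]; [exact: cmeas_abs2|exact: measurable_cst].
apply/cvgrPdist_le => e e0; have [m0 h] := enum_trunc_dense (u x) e0.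
exists m0 => // m /= /h /ltW; apply: le_trans.
rewrite ler_norml; apply/andP; split.
  by rewrite lerNl opprB lerBlDr rnormB -{1}(subrK (u x) (enum_trunc (u x) m)) rnormD.
by rewrite lerBlDr -{1}(subrK (enum_trunc (u x) m) (u x)) rnormD.
Qed.

Lemma coord_measurable_max (v : X -> l2 R T) :
  (forall u, coord_measurable u -> cmeasurable (fun x => hdot (u x) (v x))) -> coord_measurable v.
Proof.
move=> h t; have := h (fun=> l2e R t) _; move=> /(_ _)/cmeas_conj h1.
apply: cmeas_ext (h1 _) _; last by move=> x /=; rewrite -hdotC l2_dot_e.
by move=> t'; exact: cmeas_cst.
Qed.

Lemma coord_measurable_total : exists e : nat -> X -> l2 R T,
  (forall n, coord_measurable (e n)) /\ (forall x, closure (lin_span (fun n => e n x)) = setT).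
Proof.
exists (fun n _ => if enum_of n is Some t then l2e R t else 0); split.
  by move=> n t; exact: cmeas_cst.
move=> x; apply/seteqP; split => // f _; apply/closure_rnormP => e e0.
have [m h] := enum_trunc_dense f e0; exists (enum_trunc f m); last exact: h.
exists m, (fun n => if enum_of n is Some t then f t else 0).
by apply: eq_bigr => i _; case: (enum_of i) => [t|]; rewrite ?scaler0.
Qed.

Definition const_field : hilbert_field R X :=
  @HilbertField R d X (fun=> l2 R T) coord_measurable coord_measurable0 coord_measurable_lin coord_measurable_norm coord_measurable_max coord_measurable_total.

End const_field.

(** * The L2 seminorm of sections *)

Section sqrt_triangle.
Variable R : realType.

(** The bound is optimal at d = b / a, with a and b the two square roots, where it is
    the square of a + b. It yields the triangle inequality for integrals of squares
    from the pointwise one. *)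
Lemma sqrt_triangle_weighted (n t e : R) : 0 <= n -> 0 <= t -> 0 <= e ->
  (forall d, 0 < d -> n <= (1 + d) * t + (1 + d^-1) * e) ->
  Num.sqrt n <= Num.sqrt t + Num.sqrt e.
Proof.
move=> n0 t0 e0 h.
have [st se] := (sqrtr_ge0 t, sqrtr_ge0 e).
rewrite -(@ler_pXn2r _ 2) ?nnegrE ?addr_ge0 ?sqrtr_ge0 // sqr_sqrtr //.
rewrite -{}(sqr_sqrtr t0) -{}(sqr_sqrtr e0) in h.
move: (Num.sqrt t) (Num.sqrt e) st se h => a b a0 b0 h {t e t0 e0}.
have [az|az] := eqVneq a 0.
  rewrite az add0r; apply/ler_addgt0Pr => d d0.
  have q0 : 0 < b ^+ 2 + 1 by rewrite ltr_wpDl ?sqr_ge0.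
  have := h _ (divr_gt0 q0 d0); rewrite az expr0n mulr0 add0r invf_div => h'.
  apply: le_trans h' _; rewrite mulrDl mul1r lerD2l mulrAC ler_pdivrMr //.
  by rewrite ler_wpM2l ?(ltW d0) // lerDl.
have [bz|bz] := eqVneq b 0.
  rewrite bz addr0; apply/ler_addgt0Pr => d d0.
  have q0 : 0 < a ^+ 2 + 1 by rewrite ltr_wpDl ?sqr_ge0.
  have := h _ (divr_gt0 d0 q0); rewrite bz expr0n mulr0 addr0 => h'.
  apply: le_trans h' _; rewrite mulrDl mul1r lerD2l mulrAC ler_pdivrMr //.
  by rewrite ler_wpM2l ?(ltW d0) // lerDl.
have ap : 0 < a by rewrite lt_neqAle eq_sym az.
have bp : 0 < b by rewrite lt_neqAle eq_sym bz.
have := h _ (divr_gt0 bp ap); rewrite invf_div.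
have -> : (1 + b / a) * a ^+ 2 + (1 + a / b) * b ^+ 2 = (a + b) ^+ 2.
  by field; rewrite az bz.
by [].
Qed.

End sqrt_triangle.

Section L2_sections.
Variables (R : realType) (d : measure_display) (X : measurableType d)
  (mu : {measure set X -> \bar R}) (F : hilbert_field R X).
Implicit Types (u v : forall x, F x).

Definition L2sq u : \bar R := intR mu (fun x => rnorm (u x) ^+ 2).
(** A seminorm on square-integrable sections; other sections get a junk value. *)
Definition L2norm u : R := Num.sqrt (fine (L2sq u)).
Local Notation L2 := (@L2_section R d X mu F).

Lemma msection_norm2 u : msection u -> measurable_fun setT (fun x => rnorm (u x) ^+ 2).
Proof. by move=> h; apply: measurable_funX; apply: msection_norm. Qed.

Lemma section_ext (P : (forall x, F x) -> Prop) u v : P u -> (forall x, u x = v x) -> P v.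
Proof. by move=> h e; have <- : u = v by apply/functional_extensionality_dep. Qed.

Lemma msectionD u v : msection u -> msection v -> msection (fun x => u x + v x).
Proof.
move=> hu hv; apply: section_ext (msection_lin 1 hu hv) _ => x; by rewrite scale1r.
Qed.

Lemma msectionZ (a : R[i]) u : msection u -> msection (fun x => a *: u x).
Proof.
move=> hu; apply: section_ext (msection_lin a hu (msection0 F)) _ => x.
by rewrite addr0.
Qed.

Lemma msectionN u : msection u -> msection (fun x => - u x).
Proof. by move=> hu; apply: section_ext (msectionZ (-1) hu) _ => x; rewrite scaleN1r. Qed.

Lemma msectionB u v : msection u -> msection v -> msection (fun x => u x - v x).
Proof. by move=> hu hv; apply: msectionD => //; apply: msectionN. Qed.

Lemma L2sq_ge0 u : (0 <= L2sq u)%E.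
Proof. by apply: intR_ge0 => x; rewrite sqr_ge0. Qed.

Lemma L2sq_fin u : L2 u -> L2sq u \is a fin_num.
Proof.
move=> [_ h]; rewrite ge0_fin_numE //; exact: L2sq_ge0.
Qed.

Lemma L2norm_sq u : L2 u -> (L2norm u ^+ 2)%:E = L2sq u.
Proof.
move=> h; rewrite /L2norm sqr_sqrtr ?fineK ?L2sq_fin //.
by rewrite fine_ge0 // L2sq_ge0.
Qed.

Lemma L2norm_ge0 u : 0 <= L2norm u. Proof. exact: sqrtr_ge0. Qed.

Lemma rnorm_sq_tri (H : hilbertType R) (x y : H) (e : R) : 0 < e ->
  rnorm (x + y) ^+ 2 <= (1 + e) * rnorm x ^+ 2 + (1 + e^-1) * rnorm y ^+ 2.
Proof.
move=> e0; have h := rnormD x y.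
have [[x0 y0] z0] := (rnorm_ge0 x, rnorm_ge0 y, rnorm_ge0 (x + y)).
move: (rnorm x) (rnorm y) (rnorm (x + y)) h x0 y0 z0 => a b c h a0 b0 c0.
apply: le_trans (_ : _ <= (a + b) ^+ 2) _; first by rewrite ler_pXn2r ?nnegrE ?addr_ge0.
have e1 : 0 <= (e * a - b) ^+ 2 / e by rewrite divr_ge0 ?sqr_ge0 // ltW.
rewrite -subr_ge0.
suff -> : (1 + e) * a ^+ 2 + (1 + e^-1) * b ^+ 2 - (a + b) ^+ 2 = (e * a - b) ^+ 2 / e by [].
by field; rewrite gt_eqF.
Qed.

Lemma L2sq_triangle u v (e : R) : msection u -> msection v -> 0 < e ->
  (L2sq (fun x => (u x + v x)%R) <= (1 + e)%:E * L2sq u + (1 + e^-1)%:E * L2sq v)%E.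
Proof.
move=> hu hv e0; have e1 : 0 <= 1 + e by rewrite addr_ge0 // ltW.
have e2 : 0 <= 1 + e^-1 by rewrite addr_ge0 // invr_ge0 ltW.
have m1 := msection_norm2 hu; have m2 := msection_norm2 hv.
have mk (k : R) (f : X -> R) : measurable_fun setT f -> measurable_fun setT (fun x => k * f x).
  by move=> mf; apply: measurable_funM => //; exact: measurable_cst.
rewrite /L2sq -(intRZ mu e1 _ m1) => [|x]; last exact: sqr_ge0.
rewrite -(intRZ mu e2 _ m2) => [|x]; last exact: sqr_ge0.
rewrite -intRD; [|by move=> x; rewrite mulr_ge0 ?sqr_ge0|by move=> x; rewrite mulr_ge0 ?sqr_ge0|exact: mk|exact: mk].
apply: intR_le.
- by move=> x; rewrite sqr_ge0 /=; exact: rnorm_sq_tri.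
- exact/msection_norm2/msectionD.
- by apply: measurable_funD; exact: mk.
Qed.

Lemma L2D u v : L2 u -> L2 v -> L2 (fun x => u x + v x).
Proof.
move=> hu hv; have [mu1 _] := hu; have [mv _] := hv; split; first exact: msectionD.
apply: le_lt_trans (L2sq_triangle mu1 mv ltr01) _.
by rewrite -(fineK (L2sq_fin hu)) -(fineK (L2sq_fin hv)) -!EFinM -EFinD ltry.
Qed.

Lemma L2sqZ (a : R[i]) u : msection u -> L2sq (fun x => a *: u x) = ((cabs a ^+ 2)%:E * L2sq u)%E.
Proof.
move=> hu; rewrite /L2sq -(intRZ mu) ?sqr_ge0 //; [|by move=> x; rewrite sqr_ge0|exact: msection_norm2].
by congr intR; apply/funext => x; rewrite rnormZ exprMn.
Qed.

Lemma L2Z (a : R[i]) u : L2 u -> L2 (fun x => a *: u x).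
Proof.
move=> hu; have [mu1 _] := hu; split; first exact: msectionZ.
rewrite -[X in (X < _)%E]/(L2sq (fun x => a *: u x)) L2sqZ //.
by rewrite -(fineK (L2sq_fin hu)) -EFinM ltry.
Qed.

Lemma L2_0 : L2 (fun x => 0).
Proof.
split; first exact: msection0.
rewrite (eq_integral (cst 0%E)) ?integral0 // => x _.
by rewrite rnorm0 expr0n.
Qed.

Lemma L2N u : L2 u -> L2 (fun x => - u x).
Proof. by move=> hu; apply: section_ext (L2Z (-1) hu) _ => x; rewrite scaleN1r. Qed.

Lemma L2B u v : L2 u -> L2 v -> L2 (fun x => u x - v x).
Proof. by move=> hu hv; apply: L2D => //; apply: L2N. Qed.

Lemma L2_lin (a : R[i]) u v : L2 u -> L2 v -> L2 (fun x => a *: u x + v x).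
Proof. by move=> hu hv; apply: L2D => //; apply: L2Z. Qed.

Lemma L2normD u v : L2 u -> L2 v -> L2norm (fun x => u x + v x) <= L2norm u + L2norm v.
Proof.
move=> hu hv; apply: sqrt_triangle_weighted; try by rewrite fine_ge0 // L2sq_ge0.
move=> e e0; rewrite -lee_fin EFinD !EFinM !fineK ?L2sq_fin //; last exact: L2D.
by apply: L2sq_triangle => //; [case: hu|case: hv].
Qed.

Lemma L2normZ (a : R[i]) u : L2 u -> L2norm (fun x => a *: u x) = cabs a * L2norm u.
Proof.
move=> hu; have [mu1 _] := hu; rewrite /L2norm L2sqZ // -(fineK (L2sq_fin hu)) -EFinM /=.
by rewrite sqrtrM ?sqr_ge0 // sqrtr_sqr ger0_norm ?cabs_ge0.
Qed.

Lemma L2normB u v : L2norm (fun x => u x - v x) = L2norm (fun x => v x - u x).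
Proof.
rewrite /L2norm; congr (Num.sqrt (fine _)); congr intR; apply/funext => x.
by rewrite rnormB.
Qed.

Lemma L2norm_triangle3 u v w : L2 u -> L2 v -> L2 w ->
  L2norm (fun x => u x - w x) <= L2norm (fun x => u x - v x) + L2norm (fun x => v x - w x).
Proof.
move=> hu hv hw; have := L2normD (L2B hu hv) (L2B hv hw).
rewrite (_ : (fun x => u x - v x + (v x - w x)) = (fun x => u x - w x)) //.
by apply/functional_extensionality_dep => x; rewrite addrA subrK.
Qed.

Lemma L2norm_le u v : L2 u -> L2 v -> (forall x, rnorm (u x) <= rnorm (v x)) -> L2norm u <= L2norm v.
Proof.
move=> hu hv h; rewrite ler_wsqrtr // fine_le ?L2sq_fin //.
apply: intR_le; [|by apply: msection_norm2; case: hu|by apply: msection_norm2; case: hv].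
by move=> x; rewrite sqr_ge0 /= ler_pXn2r ?nnegrE ?rnorm_ge0.
Qed.

Lemma L2_le u v : msection u -> L2 v -> (forall x, rnorm (u x) <= rnorm (v x)) -> L2 u.
Proof.
move=> hu [hv1 hv] h; split => //; apply: le_lt_trans hv.
apply: (@intR_le _ _ _ mu (fun x => rnorm (u x) ^+ 2)); [|exact: msection_norm2|exact: msection_norm2].
by move=> x; rewrite sqr_ge0 /= ler_pXn2r ?nnegrE ?rnorm_ge0.
Qed.

Lemma L2norm_le_sq u (e : R) : L2 u -> 0 <= e -> (L2sq u <= (e ^+ 2)%:E)%E -> L2norm u <= e.
Proof.
move=> hu e0 h; rewrite -(@ler_pXn2r _ 2) ?nnegrE ?L2norm_ge0 //.
by rewrite -lee_fin L2norm_sq.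
Qed.

Lemma L2norm0 u : L2 u -> (forall x, u x = 0) -> L2norm u = 0.
Proof.
move=> hu h; rewrite /L2norm /L2sq (_ : intR mu _ = 0%E) ?sqrtr0 //.
rewrite /intR (eq_integral (cst 0%E)) ?integral0 // => x _.
by rewrite h rnorm0 expr0n.
Qed.

Lemma L2_dominated (u_ : nat -> forall x, F x) u (g : X -> R) :
  (forall n, L2 (u_ n)) -> L2 u -> measurable_fun setT g -> (intR mu g < +oo)%E ->
  (forall n x, rnorm (u_ n x - u x) ^+ 2 <= g x) ->
  (forall x (e : R), 0 < e -> exists n0, forall n, (n0 <= n)%N -> rnorm (u_ n x - u x) <= e) ->
  forall e : R, 0 < e -> exists n, L2norm (fun x => u x - u_ n x) <= e.
Proof.
move=> hu_ hu mg ig hg hl e e0.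
have mf n : measurable_fun setT (fun x => rnorm (u_ n x - u x) ^+ 2).
  by apply: (@msection_norm2 (fun x => u_ n x - u x)); apply: msectionB; [case: (hu_ n)|case: hu].
have hfg n x : 0 <= rnorm (u_ n x - u x) ^+ 2 <= g x by rewrite sqr_ge0 hg.
have hl2 x (k : R) : 0 < k -> exists n0, forall n, (n0 <= n)%N -> rnorm (u_ n x - u x) ^+ 2 <= k.
  move=> k0; have s0 : 0 < Num.sqrt k by rewrite sqrtr_gt0.
  have [n0 h] := hl x _ s0; exists n0 => n /h hn.
  by rewrite -(sqr_sqrtr (ltW k0)) ler_pXn2r ?nnegrE ?rnorm_ge0 ?sqrtr_ge0.
have [n h] := dominated_vanish mf mg hfg ig hl2 (exprn_gt0 2 e0).
have {}h := h n (leqnn n).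
exists n; rewrite L2normB; apply: L2norm_le_sq; [exact: L2B|exact: ltW|exact: h].
Qed.

End L2_sections.

(** * Trigonometric sections *)

Section circle_sections.
Variables (R : realType) (N : nat) (A : 'M[bool]_N) (w0 : nat -> 'I_N).
Local Notation T := (tail_word A w0).
Variables (cx : T -> nat) (cinj : injective cx).
Variable eta : probability (circle R) R.
Hypothesis heta : is_haar eta.
Local Notation C := (circle R).
Local Notation F := (const_field R cinj C).
Local Notation L2 := (@L2_section R _ C eta F).
Local Notation nrm := (@L2norm R _ C eta F).
Local Notation N2 := (@L2sq R _ C eta F).
Implicit Types (r : seq (R[i] * winding_word A w0)) (u v : C -> l2 R T).

(** The section corresponding to the basis vector of the winding word y. *)
Definition trig_section (y : winding_word A w0) (c : C) : l2 R T := chi y.2 c *: l2e R y.1.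

Definition trig_comb r (c : C) : l2 R T := \sum_(k <- r) k.1 *: trig_section k.2 c.

Lemma trig_comb_cat r r' c : trig_comb (r ++ r') c = trig_comb r c + trig_comb r' c.
Proof. exact: big_cat. Qed.

Lemma trig_comb_scale (a : R[i]) r c :
  trig_comb [seq (a * k.1, k.2) | k <- r] c = a *: trig_comb r c.
Proof.
by rewrite /trig_comb big_map scaler_sumr; apply: eq_bigr => k _; rewrite scalerA.
Qed.

Lemma trig_section_dot y y' c : hdot (trig_section y c) (trig_section y' c) =
  (y.1 == y'.1)%:R * chi (y.2 - y'.2) c.
Proof.
by rewrite hdotZl hdotZr l2e_orthonormal chi_conj chiD; ring.
Qed.

(** The terms of the squared norm of a combination: coefficient and frequency. *)
Definition gram_terms r : seq (R[i] * int) :=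
  [seq (j.1 * Num.conj k.1 * (j.2.1 == k.2.1)%:R, j.2.2 - k.2.2) | j <- r, k <- r].

Lemma trig_comb_norm r c : rnorm (trig_comb r c) ^+ 2 = \sum_(q <- gram_terms r) re_chi q.1 q.2 c.
Proof.
rewrite rnorm_sq hdot_suml cRe_sum /gram_terms big_allpairs_dep; apply: eq_bigr => j _.
rewrite hdotZl hdot_sumr mulr_sumr cRe_sum; apply: eq_bigr => k _.
by rewrite /re_chi hdotZr trig_section_dot /= !mulrA.
Qed.

Lemma trig_comb_msection r : msection (trig_comb r : forall c, F c).
Proof.
move=> t; apply: cmeas_ext (cmeas_sum r (F := fun k c => k.1 * (chi k.2.2 c * (t == k.2.1)%:R)) _) _.
  move=> k; apply: cmeasM; first exact: cmeas_cst.
  by apply: cmeasM; [exact: cmeas_chi|exact: cmeas_cst].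
by move=> c; rewrite /trig_comb l2_sum_eval; apply: eq_bigr => k _.
Qed.

Lemma intR_cst_fin (M : R) : 0 <= M -> (intR eta (fun=> M) < +oo)%E.
Proof.
move=> M0; apply: (@le_lt_trans _ _ (M%:E * eta setT)%E).
  by rewrite /intR -integral_cst.
by rewrite probability_setT mule1 ltry.
Qed.

Lemma L2_bounded (u : forall c, F c) (M : R) : msection u -> (forall c, rnorm (u c) <= M) -> L2 u.
Proof.
move=> hu hM; split => //; apply: le_lt_trans (intR_cst_fin (sqr_ge0 M)).
apply: (@intR_le _ _ _ eta (fun c => rnorm (u c) ^+ 2)); [|exact: msection_norm2|exact: measurable_cst].
move=> c; have M0 : 0 <= M by exact: le_trans (rnorm_ge0 _) (hM c).
by rewrite sqr_ge0 /= ler_pXn2r ?nnegrE ?rnorm_ge0 //; exact: hM.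
Qed.

Lemma trig_section_norm y c : rnorm (trig_section y c) = 1.
Proof. by apply/eqP; rewrite -(sqrp_eq1 (rnorm_ge0 _)) rnorm_sq trig_section_dot eqxx subrr chi0 mulr1. Qed.

Lemma trig_comb_L2 r : L2 (trig_comb r).
Proof.
apply: (L2_bounded (M := \sum_(k <- r) cabs k.1)); first exact: trig_comb_msection.
move=> c; rewrite /trig_comb; elim: r => [|k r IH]; first by rewrite !big_nil rnorm0.
rewrite !big_cons; apply: le_trans (rnormD _ _) _; apply: lerD => //.
by rewrite rnormZ trig_section_norm mulr1.
Qed.

(** Both Gram matrices are the identity, by orthogonality of the characters. *)
Lemma trig_comb_iso (H : hilbertType R) (e : winding_word A w0 -> H) r : orthonormal_family e ->
  nrm (trig_comb r) = rnorm (\sum_(k <- r) k.1 *: e k.2).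
Proof.
move=> he; set h := \sum_(k <- r) _.
suff e1 : N2 (trig_comb r) = (rnorm h ^+ 2)%:E.
  by rewrite /L2norm e1 /= sqrtr_sqr ger0_norm ?rnorm_ge0.
rewrite /L2sq /intR; under eq_integral do rewrite trig_comb_norm.
rewrite trig_integral //; congr (_%:E).
rewrite rnorm_sq hdot_suml cRe_sum /gram_terms big_allpairs_dep; apply: eq_bigr => j _.
rewrite hdotZl hdot_sumr mulr_sumr cRe_sum; apply: eq_bigr => k _ /=.
rewrite hdotZr he subr_eq0; case: j k => [a [x m]] [b [x' m']] /=.
by rewrite xpair_eqE; case: (x == x'); case: (m == m'); rewrite /= ?mulr1 ?mulr0 ?mul0r.
Qed.

(** The closure of the trigonometric sections in L2. *)
Definition trig_approx (u : forall c, F c) := L2 u /\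
  forall e : R, 0 < e -> exists r, nrm (fun c => u c - trig_comb r c) <= e.

Lemma trig_approx_ext u v : trig_approx u -> (forall c, u c = v c) -> trig_approx v.
Proof. by move=> h e; have <- : u = v by apply/funext. Qed.

Lemma trig_approx_lin (a : R[i]) u v : trig_approx u -> trig_approx v -> trig_approx (fun c => a *: u c + v c).
Proof.
move=> [hu Au] [hv Av]; split; first exact: (@L2_lin _ _ _ _ F).
move=> e e0; have q : 0 < cabs a + 1 by rewrite ltr_wpDl ?cabs_ge0.
have e2 : 0 < e / 2 by rewrite divr_gt0.
have [r hr] := Au _ (divr_gt0 e2 q); have [r' hr'] := Av _ e2.
exists ([seq (a * k.1, k.2) | k <- r] ++ r').
have L1 := @L2B _ _ _ _ F _ _ hu (trig_comb_L2 r).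
have L1' := @L2B _ _ _ _ F _ _ hv (trig_comb_L2 r').
have := @L2normD _ _ _ _ F _ _ (L2Z a L1) L1'; rewrite L2normZ //.
rewrite [X in nrm X <= _ -> _](_ : _ = (fun c => a *: u c + v c -
   trig_comb ([seq (a * k.1, k.2) | k <- r] ++ r') c)); last first.
  apply/funext => c; rewrite trig_comb_cat trig_comb_scale scalerBr opprD addrACA.
  by [].
move=> h; apply: le_trans h _.
have h3 : cabs a * nrm (fun c => u c - trig_comb r c) <= e / 2.
  apply: le_trans (_ : _ <= (cabs a + 1) * (e / 2 / (cabs a + 1))) _.
    by apply: ler_pM; rewrite ?cabs_ge0 ?L2norm_ge0 ?lerDl.
  by rewrite mulrC divfK // gt_eqF.
rewrite (splitr e); exact: (lerD h3 hr').
Qed.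

Lemma trig_approx_lim u : L2 u -> (forall e : R, 0 < e -> exists2 v, trig_approx v &
  nrm (fun c => u c - v c) <= e) -> trig_approx u.
Proof.
move=> hu h; split => // e e0; have e2 : 0 < e / 2 by rewrite divr_gt0.
have [v [hv Av] huv] := h _ e2; have [r hr] := Av _ e2; exists r.
apply: le_trans (L2norm_triangle3 hu hv (trig_comb_L2 r)) _.
rewrite (splitr e); exact: (lerD huv hr).
Qed.

Lemma trig_approx0 : trig_approx (fun=> 0).
Proof.
split; first exact: (@L2_0 _ _ _ _ F).
move=> e e0; exists [::]; rewrite L2norm0 ?ltW //.
  by apply: L2B; [exact: (@L2_0 _ _ _ _ F)|exact: trig_comb_L2].
by move=> c; rewrite /trig_comb big_nil subrr.
Qed.

Lemma trig_approxD u v : trig_approx u -> trig_approx v -> trig_approx (fun c => u c + v c).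
Proof. by move=> hu hv; apply: trig_approx_ext (trig_approx_lin 1 hu hv) _ => c; rewrite scale1r. Qed.

Definition coord_section (f : C -> R[i]) (t : T) (c : C) : l2 R T := f c *: l2e R t.

Lemma l2e_rnorm (t : T) : rnorm (l2e R t) = 1.
Proof. by apply/eqP; rewrite -(sqrp_eq1 (rnorm_ge0 _)) rnorm_sq l2e_orthonormal eqxx. Qed.

Lemma coord_section_norm f t c : rnorm (coord_section f t c) = cabs (f c).
Proof. by rewrite rnormZ l2e_rnorm mulr1. Qed.

Lemma coord_section_msection f t : cmeasurable f -> msection (coord_section f t : forall c, F c).
Proof. by move=> hf t'; apply: cmeasM => //; exact: cmeas_cst. Qed.

Lemma coord_sectionB f g t c : coord_section f t c - coord_section g t c = coord_section (fun c => f c - g c) t c.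
Proof. by rewrite /coord_section scalerBl. Qed.

(** Induction on the class: a bounded pointwise limit is a limit in L2. *)
Lemma trig_approx_baire f t : baire f -> trig_approx (coord_section f t).
Proof.
elim=> [m|a {}f g _ IH _ IH'|f_ {}f M hb IH hM hl].
- split.
    apply: (L2_bounded (M := 1)); first exact/coord_section_msection/cmeas_chi.
    by move=> c; rewrite coord_section_norm chi_abs.
  move=> e e0; exists [:: (1, (t, m))]; rewrite L2norm0 ?ltW //; last first.
    by move=> c; rewrite /trig_comb big_seq1 scale1r subrr.
  apply: L2B; last exact: trig_comb_L2.
  apply: (L2_bounded (M := 1)); first exact/coord_section_msection/cmeas_chi.
  by move=> c; rewrite coord_section_norm chi_abs.
- by apply: trig_approx_ext (trig_approx_lin a IH IH') _ => c; rewrite /coord_section scalerDl scalerA.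
have fM c : cabs (f c) <= M by apply: lim_bound (hl c) => n.
have Lf : L2 (coord_section f t).
  apply: (L2_bounded (M := M)); first exact/coord_section_msection/cmeas_baire/(baire_lim hb hM hl).
  by move=> c; rewrite coord_section_norm.
apply: trig_approx_lim => // e e0.
have hg n c : rnorm (coord_section (f_ n) t c - coord_section f t c) ^+ 2 <= (2 * M) ^+ 2.
  rewrite coord_sectionB coord_section_norm ler_pXn2r ?nnegrE ?cabs_ge0 //; last first.
    by rewrite mulr_ge0 // (le_trans _ (fM c)) ?cabs_ge0.
  apply: le_trans (cabsD _ _) _; rewrite cabsN mulr_natl mulr2n.
  exact: lerD (hM n c) (fM c).
have hl' c (k : R) : 0 < k -> exists n0, forall n, (n0 <= n)%N ->
    rnorm (coord_section (f_ n) t c - coord_section f t c) <= k.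
  by move=> k0; have [n0 h] := hl c k k0; exists n0 => n /h; rewrite coord_sectionB coord_section_norm.
have [n hn] := @L2_dominated _ _ _ eta F (fun n => coord_section (f_ n) t) (coord_section f t) (fun=> (2 * M) ^+ 2)
  (fun n => (IH n).1) Lf (measurable_cst _) (intR_cst_fin (sqr_ge0 _)) hg hl' e e0.
by exists (coord_section (f_ n) t).
Qed.

End circle_sections.

(** * Density of the trigonometric sections *)

Section density.
Import HBSimple HBNNSimple.
Variables (R : realType) (N : nat) (A : 'M[bool]_N) (w0 : nat -> 'I_N).
Local Notation T := (tail_word A w0).
Variables (cx : T -> nat) (cinj : injective cx).
Variable eta : probability (circle R) R.
Local Notation C := (circle R).
Local Notation F := (const_field R cinj C).
Local Notation L2 := (@L2_section R _ C eta F).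
Local Notation trig_approx := (@trig_approx R N A w0 cx cinj eta).
Local Notation sec := (@coord_section R N A w0).
Implicit Types (u v : C -> l2 R T).

Lemma baire_sum (I : Type) (s : seq I) (G : I -> C -> R[i]) :
  (forall i, baire (G i)) -> baire (fun c => \sum_(i <- s) G i c).
Proof.
move=> h; elim: s => [|i s IH].
  by apply: baire_ext (baire_cst 0) _ => c; rewrite big_nil.
by apply: baire_ext (baireD (h i) IH) _ => c; rewrite big_cons.
Qed.

Lemma baire_simple (f : {nnsfun C >-> R}) : baire (fun c => (f c)%:C).
Proof.
apply: baire_ext (baire_sum (fset_set (range f))
  (G := fun y c => y%:C * (\1_(f @^-1` [set y]) c : R)%:C) _) _.
  move=> y; apply: baireZ; apply: baire_measurable.
  by rewrite -[_ @^-1` _]setTI; apply: measurable_funP.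
move=> c; rewrite (fimfunE f) fsbig_finite //= rmorph_sum; apply: eq_bigr => y _.
by rewrite rmorphM.
Qed.

(** Simple functions are Baire, and increase to f. *)
Lemma trig_approx_nonneg (f : C -> R) (t : T) : measurable_fun setT f -> (forall c, 0 <= f c) ->
  L2 (sec (fun c => (f c)%:C) t) -> trig_approx (sec (fun c => (f c)%:C) t).
Proof.
move=> mf f0 Lf.
have mEf : measurable_fun setT (EFin \o f) by exact/measurable_EFinP.
pose f_ n : {nnsfun C >-> R} := nnsfun_approx measurableT mEf n.
have fle n c : f_ n c <= f c.
  by rewrite -lee_fin /f_ nnsfun_approxE; apply: le_approx => // y _; rewrite lee_fin.
have A_ n : trig_approx (sec (fun c => (f_ n c)%:C) t) by apply: trig_approx_baire; exact: baire_simple.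
have nE n c : rnorm (sec (fun c => (f_ n c)%:C) t c - sec (fun c => (f c)%:C) t c) = f c - f_ n c.
  by rewrite coord_sectionB coord_section_norm -rmorphB cabs_real distrC ger0_norm // subr_ge0.
have hg n c : rnorm (sec (fun c => (f_ n c)%:C) t c - sec (fun c => (f c)%:C) t c) ^+ 2 <= f c ^+ 2.
  rewrite nE ler_pXn2r ?nnegrE ?subr_ge0 //.
  by rewrite gerBl.
have hl c (k : R) : 0 < k -> exists n0, forall n, (n0 <= n)%N ->
    rnorm (sec (fun c => (f_ n c)%:C) t c - sec (fun c => (f c)%:C) t c) <= k.
  move=> k0; have h := @cvg_nnsfun_approx _ C R setT measurableT _ mEf (fun y _ => _) c I.
  have /fine_cvgP[_ /cvgrPdist_le/(_ _ k0)[n0 _ hn]] := h (fun y => f0 y).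
  by exists n0 => n /hn /=; rewrite nE ger0_norm // subr_ge0.
have ig : (intR eta (fun c => (f c ^+ 2)%R) < +oo)%E.
  have [_] := Lf; rewrite /intR; congr (_ < _)%E; apply: eq_integral => c _.
  by rewrite coord_section_norm cabs_real ger0_norm.
apply: (trig_approx_lim Lf) => e e0.
have [n hn] := @L2_dominated _ _ _ eta F (fun n => sec (fun c => (f_ n c)%:C) t)
  (sec (fun c => (f c)%:C) t) (fun c => f c ^+ 2)
  (fun n => (A_ n).1) Lf (measurable_funX 2 mf) ig hg hl e e0.
by exists (sec (fun c => (f_ n c)%:C) t); [exact: A_|exact: hn].
Qed.

Lemma trig_approx_real (f : C -> R) (t : T) : measurable_fun setT f ->
  L2 (sec (fun c => (f c)%:C) t) -> trig_approx (sec (fun c => (f c)%:C) t).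
Proof.
move=> mf Lf.
have half (sg : R) : `|sg| = 1 -> trig_approx (sec (fun c => (2^-1 * (`|f c| + sg * f c))%:C) t).
  move=> s1; have m1 : measurable_fun setT (fun c => 2^-1 * (`|f c| + sg * f c)).
    apply: measurable_funM; first exact: measurable_cst.
    apply: measurable_funD; first by apply: measurableT_comp.
    by apply: measurable_funM => //; exact: measurable_cst.
  have le1 c : `|sg * f c| <= `|f c| by rewrite normrM s1 mul1r.
  apply: trig_approx_nonneg; first exact: m1.
    move=> c; have := le1 c; rewrite ler_norml => /andP[h _].
    by apply: mulr_ge0; rewrite ?invr_ge0 // -lerBlDl sub0r.
  apply: (L2_le _ Lf); first exact: coord_section_msection (cmeas_real m1).
  move=> c; rewrite !coord_section_norm !cabs_real normrM ger0_norm ?invr_ge0 //.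
  rewrite mulrC ler_pdivrMr // mulr_natr mulr2n; apply: le_trans (ler_normD _ _) _.
  by rewrite normr_id lerD2l le1.
have h1 := half 1 (normr1 _); have h2 := half (-1) (normrN1 _).
apply: trig_approx_ext (trig_approx_lin (-1) h2 h1) _ => c.
rewrite /coord_section scalerA -scalerDl; congr (_ *: _).
by rewrite mulN1r -rmorphN -rmorphD; congr (_%:C); field.
Qed.

Lemma trig_approx_complex (f : C -> R[i]) (t : T) : cmeasurable f -> L2 (sec f t) -> trig_approx (sec f t).
Proof.
move=> [m1 m2] Lf.
have h1 : trig_approx (sec (fun c => (complex.Re (f c))%:C) t).
  apply: trig_approx_real; first exact: m1.
  apply: (L2_le _ Lf); first exact: coord_section_msection (cmeas_real m1).
  by move=> c; rewrite !coord_section_norm cabs_real Re_le_cabs.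
have h2 : trig_approx (sec (fun c => (complex.Im (f c))%:C) t).
  apply: trig_approx_real; first exact: m2.
  apply: (L2_le _ Lf); first exact: coord_section_msection (cmeas_real m2).
  by move=> c; rewrite !coord_section_norm cabs_real Im_le_cabs.
apply: trig_approx_ext (trig_approx_lin 'i h2 h1) _ => c.
rewrite /coord_section scalerA -scalerDl; congr (_ *: _).
by case: (f c) => a b; apply: complex_ext => /=; ring.
Qed.

(** A section is the limit of its truncations, treated one coordinate at a time. *)
Lemma trig_approx_all (u : forall c, F c) : L2 u -> trig_approx u.
Proof.
move=> Lu; have [mu1 iu] := Lu.
have At m : trig_approx (fun c => enum_trunc cx (u c) m).
  elim: m => [|m IH].
    by apply: trig_approx_ext (trig_approx0 cinj eta) _ => c; rewrite /enum_trunc big_geq.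
  case e : (enum_of cx m) => [t|]; last first.
    by apply: trig_approx_ext IH _ => c; rewrite enum_truncS e addr0.
  have mut : cmeasurable (fun c => (u c : l2 R T) t) by exact: mu1.
  have h : trig_approx (sec (fun c => (u c : l2 R T) t) t).
    apply: trig_approx_complex; first exact: mut.
    apply: (L2_le _ Lu); first exact: coord_section_msection mut.
    by move=> c; rewrite coord_section_norm; exact: l2_coord_le.
  by apply: trig_approx_ext (trig_approxD IH h) _ => c; rewrite enum_truncS e.
have mg : measurable_fun setT (fun c => rnorm (u c) ^+ 2) by exact: msection_norm2.
have hg m c : rnorm (enum_trunc cx (u c) m - u c) ^+ 2 <= rnorm (u c) ^+ 2.
  by rewrite ler_pXn2r ?nnegrE ?rnorm_ge0 // rnormB; exact: enum_trunc_le.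
have hl c (k : R) : 0 < k -> exists n0, forall n, (n0 <= n)%N ->
    rnorm (enum_trunc cx (u c) n - u c) <= k.
  move=> k0; have [n0 h] := enum_trunc_dense cinj (u c) k0; exists n0 => n /h /ltW.
  by rewrite rnormB.
apply: (trig_approx_lim Lu) => e e0.
have [n hn] := @L2_dominated _ _ _ eta F (fun m c => enum_trunc cx (u c) m) u (fun c => rnorm (u c) ^+ 2)
  (fun n => (At n).1) Lu mg iu hg hl e e0.
by exists (fun c => enum_trunc cx (u c) n); [exact: At|exact: hn].
Qed.

End density.

(** * The correspondence between sections and vectors *)

Section graph.
Variables (R : realType) (N : nat) (A : 'M[bool]_N) (w0 : nat -> 'I_N).
Local Notation T := (tail_word A w0).
Variables (cx : T -> nat) (cinj : injective cx).
Variable eta : probability (circle R) R.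
Hypothesis heta : is_haar eta.
Local Notation C := (circle R).
Local Notation F := (const_field R cinj C).
Local Notation L2 := (@L2_section R _ C eta F).
Local Notation nrm := (@L2norm R _ C eta F).
Local Notation trig_comb := (@trig_comb R N A w0).
Variables (H : hilbertType R) (e : winding_word A w0 -> H).
Hypothesis he : orthonormal_family e.
Hypothesis hdense : forall (h : H) (k : R), 0 < k ->
  exists r : seq (R[i] * winding_word A w0), rnorm (h - \sum_(k <- r) k.1 *: e k.2) < k.
Implicit Types (r : seq (R[i] * winding_word A w0)) (u v : forall c : C, F c) (h : H).

Definition vec_comb r : H := \sum_(k <- r) k.1 *: e k.2.

Lemma vec_comb_cat r r' : vec_comb (r ++ r') = vec_comb r + vec_comb r'.
Proof. exact: big_cat. Qed.

Lemma vec_comb_scale (a : R[i]) r : vec_comb [seq (a * k.1, k.2) | k <- r] = a *: vec_comb r.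
Proof.
by rewrite /vec_comb big_map scaler_sumr; apply: eq_bigr => k _; rewrite scalerA.
Qed.

Lemma comb_isoB r r' : nrm (fun c => trig_comb r c - trig_comb r' c) = rnorm (vec_comb r - vec_comb r').
Proof.
have := trig_comb_iso cinj heta (r ++ [seq (-1 * k.1, k.2) | k <- r']) he.
rewrite -/(vec_comb _) vec_comb_cat vec_comb_scale scaleN1r => <-; congr L2norm.
by apply/funext => c; rewrite trig_comb_cat trig_comb_scale scaleN1r.
Qed.

(** The closed graph of the isometry sending the trigonometric section of y to the
    vector e y. A relation, not a map, so that its preservation by an operator family
    can be stated as a condition on pairs of a section and a vector. *)
Definition fourier_graph u h := L2 u /\ forall k : R, 0 < k ->
  exists r, nrm (fun c => u c - trig_comb r c) <= k /\ rnorm (h - vec_comb r) <= k.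

Lemma fourier_graph_ext u v h : fourier_graph u h -> (forall c, u c = v c) -> fourier_graph v h.
Proof. by move=> hg huv; have <- : u = v by apply/functional_extensionality_dep. Qed.

Lemma L2norm_near u v : L2 u -> L2 v -> nrm u <= nrm (fun c => u c - v c) + nrm v.
Proof.
move=> hu hv; have := L2normD (L2B hu hv) hv.
rewrite [X in nrm X <= _ -> _](_ : _ = u) //.
by apply/functional_extensionality_dep => c; rewrite subrK.
Qed.

Lemma rnorm_near (x y : H) : rnorm x <= rnorm (x - y) + rnorm y.
Proof. by rewrite -{1}(subrK y x) rnormD. Qed.

Lemma comb_iso1 r : nrm (trig_comb r) = rnorm (vec_comb r).
Proof. exact: (trig_comb_iso cinj heta r he). Qed.

Lemma fourier_graph_iso u h : fourier_graph u h -> nrm u = rnorm h.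
Proof.
move=> [hu hG]; apply/eqP; rewrite eq_le; apply/andP; split; apply/ler_addgt0Pr => k k0.
  have k2 : 0 < k / 2 by rewrite divr_gt0.
  have [r [h1 h2]] := hG _ k2.
  apply: le_trans (L2norm_near hu (trig_comb_L2 cinj eta r)) _.
  rewrite comb_iso1; apply: le_trans (lerD h1 (rnorm_near _ h)) _.
  rewrite rnormB; apply: le_trans (lerD (lexx _) (lerD h2 (lexx _))) _.
  by rewrite addrA -splitr addrC.
have k2 : 0 < k / 2 by rewrite divr_gt0.
have [r [h1 h2]] := hG _ k2.
apply: le_trans (rnorm_near h (vec_comb r)) _.
rewrite -comb_iso1; apply: le_trans (lerD h2 (L2norm_near (trig_comb_L2 cinj eta r) hu)) _.
rewrite L2normB; apply: le_trans (lerD (lexx _) (lerD h1 (lexx _))) _.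
by rewrite addrA -splitr addrC.
Qed.

Lemma scaled_small (a b k : R) : 0 <= a -> 0 <= b -> b <= k / 2 / (a + 1) -> a * b <= k / 2.
Proof.
move=> a0 b0; have q : 0 < a + 1 by rewrite ltr_wpDl.
rewrite ler_pdivlMr // => h; apply: le_trans h; rewrite mulrC ler_wpM2l // lerDl.
by [].
Qed.

Lemma fourier_graph_lin (a : R[i]) u v h g : fourier_graph u h -> fourier_graph v g ->
  fourier_graph (fun c => a *: u c + v c) (a *: h + g).
Proof.
move=> [hu hG] [hv hG']; split; first exact: (@L2_lin _ _ _ _ F).
move=> k k0; have q : 0 < cabs a + 1 by rewrite ltr_wpDl ?cabs_ge0.
have k2 : 0 < k / 2 by rewrite divr_gt0.
have [r [h1 h2]] := hG _ (divr_gt0 k2 q); have [r' [h1' h2']] := hG' _ k2.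
exists ([seq (a * k.1, k.2) | k <- r] ++ r'); split.
  have L1 := @L2B _ _ _ _ F _ _ hu (trig_comb_L2 cinj eta r).
  have L1' := @L2B _ _ _ _ F _ _ hv (trig_comb_L2 cinj eta r').
  have := @L2normD _ _ _ _ F _ _ (L2Z a L1) L1'; rewrite L2normZ //.
  rewrite [X in nrm X <= _ -> _](_ : _ = (fun c => a *: u c + v c -
    trig_comb ([seq (a * k.1, k.2) | k <- r] ++ r') c)); last first.
    apply/funext => c; rewrite trig_comb_cat trig_comb_scale scalerBr opprD addrACA.
    by [].
  move=> h3; apply: le_trans h3 _.
  rewrite (splitr k); apply: (lerD _ h1').
  exact: scaled_small (cabs_ge0 _) (L2norm_ge0 _ _) h1.
rewrite vec_comb_cat vec_comb_scale.
have -> : a *: h + g - (a *: vec_comb r + vec_comb r') = a *: (h - vec_comb r) + (g - vec_comb r').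
  by rewrite scalerBr opprD addrACA.
apply: le_trans (rnormD _ _) _; rewrite rnormZ (splitr k); apply: (lerD _ h2').
exact: scaled_small (cabs_ge0 _) (rnorm_ge0 _) h2.
Qed.

Lemma fourier_graph_lim u h : L2 u -> (forall k : R, 0 < k -> exists v g, [/\ fourier_graph v g,
  nrm (fun c => u c - v c) <= k & rnorm (h - g) <= k]) -> fourier_graph u h.
Proof.
move=> hu hh; split => // k k0; have k2 : 0 < k / 2 by rewrite divr_gt0.
have [v [g [[hv hG] h1 h2]]] := hh _ k2; have [r [h3 h4]] := hG _ k2; exists r; split.
  apply: le_trans (L2norm_triangle3 hu hv (trig_comb_L2 cinj eta r)) _.
  rewrite (splitr k); exact: (lerD h1 h3).
have -> : h - vec_comb r = (h - g) + (g - vec_comb r) by rewrite addrA subrK.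
apply: le_trans (rnormD _ _) _; rewrite (splitr k); exact: (lerD h2 h4).
Qed.

Lemma fourier_graph_comb r : fourier_graph (trig_comb r) (vec_comb r).
Proof.
split; first exact: trig_comb_L2.
move=> k k0; exists r; rewrite subrr rnorm0 (ltW k0) L2norm0 ?(ltW k0) //.
  apply: L2B; exact: trig_comb_L2.
by move=> c; rewrite subrr.
Qed.

Lemma fourier_graph_e y : fourier_graph (trig_section (R := R) y) (e y).
Proof.
have := fourier_graph_comb [:: (1, y)]; rewrite /vec_comb big_seq1 scale1r => hg.
by apply: fourier_graph_ext hg _ => c; rewrite /trig_comb big_seq1 scale1r.
Qed.

Lemma fourier_graph_0 : fourier_graph (fun=> 0) 0.
Proof.
have := fourier_graph_comb [::]; rewrite /vec_comb big_nil => hg.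
by apply: fourier_graph_ext hg _ => c; rewrite /trig_comb big_nil.
Qed.

Lemma fourier_graph_unique u h h' : fourier_graph u h -> fourier_graph u h' -> h = h'.
Proof.
move=> hg hg'; have h1 := fourier_graph_lin (-1) hg hg'; have [L1 _] := h1.
have := fourier_graph_iso h1; rewrite L2norm0 //; last by move=> c; rewrite scaleN1r addNr.
move=> /esym /rnorm0_eq0 /eqP; rewrite scaleN1r addrC subr_eq0 => /eqP ->.
by [].
Qed.

Lemma inv_small (k : R) : 0 < k -> exists n0 : nat, forall n : nat, (n0 <= n)%N -> n.+1%:R^-1 < k.
Proof.
move=> k0; have k1 : 0 <= k^-1 by rewrite invr_ge0 ltW.
exists (Num.bound k^-1) => n hn; rewrite invf_plt ?posrE //.
by apply: lt_le_trans (archi_boundP k1) _; rewrite ler_nat (leq_trans hn).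
Qed.

(** Approximate u by trigonometric sections; by isometry the corresponding vectors
    form a Cauchy sequence. *)
Lemma fourier_graph_total u : L2 u -> exists h, fourier_graph u h.
Proof.
move=> hu; have [_ hA] := trig_approx_all hu.
have n0 n : 0 < n.+1%:R^-1 :> R by rewrite invr_gt0.
pose r n := proj1_sig (cid (hA _ (n0 n))).
have hr n : nrm (fun c => u c - trig_comb (r n) c) <= n.+1%:R^-1 by rewrite /r; case: cid.
have dr m n : rnorm (vec_comb (r m) - vec_comb (r n)) <= m.+1%:R^-1 + n.+1%:R^-1.
  rewrite -comb_isoB.
  apply: le_trans (L2norm_triangle3 (trig_comb_L2 cinj eta (r m)) hu (trig_comb_L2 cinj eta (r n))) _.
  rewrite L2normB; exact: (lerD (hr m) (hr n)).
have [h hl] : exists h, lim_seq (fun n => vec_comb (r n)) h.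
  apply: hilbert_complete => k k0; have k2 : 0 < k / 2 by rewrite divr_gt0.
  have [q hq] := inv_small k2; exists q => m n hm hn.
  apply: le_lt_trans (dr m n) _; rewrite (splitr k).
  exact: (ltrD (hq m hm) (hq n hn)).
exists h; split => // k k0.
have [n1 h1] := inv_small k0; have [n2 h2] := hl k k0.
exists (r (maxn n1 n2)); split.
  exact: le_trans (hr _) (ltW (h1 _ (leq_maxl _ _))).
rewrite rnormB; exact: ltW (h2 _ (leq_maxr _ _)).
Qed.

(** Contractions that match on the basis match on its combinations, then on limits. *)
Lemma fourier_graph_op (TF : C -> l2 R T -> l2 R T) (TH : H -> H) :
  (forall c (a : R[i]) f g, TF c (a *: f + g) = a *: TF c f + TF c g) ->
  (forall c f, rnorm (TF c f) <= rnorm f) ->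
  (forall u, msection u -> msection ((fun c => TF c (u c)) : forall c, F c)) ->
  (forall (a : R[i]) f g, TH (a *: f + g) = a *: TH f + TH g) ->
  (forall f, rnorm (TH f) <= rnorm f) ->
  (forall y, fourier_graph (fun c => TF c (trig_section (R := R) y c)) (TH (e y))) ->
  forall u h, fourier_graph u h -> fourier_graph (fun c => TF c (u c)) (TH h).
Proof.
move=> linF conF mF linH conH hy u h [hu hG].
have TF0 c : TF c 0 = 0 by have := linF c (-1) 0 0; rewrite !scaleN1r !addNr.
have TH0 : TH 0 = 0 by have := linH (-1) 0 0; rewrite !scaleN1r !addNr.
have TFB c f g : TF c (f - g) = TF c f - TF c g.
  by have := linF c (-1) g f; rewrite !scaleN1r ![- _ + _]addrC.
have THB f g : TH (f - g) = TH f - TH g.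
  by have := linH (-1) g f; rewrite !scaleN1r ![- _ + _]addrC.
have LT v : L2 v -> L2 (fun c => TF c (v c)).
  move=> hv; apply: (L2_le _ hv); first by apply: mF; case: hv.
  by move=> c; exact: conF.
have hc r : fourier_graph (fun c => TF c (trig_comb r c)) (TH (vec_comb r)).
  elim: r => [|k r IH].
    rewrite /vec_comb big_nil TH0; apply: fourier_graph_ext fourier_graph_0 _ => c.
    by rewrite /trig_comb big_nil TF0.
  rewrite /vec_comb big_cons linH; apply: fourier_graph_ext (fourier_graph_lin k.1 (hy k.2) IH) _ => c.
  by rewrite /trig_comb big_cons linF.
apply: fourier_graph_lim; first exact: LT.
move=> k k0; have [r [h1 h2]] := hG k k0.
exists (fun c => TF c (trig_comb r c)), (TH (vec_comb r)); split; first exact: hc.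
  apply: le_trans h1; apply: L2norm_le.
  - apply: L2B; [exact: LT|apply: LT; exact: trig_comb_L2].
  - exact: (L2B hu (trig_comb_L2 cinj eta r)).
  - by move=> c; rewrite -TFB; exact: conF.
by apply: le_trans h2; rewrite -THB; exact: conH.
Qed.

End graph.

(** * Completeness of the space of sections *)

Section riesz_fischer.
Variable R : realType.

Lemma two_pow_small (G k : R) : 0 <= G -> 0 < k ->
  exists n0, forall n, (n0 <= n)%N -> G * 2 / 2 ^+ n < k.
Proof.
move=> G0 k0; have q : 0 < 2 :> R by [].
have b0 : 0 <= G * 2 / k by rewrite divr_ge0 ?mulr_ge0 // ltW.
exists (Num.bound (G * 2 / k)) => n hn.
rewrite ltr_pdivrMr ?exprn_gt0 // [ltRHS]mulrC -ltr_pdivrMr //.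
apply: lt_le_trans (archi_boundP b0) _.
apply: le_trans (_ : (n%:R : R) <= _); first by rewrite ler_nat.
by rewrite -natrX ler_nat ltnW // ltn_expl.
Qed.

Lemma geometric_limit (H : hilbertType R) (x : nat -> H) (G : R) : 0 <= G ->
  (forall k, rnorm (x k.+1 - x k) <= G / 2 ^+ k) ->
  exists l, forall n, rnorm (l - x n) <= G * 2 / 2 ^+ n.
Proof.
move=> G0 hx; have p2 n : 0 < 2 ^+ n :> R by rewrite exprn_gt0.
have step n m : rnorm (x (n + m)%N - x n) <= G * 2 / 2 ^+ n - G * 2 / 2 ^+ (n + m).
  elim: m => [|m IH]; first by rewrite addn0 !subrr rnorm0.
  have -> : x (n + m.+1)%N - x n = (x (n + m).+1 - x (n + m)%N) + (x (n + m)%N - x n).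
    by rewrite addrA subrK addnS.
  apply: le_trans (rnormD _ _) _; apply: le_trans (lerD (hx _) IH) _.
  rewrite addnS exprS le_eqVlt; apply/orP; left; apply/eqP; field.
  by rewrite !gt_eqF.
have far n m : rnorm (x (n + m)%N - x n) <= G * 2 / 2 ^+ n.
  apply: le_trans (step n m) _; rewrite gerBl; apply: divr_ge0; last exact: ltW.
  by rewrite mulr_ge0.
have [l hl] : exists l, lim_seq x l.
  apply: hilbert_complete => k k0; have k2 : 0 < k / 2 by rewrite divr_gt0.
  have [n0 h0] := two_pow_small G0 k2; exists n0 => m n hm hn.
  have -> : x m - x n = (x m - x n0) - (x n - x n0) by rewrite opprB addrA subrK.
  apply: le_lt_trans (rnormD _ _) _; rewrite rnormN (splitr k).
  have e q : (n0 <= q)%N -> rnorm (x q - x n0) < k / 2.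
    move=> hq; rewrite -(subnKC hq); exact: le_lt_trans (far _ _) (h0 _ (leqnn _)).
  exact: (ltrD (e _ hm) (e _ hn)).
exists l => n; apply/ler_addgt0Pr => k k0; have [n0 h0] := hl k k0.
have -> : l - x n = - (x (n + n0)%N - l) + (x (n + n0)%N - x n).
  by rewrite opprB addrA subrK.
apply: le_trans (rnormD _ _) _; rewrite rnormN addrC.
apply: lerD; first exact: far.
by apply: ltW; apply: h0; exact: leq_addl.
Qed.

Variables (T : choiceType) (cx : T -> nat) (cinj : injective cx).
Variables (d : measure_display) (X : measurableType d) (mu : {measure set X -> \bar R}).
Local Notation F := (const_field R cinj X).
Local Notation L2 := (@L2_section R d X mu F).
Local Notation N2 := (@L2sq R d X mu F).

(** The series g of the squared increments, weighted by 4 ^ k, has a finite integral.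
    Where g is finite, the sequence converges geometrically with error at most
    2 sqrt(g) / 2 ^ n; elsewhere the limit is set to 0, and the bound by a multiple of
    g holds trivially. Integrating it gives convergence in L2. *)
Lemma riesz_fischer (t : nat -> forall x, F x) : (forall n, L2 (t n)) ->
  (forall k, (N2 (fun x => (2 ^+ k)%:C *: (t k.+1 x - t k x)%R) <= (1 / (2 ^ k.+1)%:R)%:E)%E) ->
  exists2 u, L2 u & forall n, (N2 (fun x => (u x - t n x)%R) <= (4 / 4 ^+ n)%:E)%E.
Proof.
move=> ht hN.
pose w k x := (2 ^+ k)%:C *: (t k.+1 x - t k x) : l2 R T.
have hw k : L2 (w k) by apply: L2Z; apply: L2B.
pose g x := (\sum_(k <oo) (rnorm (w k x) ^+ 2)%:E)%E.
have w0 k x : (0 <= (rnorm (w k x) ^+ 2)%:E)%E by rewrite lee_fin sqr_ge0.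
have mw k : measurable_fun setT (fun x => (rnorm (w k x) ^+ 2)%:E).
  by apply/measurable_EFinP; apply: (@msection_norm2 _ _ _ F); case: (hw k).
have mg : measurable_fun setT g.
  apply: (@ge0_emeasurable_sum _ _ _ setT (fun k x => (rnorm (w k x) ^+ 2)%:E) xpredT) => //.
have ig : (\int[mu]_x g x <= 1)%E.
  rewrite integral_nneseries //.
  apply: le_trans (epsilon_trick0 xpredT ler01).
  by apply: lee_nneseries => [k _ _|k _]; [exact: integral_ge0|exact: hN].
have g0 x : (0 <= g x)%E by apply: nneseries_ge0 => k _ _; exact: w0.
pose D := [set x | (g x < +oo)%E].
have mD : measurable D.
  by have := emeasurable_fun_infty_o measurableT mg +oo%E; rewrite setTI.
have inc x k : D x -> rnorm (t k.+1 x - t k x) <= Num.sqrt (fine (g x)) / 2 ^+ k.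
  move=> Dx; have gf : g x \is a fin_num by rewrite ge0_fin_numE.
  rewrite ler_pdivlMr ?exprn_gt0 //.
  have -> : rnorm (t k.+1 x - t k x) * 2 ^+ k = rnorm (w k x).
    by rewrite /w rnormZ cabs_real ger0_norm ?exprn_ge0 // mulrC.
  rewrite -[leLHS]ger0_norm ?rnorm_ge0 // -sqrtr_sqr ler_wsqrtr //.
  rewrite -lee_fin fineK //.
  apply: le_trans (nneseries_lim_ge (m := 0%N) (P := xpredT) k.+1 _); last by move=> n _ _; exact: w0.
  rewrite big_nat_recr //= leeDr //.
  by apply: sume_ge0 => n _; exact: w0.
have lim x : exists l : l2 R T, D x -> forall n, rnorm (l - t n x) <= Num.sqrt (fine (g x)) * 2 / 2 ^+ n.
  have [Dx|nD] := pselect (D x); last by exists 0 => /nD.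
  have [l hl] := geometric_limit (sqrtr_ge0 _) (fun k => inc x k Dx).
  by exists l.
pose u x : l2 R T := if x \in D then proj1_sig (cid (lim x)) else 0.
have uE x n : D x -> rnorm (u x - t n x) <= Num.sqrt (fine (g x)) * 2 / 2 ^+ n.
  by move=> Dx; rewrite /u mem_set //; case: cid => l /= /(_ Dx).
have mu_ : msection (u : forall x, F x).
  move=> s.
  apply: (@cmeas_lim _ _ _ (fun n x => (\1_D x)%:C * (t n x : l2 R T) s)) => [n|x e e0].
    apply: cmeasM; first by apply: cmeas_real; exact: measurable_indic.
    by have [h _] := ht n; exact: h.
  have [Dx|nD] := pselect (D x); last first.
    exists 0%N => n _; rewrite indicE memNset // mul0r sub0r cabsN /u memNset //.
    by rewrite l2E0 cabs0 ltW.
  have [n0 h0] := two_pow_small (sqrtr_ge0 (fine (g x))) e0; exists n0 => n hn.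
  rewrite indicE mem_set // mul1r -l2EB; apply: le_trans (l2_coord_le _ _) _.
  by rewrite rnormB; apply: le_trans (uE x n Dx) (ltW (h0 n hn)).
have bound n : (N2 (fun x => ((u x : F x) - t n x)%R) <= (4 / 4 ^+ n)%:E)%E.
  have p4 : 0 <= 4 / 4 ^+ n :> R by rewrite divr_ge0 ?exprn_ge0.
  apply: (@le_trans _ _ (\int[mu]_x ((4 / 4 ^+ n)%:E * g x))%E).
    apply: ge0_le_integral => //.
    - by move=> x _; rewrite lee_fin sqr_ge0.
    - apply/measurable_EFinP; apply: (@msection_norm2 _ _ _ F (fun x => (u x : F x) - t n x)).
      by apply: (@msectionB _ _ _ F) => //; case: (ht n).
    - by apply: emeasurable_funM => //; exact: measurable_cst.
    move=> x _; have [Dx|nD] := pselect (D x); last first.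
      have -> : g x = +oo%E by apply/eqP; rewrite eq_le leey /= leNgt; exact/negP.
      by rewrite gt0_muley ?leey // lte_fin divr_gt0 ?exprn_gt0.
    have gf : g x \is a fin_num by rewrite ge0_fin_numE.
    rewrite -(fineK gf) -EFinM lee_fin.
    have s0 : 0 <= fine (g x) by rewrite fine_ge0.
    rewrite -[in leRHS](sqr_sqrtr s0).
    have -> : 4 / 4 ^+ n * Num.sqrt (fine (g x)) ^+ 2 =
        (Num.sqrt (fine (g x)) * 2 / 2 ^+ n) ^+ 2.
      have e4 : 2 ^+ 2 = 4 :> R by ring.
      by rewrite expr_div_n exprMn -exprM [(n * 2)%N]mulnC exprM e4 mulrC mulrA.
    have q0 : 0 <= Num.sqrt (fine (g x)) * 2 / 2 ^+ n.
      by apply: divr_ge0; rewrite ?exprn_ge0 // mulr_ge0 ?sqrtr_ge0.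
    rewrite ler_pXn2r ?nnegrE ?rnorm_ge0 //; exact: uE.
  rewrite ge0_integralZl //.
  by rewrite -[leRHS]mule1; apply: lee_wpmul2l => //; rewrite lee_fin.
have L0 : L2 (fun x => (u x : F x) - t 0%N x).
  split; first by apply: (@msectionB _ _ _ F) => //; case: (ht 0%N).
  exact: le_lt_trans (bound 0%N) (ltry _).
exists u; last exact: bound.
by apply: (section_ext (P := L2) (L2D L0 (ht 0%N))) => x; exact: subrK.
Qed.

End riesz_fischer.

Section graph_onto.
Variables (R : realType) (N : nat) (A : 'M[bool]_N) (w0 : nat -> 'I_N).
Variables (cx : tail_word A w0 -> nat) (cinj : injective cx).
Variable eta : probability (circle R) R.
Hypothesis heta : is_haar eta.
Local Notation F := (const_field R cinj (circle R)).
Local Notation trig_comb := (@trig_comb R N A w0).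
Variables (H : hilbertType R) (e : winding_word A w0 -> H).
Hypothesis he : orthonormal_family e.
Hypothesis hdense : forall (h : H) (k : R), 0 < k ->
  exists r : seq (R[i] * winding_word A w0), rnorm (h - \sum_(k <- r) k.1 *: e k.2) < k.
Local Notation fourier_graph := (@fourier_graph R N A w0 cx cinj eta H e).
Local Notation vec_comb := (@vec_comb R N A w0 H e).

(** Approximate h by combinations of basis vectors at a geometric rate. *)
Lemma fourier_graph_onto h : exists u, fourier_graph u h.
Proof.
have d0 k : 0 < (4 ^+ k.+1)^-1 :> R by rewrite invr_gt0 exprn_gt0.
pose r k := proj1_sig (cid (hdense h (d0 k))).
have hr k : rnorm (h - vec_comb (r k)) < (4 ^+ k.+1)^-1 by rewrite /r; case: cid.
have ht k := trig_comb_L2 cinj eta (r k).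
have [k|u hu hb] := @riesz_fischer R _ cx cinj _ _ eta (fun k => trig_comb (r k)) ht.
  rewrite L2sqZ; last by apply: msectionB; [case: (ht k.+1)|case: (ht k)].
  rewrite -L2norm_sq; last exact: (L2B (ht k.+1) (ht k)).
  rewrite (comb_isoB cinj heta he) cabs_real ger0_norm ?exprn_ge0 // -EFinM lee_fin.
  have hd : rnorm (vec_comb (r k.+1) - vec_comb (r k)) <= 2 / 4 ^+ k.+1.
    have -> : vec_comb (r k.+1) - vec_comb (r k) =
      (h - vec_comb (r k)) - (h - vec_comb (r k.+1)) by rewrite opprB [RHS]addrC addrA subrK.
    apply: le_trans (rnormD _ _) _; rewrite rnormN.
    apply: le_trans (lerD (ltW (hr k)) (ltW (hr k.+1))) _.
    rewrite mulr_natl mulr2n lerD2l lef_pV2 ?posrE ?exprn_gt0 //.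
    by rewrite ler_weXn2l // ler1n.
  rewrite -exprMn; apply: le_trans (_ : _ <= (2 ^+ k * (2 / 4 ^+ k.+1)) ^+ 2) _.
    rewrite ler_pXn2r ?nnegrE ?mulr_ge0 ?exprn_ge0 ?rnorm_ge0 ?invr_ge0 ?exprn_ge0 //.
    by rewrite ler_wpM2l ?exprn_ge0.
  have -> : 2 ^+ k * (2 / 4 ^+ k.+1) = (2 ^+ k.+1)^-1 :> R.
    have -> : 4 = 2 * 2 :> R by ring.
    rewrite exprMn (exprS _ k); field.
    by rewrite gt_eqF // exprn_gt0.
  rewrite natrX div1r expr2 ler_piMr ?invr_ge0 ?exprn_ge0 //.
  by rewrite invf_le1 ?exprn_gt0 // exprn_ege1 // ler1n.
exists u; split; first exact: hu.
move=> k k0; have [n1 h1] := two_pow_small (ler0n R 1) k0.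
have [n2 h2] := inv_small k0.
exists (r (maxn n1 n2)); set n := maxn n1 n2; split.
  apply: le_trans (ltW (h1 n (leq_maxl _ _))).
  apply: L2norm_le_sq; first exact: (L2B hu (ht n)).
    by rewrite divr_ge0 ?exprn_ge0 // mulr_ge0.
  apply: le_trans (hb n) _; rewrite lee_fin mul1r.
  have e4 : 2 ^+ 2 = 4 :> R by ring.
  by rewrite expr_div_n -exprM mulnC exprM e4.
apply: le_trans (ltW (hr n)) _; apply: le_trans (ltW (h2 n (leq_maxr _ _))).
rewrite lef_pV2 ?posrE ?exprn_gt0 // -natrX ler_nat.
by apply: ltnW; exact: ltn_expl.
Qed.

End graph_onto.

(** * Decomposition of a chain representation *)

Section decomposition.
Variables (R : realType) (N : nat) (A : 'M[bool]_N) (O : cstarAlgType R)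
  (s : 'I_N -> O).
Hypothesis hO : is_cuntz_krieger A s.
Variables (w0 : nat -> 'I_N) (p : nat).
Hypothesis hp : minimal_period w0 p.
Hypothesis hA : admissible_word A w0.
Variables (cx : tail_word A w0 -> nat) (cinj : injective cx).
Variable eta : probability (circle R) R.
Hypothesis heta : is_haar eta.
Local Notation C := (circle R).
Local Notation F := (const_field R cinj C).
Local Notation L2 := (@L2_section R _ C eta F).
Local Notation nrm := (@L2norm R _ C eta F).
Local Notation base_word := (base_word hA).

(** The phases of the model of P(J; c), gathered over c. *)
Definition phase (c : C) (y : tail_branching A hp) : R[i] := if y == base_word then val c else 1.

Lemma phase1 c y : cabs (phase c y) = 1.
Proof.
rewrite /phase; case: eqP => _; last exact: cabs1.
by apply: complexI; rewrite -cabsE (eqP (valP c)).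
Qed.

Lemma phaseE c y : phase c y = chi (y == base_word)%:Z c.
Proof. by rewrite /phase; case: eqP => _; rewrite /chi ?expr1z ?expr0z. Qed.

Lemma cmeas_phase y : cmeasurable (fun c => phase c y).
Proof.
by rewrite /phase; case: eqP => _; [exact: cmeas_val|exact: cmeas_cst].
Qed.

Definition fiber_gen i c : l2 R (tail_branching A hp) -> l2 R (tail_branching A hp) := wcomp (gen_data (phase1 c) i).
Definition fiber_gen_adj i c : l2 R (tail_branching A hp) -> l2 R (tail_branching A hp) := wcomp (gen_data_adj (phase1 c) i).

Lemma fiber_gen_msection i (u : forall c, F c) : msection u ->
  msection ((fun c => fiber_gen i c (u c)) : forall c, F c).
Proof.
move=> hu y.
apply: cmeas_ext (_ : cmeasurable (fun c => if word_head y == i then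
    phase c y * (u c : l2 R (tail_word A w0)) (word_tail hp y) else 0)) _ => //.
case: eqP => _; last exact: cmeas_cst.
by apply: cmeasM; [exact: cmeas_phase|exact: hu].
Qed.

Lemma fiber_gen_adj_msection i (u : forall c, F c) : msection u ->
  msection ((fun c => fiber_gen_adj i c (u c)) : forall c, F c).
Proof.
move=> hu y.
apply: cmeas_ext (_ : cmeasurable (fun c => if A i (word_head y) then
    Num.conj (phase c (word_cons i y)) * (u c : l2 R (tail_word A w0)) (word_cons i y) else 0)) _ => //.
case: (A i (word_head y)); last exact: cmeas_cst.
by apply: cmeasM; [apply: cmeas_conj; exact: cmeas_phase|exact: hu].
Qed.

Lemma fiber_gen_trig i c (y : winding_word A w0) : fiber_gen i c (trig_section y c) =
  if A i (winding_head y) then trig_section (winding_cons hA i y) c else 0.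
Proof.
rewrite /fiber_gen /trig_section wcompZ gen_basis; case: ifP => _; last exact: scaler0.
rewrite scalerA phaseE -chiD.
by [].
Qed.

Lemma fiber_gen_adj_trig i c (y : winding_word A w0) : fiber_gen_adj i c (trig_section y c) =
  if winding_head y == i then trig_section (winding_tail hp hA y) c else 0.
Proof.
have hadj : mutual_adjoint (gen_data_adj (phase1 c) i) (gen_data (phase1 c) i).
  have [h1 h2 h3] := gen_mutual_adjoint (phase1 c) i; split => // x hx.
  by have [h4 h5] := h1 x hx; rewrite h3 // h5 conjCK.
rewrite /fiber_gen_adj /trig_section wcompZ (wcomp_e _ hadj) /=; case: eqP => [<-|_]; last exact: scaler0.
have [_ e] := word_tailP hp y.1; rewrite e scalerA; congr (_ *: _).
by rewrite phaseE chi_conj -chiD.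
Qed.

Variables (H : hilbertType R) (pi : O -> H -> H) (xK : tail_word A w0).
Hypothesis hpi : is_representation pi.
Variables (Om : H).
Hypothesis hcyc : cyclic_vector pi Om.
Hypothesis Om1 : `|Om| = 1.
Hypothesis horth : orthonormal_family
  (fun n : nat => pi (\prod_(k <- rev (mkseq (val xK) n.+1)) star (s k)) Om).
Local Notation chain_vec := (chain_vec s hp hA pi Om xK).
Local Notation fourier_graph := (@fourier_graph R N A w0 cx cinj eta H chain_vec).

Let he : orthonormal_family chain_vec.
Proof. exact: chain_vec_orth. Qed.
Let hd (h : H) (k : R) : 0 < k ->
  exists r : seq (R[i] * winding_word A w0), rnorm (h - \sum_(k <- r) k.1 *: chain_vec k.2) < k.
Proof. exact: chain_vec_dense. Qed.

(** The model space above each point of the circle, and H above the extra point. *)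
Definition joint_fiber (o : option C) : hilbertType R :=
  if o is Some _ then l2 R (tail_branching A hp) else H.

(** The two classes to preserve: measurable sections, and corresponding pairs of a
    section and a vector of H. *)
Definition joint_section (j : bool) : set (forall o, joint_fiber o) :=
  if j then fun u : forall o, joint_fiber o => @msection _ _ _ F (fun c => u (Some c))
  else fun u : forall o, joint_fiber o => fourier_graph (fun c => u (Some c)) (u None).

Lemma joint_section_lin j (a : R[i]) u v : joint_section j u -> joint_section j v ->
  joint_section j (fun c => a *: u c + v c).
Proof.
case: j => hu hv; first exact: (@msection_lin _ _ _ F).
exact: fourier_graph_lin.
Qed.

Lemma msection_relative_lim (u w : forall c, F c) :
  (forall e : R, 0 < e -> exists2 v : forall c, F c, msection v &
     forall c, rnorm (v c - w c) <= e * rnorm (u c)) -> msection w.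
Proof.
move=> h t.
have n0 n : 0 < n.+1%:R^-1 :> R by rewrite invr_gt0.
pose v n := proj1_sig (cid2 (h _ (n0 n))).
have [vm vb] : (forall n, msection (v n)) /\
    forall n c, rnorm (v n c - w c) <= n.+1%:R^-1 * rnorm (u c).
  by split=> n; rewrite /v; case: cid2.
apply: (@cmeas_lim _ _ _ (fun n c => (v n c : l2 R (tail_word A w0)) t)) => [n|c e e0].
  exact: vm.
have q : 0 < rnorm (u c) + 1 by rewrite ltr_wpDl ?rnorm_ge0.
have [m0 hm] := inv_small (divr_gt0 e0 q); exists m0 => n /hm hn.
rewrite -l2EB; apply: le_trans (l2_coord_le _ _) _; apply: le_trans (vb _ _) _.
apply: le_trans (_ : _ <= e / (rnorm (u c) + 1) * (rnorm (u c) + 1)) _.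
  by apply: ler_pM; rewrite ?invr_ge0 ?rnorm_ge0 ?lerDl // ltW.
by rewrite divfK // gt_eqF.
Qed.

(** A relative limit is pointwise, hence measurable, over the circle; it is also
    uniform relative to the L2 norm of u and to the norm of its vector, which keeps
    the pair in the closed graph. *)
Lemma joint_section_lim j u w : joint_section j u ->
    (forall e : R, 0 < e -> exists2 v, joint_section j v &
       forall c, rnorm (v c - w c) <= e * rnorm (u c)) -> joint_section j w.
Proof.
case: j => hu h.
  apply: (msection_relative_lim (u := fun c => u (Some c))) => e /h[v hv hb].
  by exists (fun c => v (Some c)) => [|c]; [exact: hv|exact: (hb (Some c))].
have Lu : L2 (fun c => u (Some c)) by case: hu.
have mw : @msection _ _ _ F (fun c => w (Some c)).
  apply: (msection_relative_lim (u := fun c => u (Some c))) => e /h[v [[hv _] _] hb].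
  by exists (fun c => v (Some c)) => [|c]; [exact: hv|exact: (hb (Some c))].
have Lvw (v : forall o, joint_fiber o) (e : R) : 0 < e -> fourier_graph (fun c => v (Some c)) (v None) ->
    (forall c, rnorm (v c - w c) <= e * rnorm (u c)) ->
    L2 (fun c => (w (Some c) : F c) - v (Some c)).
  move=> e0 [[hv _] _] hb; apply: (L2_le (v := fun c => e%:C *: (u (Some c) : F c))).
  - exact: (@msectionB _ _ _ F _ _ mw hv).
  - exact: (L2Z _ Lu).
  - by move=> c; rewrite rnormB rnormZ cabs_real ger0_norm ?(ltW e0) //; exact: (hb (Some c)).
have Lw : L2 (fun c => w (Some c)).
  have [v hv hb] := h 1 ltr01; have L1 := Lvw v 1 ltr01 hv hb.
  have [Lv _] := hv.
  by apply: (section_ext (P := L2) (L2D L1 Lv)) => c; exact: subrK.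
apply: fourier_graph_lim => // k k0.
have q : 0 < rnorm (u None) + 1 by rewrite ltr_wpDl ?rnorm_ge0.
have e0 := divr_gt0 k0 q; set e := k / _ in e0.
have [v hv hb] := h e e0.
have sm : e * rnorm (u None) <= k.
  apply: le_trans (_ : _ <= e * (rnorm (u None) + 1)) _.
    by apply: ler_wpM2l; [exact: ltW|rewrite lerDl].
  by rewrite divfK // gt_eqF.
exists (fun c => v (Some c)), (v None); split; first exact: hv.
  apply: le_trans sm; rewrite -(fourier_graph_iso heta he hu).
  have -> : e * nrm (fun c => u (Some c)) = nrm (fun c => e%:C *: (u (Some c) : F c)).
    by rewrite (L2normZ _ Lu) cabs_real ger0_norm //; exact: ltW.
  apply: L2norm_le; [exact: (Lvw v e)|exact: (L2Z _ Lu)|move=> c].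
  by rewrite rnormB rnormZ cabs_real ger0_norm ?(ltW e0) //; exact: (hb (Some c)).
by rewrite rnormB; exact: le_trans (hb None) sm.
Qed.

Definition joint_gen i (o : option C) : joint_fiber o -> joint_fiber o :=
  if o is Some c as o return joint_fiber o -> joint_fiber o then fiber_gen i c else pi (s i).
Definition joint_gen_adj i (o : option C) : joint_fiber o -> joint_fiber o :=
  if o is Some c as o return joint_fiber o -> joint_fiber o then fiber_gen_adj i c else pi (star (s i)).

Lemma fiber_gen_lin i c (a : R[i]) f g : fiber_gen i c (a *: f + g) = a *: fiber_gen i c f + fiber_gen i c g.
Proof. by rewrite /fiber_gen wcompD wcompZ. Qed.

Lemma fiber_gen_adj_lin i c (a : R[i]) f g : fiber_gen_adj i c (a *: f + g) = a *: fiber_gen_adj i c f + fiber_gen_adj i c g.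
Proof. by rewrite /fiber_gen_adj wcompD wcompZ. Qed.

Lemma gen_contraction i h : rnorm (pi (s i) h) <= rnorm h.
Proof.
have n1 : rnorm (pi (s i) h) ^+ 2 <= rnorm h * rnorm (pi (star (s i)) (pi (s i) h)).
  rewrite rnorm_sq (rep_star hpi).
  apply: le_trans (cauchy_schwarz _ _); apply: le_trans (Re_le_cabs _); exact: ler_norm.
have n2 := norm_star_le hO hpi i (pi (s i) h).
have [z|z] := eqVneq (rnorm (pi (s i) h)) 0; first by rewrite z rnorm_ge0.
have z0 : 0 < rnorm (pi (s i) h) by rewrite lt_neqAle eq_sym z rnorm_ge0.
rewrite -(ler_pM2r z0) -expr2; apply: le_trans n1 _.
by apply: ler_wpM2l n2; exact: rnorm_ge0.
Qed.

(** On basis elements both generators prepend the letter i, and the power of c counts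
    the winding number. *)
Lemma joint_gen_preserves i j u : joint_section j u -> joint_section j (fun o => joint_gen i (u o)).
Proof.
case: j; first by move=> hu; exact: (@fiber_gen_msection i (fun c => u (Some c))).
move=> hu; apply: (@fourier_graph_op _ _ _ _ _ _ _ _ _ (fiber_gen i) (pi (s i))) hu.
- exact: fiber_gen_lin.
- by move=> c f; exact: wcomp_norm.
- exact: fiber_gen_msection.
- exact: (rep_lin _ hpi).
- exact: gen_contraction.
move=> y; rewrite (chain_vec_s hO hp hA hpi Om1 horth); case h : (A i (winding_head y)).
  by apply: fourier_graph_ext (fourier_graph_e _ _ _ _) _ => c; rewrite fiber_gen_trig h.
by apply: fourier_graph_ext (fourier_graph_0 _ _ _) _ => c; rewrite fiber_gen_trig h.
Qed.

Lemma joint_gen_adj_preserves i j u : joint_section j u -> joint_section j (fun o => joint_gen_adj i (u o)).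
Proof.
case: j; first by move=> hu; exact: (@fiber_gen_adj_msection i (fun c => u (Some c))).
move=> hu; apply: (@fourier_graph_op _ _ _ _ _ _ _ _ _ (fiber_gen_adj i) (pi (star (s i)))) hu.
- exact: fiber_gen_adj_lin.
- by move=> c f; exact: wcomp_norm.
- exact: fiber_gen_adj_msection.
- exact: (rep_lin _ hpi).
- exact: (norm_star_le hO hpi i).
move=> y; rewrite (chain_vec_star hO hp hA hpi Om1 horth); case h : (winding_head y == i).
  by apply: fourier_graph_ext (fourier_graph_e _ _ _ _) _ => c; rewrite fiber_gen_adj_trig h.
by apply: fourier_graph_ext (fourier_graph_0 _ _ _) _ => c; rewrite fiber_gen_adj_trig h.
Qed.

Let Om0 : Om <> 0.
Proof. by move=> e; have := Om1; rewrite e normr0 => /eqP; rewrite eq_sym oner_eq0. Qed.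

Definition joint_ctx : section_ctx R := @SectionCtx R _ joint_fiber bool joint_section joint_section_lin joint_section_lim None Om Om0.

(** One morphism carries the fiber representations and pi together. Its component at
    the extra point is pi because both extend the same generators. *)
Lemma joint_rep : exists rho : forall o, O -> joint_fiber o -> joint_fiber o,
  [/\ forall o, is_representation (rho o),
      forall i c f, rho (Some c) (s i) f = fiber_gen i c f,
      forall a h, rho None a h = pi a h
    & forall a j u, joint_section j u -> joint_section j (fun o => rho o a (u o))].
Proof.
have [h1 h2 h3] := rep_ck hO hpi.
have hadj i : is_adjoint (X := joint_ctx) (joint_gen i) (joint_gen_adj i).
  by move=> [c|] x y; [exact: wcomp_adj (gen_mutual_adjoint _ i)|exact: (rep_star hpi)].
have [|||rho [hr hs hpr _]] := @ck_rep_family _ _ _ _ _ hO joint_ctx joint_gen joint_gen_adj hadj joint_gen_preserves joint_gen_adj_preserves.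
- by move=> i [c|] x; [exact: gen_partial_isometry|exact: h1].
- by move=> i [c|] x; [exact: gen_relation|exact: h2].
- by move=> [c|] x; [exact: gen_complete|exact: h3].
exists rho; split; first exact: hr.
- by move=> i c f; exact: (hs i (Some c) f).
- move=> a h; apply: (rep_unique hO (hr None) hpi) => i x.
  exact: (hs i None x).
exact: hpr.
Qed.

(** Preservation of the first class of sections says that the representations form a
    measurable field, preservation of the second that the correspondence intertwines
    them with pi. So the direct integral can be taken on H itself. *)
Lemma chain_decomposition : exists (F : hilbert_field R C)
    (pi_ : forall c : C, O -> F c -> F c) (L : hilbertType R) (rho : O -> L -> L),
  [/\ is_representation_field pi_,
      forall c : C, is_P_cycle s (mkseq w0 p) (val c) (pi_ c),
      is_direct_integral eta pi_ rho & unitarily_equivalent pi rho].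
Proof.
have [rho [hr hs hN hpr]] := joint_rep.
pose pi_ c a (f : F c) : F c := rho (Some c) a f.
exists F, pi_, H, pi; split.
- split; first by move=> c; exact: (hr (Some c)).
  move=> a u hu; exact: (hpr a true (fun o => if o is Some c then u c else 0) hu).
- move=> c; apply: (@cycle_model _ _ _ _ s _ _ hp hA (mkseq w0 p) (val c) (phase c) (phase1 c) (pi_ c)) => //.
  + exact: (hr (Some c)).
  + by move=> i f; exact: (hs i c f).
- split; first exact: hpi.
  pose cls u := if pselect (L2 u) is left h then proj1_sig (cid (fourier_graph_total heta he h)) else 0.
  have clsP u : L2 u -> fourier_graph u (cls u).
    by move=> hu; rewrite /cls; case: pselect => // h; case: cid.
  have clsE u h : fourier_graph u h -> cls u = h.
    by move=> hg; apply: (fourier_graph_unique heta he (clsP _ _) hg); case: hg.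
  exists cls; split.
  + by move=> a u v hu hv; apply: clsE; apply: fourier_graph_lin; exact: clsP.
  + move=> h; have [u hu] := fourier_graph_onto cinj heta he hd h.
    by exists u; [case: hu|exact: clsE].
  + by move=> u hu; rewrite -(fourier_graph_iso heta he (clsP _ hu)) L2norm_sq.
  move=> a u hu; apply/esym/clsE.
  pose U o : joint_fiber o := if o is Some c as o return joint_fiber o then u c else cls u.
  have := hpr a false U (clsP _ hu); rewrite /joint_section /U /= hN.
  by [].
exists id; split => //; first by move=> y; exists y.
Qed.

End decomposition.

(** * The canonical word of the decomposition *)

Theorem proposition5p5 (R : realType) (N : nat) (hN : (2 <= N)%N)
    (A : 'M[bool]_N) (hA : nonzero_lines A)
    (O : cstarAlgType R) (s : 'I_N -> O) (hO : is_cuntz_krieger A s)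
    (eta : probability (circle R) R) (heta : is_haar eta)
    (K : nat -> 'I_N) (hK : admissible_word A K)
    (hKper : eventually_periodic K) :
  exists! J : seq 'I_N,
    canonical_word A J /\
    forall (H : hilbertType R) (pi : O -> H -> H), is_P_chain s K pi ->
      exists (F : hilbert_field R (circle R))
             (pi_ : forall c : circle R, O -> F c -> F c)
             (L : hilbertType R) (rho : O -> L -> L),
        [/\ is_representation_field pi_,
            forall c : circle R, is_P_cycle s J (val c) (pi_ c),
            is_direct_integral eta pi_ rho
          & unitarily_equivalent pi rho].
Proof.
have [J [a [hJ ha]]] := canonical_exists hK hKper.
have [[J0 _] _ nJ] := hJ.
set w0 := repeat_word (K 0%N) J in ha.
have hp : minimal_period w0 (size J) by exact: nonperiodic_min.
have hw : admissible_word A w0 by move=> n; rewrite -!ha addnS; exact: hK.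
have tK : has_tail A w0 K by split => //; exists a.
exists J; split.
  split; first exact: hJ.
  move=> H pi [hpi [Om [hcyc Om1 horth]]].
  have [cx cinj] := tail_word_countable hp hw.
  have := @chain_decomposition _ _ _ _ _ hO _ _ hp hw _ cinj _ heta _ _ (mk_tail_word tK)
    hpi _ hcyc Om1 horth.
  by rewrite mkseq_repeat_word.
move=> J' [hJ' hdec].
have [H [pi hpi]] := chain_model hO hp hw hK ha.
have [F [pi_ [L [rho [h1 h2 h3 h4]]]]] := hdec H pi hpi.
have J0' : J' <> [::] by case: hJ' => [[]].
have [b [b' hb]] := decomposition_tail hO (K 0%N) J0' hpi h1 h2 h3 h4.
apply: (@canonical_unique _ _ (K 0%N) J J' b (b' + a)%N hJ hJ') => n.
by rewrite -/w0 -ha -addnA -hb addnCA.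
Qed.
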